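(* Let $A$ be a $C^*$-algebra, let $H$ be a Hilbertian $A$-module and let $P$ be a selfadjoint regular operator on $H$. Let $H^\infty=\bigcap_{k\in\mathbb N}\operatorname{dom}P^k$. Then for any $f\in C^\infty(\mathbb R,H^\infty)$ and any $g\in H^\infty$, the Cauchy problem $$\Big(\frac{\partial}{\partial t}+iP\Big)u=f,\qquad u(0)=g$$ has a unique solution $u$ in $C^\infty(\mathbb R,H^\infty)$, and it is given by $$u(t)=e^{-itP}g+\int_0^t e^{i(s-t)P}f(s)\,ds .$$
   Context: Selfadjoint regular operators on Hilbert $C^*$-modules are unbounded operators in the usual sense (Baaj, Woronowicz, Lance). For $k\in\mathbb N$, $H^k=\operatorname{dom}P^k$ is a Hilbert $A$-module for the scalar product $\langle u,v\rangle_k=\langle(1+P^2)^k u,v\rangle$. The space $H^\infty=\bigcap_k H^k$ is a Fréchet space for the seminorms $\|\cdot\|_{H^k}$, $k\ge 0$, and $C^\infty(\mathbb R,H^\infty)=\bigcap_k C^\infty(\mathbb R,H^k)$. The operator $e^{-itP}\in\mathcal L(H)$ is obtained by the continuous functional calculus of the selfadjoint regular operator $P$, applied to the function $\lambda\mapsto e^{-it\lambda}$. *)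

(* Defs.v *)
From Stdlib Require Import Reals ClassicalEpsilon.
From Coquelicot Require Import Coquelicot.
Open Scope R_scope.

(* C*-algebras are not assumed unital, so the product is not Coquelicot's
   [mult], which lives on unital rings. *)
Record CStarAlgebra := {
  csa_carrier :> CompleteNormedModule C_AbsRing;
  amul : csa_carrier -> csa_carrier -> csa_carrier;
  astar : csa_carrier -> csa_carrier;
  amul_assoc : forall a b c, amul a (amul b c) = amul (amul a b) c;
  amul_plus_l : forall a b c, amul (plus a b) c = plus (amul a c) (amul b c);
  amul_plus_r : forall a b c, amul a (plus b c) = plus (amul a b) (amul a c);
  amul_scal_l : forall (z : C) a b, amul (scal z a) b = scal z (amul a b);
  amul_scal_r : forall (z : C) a b, amul a (scal z b) = scal z (amul a b);
  astar_plus : forall a b, astar (plus a b) = plus (astar a) (astar b);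
  astar_scal : forall (z : C) a, astar (scal z a) = scal (Cconj z) (astar a);
  astar_mul : forall a b, astar (amul a b) = amul (astar b) (astar a);
  astar_involutive : forall a, astar (astar a) = a;
  norm_amul : forall a b, norm (amul a b) <= norm a * norm b;
  norm_cstar : forall a, norm (amul (astar a) a) = norm a * norm a
}.

Arguments amul {_} _ _.
Arguments astar {_} _.

Definition positive {A : CStarAlgebra} (a : A) : Prop :=
  exists b : A, a = amul (astar b) b.

(* Right Hilbert modules, with a scalar product conjugate-linear in its first
   variable.  Since the carrier is a complete normed module, [norm_inner] says
   both that the scalar product is definite and that the module is complete for
   the norm |x| = |<x,x>|^(1/2). *)
Record HilbertModule (A : CStarAlgebra) := {
  hm_carrier :> CompleteNormedModule C_AbsRing;
  ract : hm_carrier -> A -> hm_carrier;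
  inner : hm_carrier -> hm_carrier -> A;
  ract_amul : forall x a b, ract x (amul a b) = ract (ract x a) b;
  ract_plus_l : forall x y a, ract (plus x y) a = plus (ract x a) (ract y a);
  ract_plus_r : forall x a b, ract x (plus a b) = plus (ract x a) (ract x b);
  ract_scal_l : forall (z : C) x a, ract (scal z x) a = scal z (ract x a);
  ract_scal_r : forall (z : C) x a, ract x (scal z a) = scal z (ract x a);
  inner_plus_r : forall x y w, inner x (plus y w) = plus (inner x y) (inner x w);
  inner_scal_r : forall (z : C) x y, inner x (scal z y) = scal z (inner x y);
  inner_ract_r : forall x y a, inner x (ract y a) = amul (inner x y) a;
  inner_star : forall x y, astar (inner x y) = inner y x;
  inner_positive : forall x, positive (inner x x);
  norm_inner : forall x, norm x = sqrt (norm (inner x x))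
}.

Arguments ract {A} {_} _ _.
Arguments inner {A} {_} _ _.

(* Restriction of scalars from C to R, needed to integrate functions of a real
   variable with [RInt]; the underlying set, addition, balls and norm are
   unchanged. *)
Section RealScalars.
Variable V : CompleteNormedModule C_AbsRing.

Definition real_ModuleSpace_mixin : ModuleSpace.mixin_of R_Ring V.
Proof.
  apply (@ModuleSpace.Mixin R_Ring V (fun (r : R) (x : V) => scal (RtoC r) x)).
  - intros x y u. rewrite scal_assoc. f_equal. symmetry. apply RtoC_mult.
  - intros u. exact (scal_one u).
  - intros x u v. exact (scal_distr_l (RtoC x) u v).
  - intros x y u.
    exact (eq_trans (f_equal (fun z : C => scal z u) (RtoC_plus x y))
                    (scal_distr_r (RtoC x) (RtoC y) u)).
Defined.

Definition real_ModuleSpace : ModuleSpace R_Ring :=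
  ModuleSpace.Pack R_Ring V
    (ModuleSpace.Class R_Ring V (AbelianGroup.class V) real_ModuleSpace_mixin) V.

Definition real_NormedModuleAux : NormedModuleAux R_AbsRing :=
  NormedModuleAux.Pack R_AbsRing V
    (NormedModuleAux.Class R_AbsRing V
       (ModuleSpace.class _ real_ModuleSpace) (UniformSpace.class V)) V.

Definition real_NormedModule_mixin :
  NormedModule.mixin_of R_AbsRing real_NormedModuleAux.
Proof.
  apply (@NormedModule.Mixin R_AbsRing real_NormedModuleAux
           (fun x : V => norm x) (@norm_factor C_AbsRing V)).
  - exact (@norm_triangle C_AbsRing V).
  - intros l x. eapply Rle_trans.
    + exact (@norm_scal C_AbsRing V (RtoC l) x).
    + apply Rmult_le_compat_r; [ apply norm_ge_0 | ].
      apply Req_le. exact (Cmod_R l).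
  - exact (@norm_compat1 C_AbsRing V).
  - exact (@norm_compat2 C_AbsRing V).
  - exact (@norm_eq_zero C_AbsRing V).
Defined.

Definition real_NormedModule : NormedModule R_AbsRing :=
  NormedModule.Pack R_AbsRing V
    (NormedModule.Class R_AbsRing V
       (NormedModuleAux.class _ real_NormedModuleAux) real_NormedModule_mixin) V.

Definition real_scalars : CompleteNormedModule R_AbsRing :=
  CompleteNormedModule.Pack R_AbsRing V
    (CompleteNormedModule.Class R_AbsRing V
       (NormedModule.class _ real_NormedModule)
       (CompleteNormedModule.mixin C_AbsRing V
          (CompleteNormedModule.class C_AbsRing V))) V.

End RealScalars.

(* An unbounded operator is [app] restricted to [dom]; the values of [app]
   outside [dom] are irrelevant. *)
Record Operator {A : CStarAlgebra} (H : HilbertModule A) := {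
  dom : H -> Prop;
  app :> H -> H
}.

Arguments dom {A H} _ _.
Arguments app {A H} _ _.

Section Operators.
Context {A : CStarAlgebra} {H : HilbertModule A}.

Definition module_linear (T : Operator H) : Prop :=
  dom T zero /\
  (forall x y, dom T x -> dom T y ->
     dom T (plus x y) /\ T (plus x y) = plus (T x) (T y)) /\
  (forall (z : C) x, dom T x ->
     dom T (scal z x) /\ T (scal z x) = scal z (T x)) /\
  (forall x a, dom T x ->
     dom T (ract x a) /\ T (ract x a) = ract (T x) a).

Definition dense (D : H -> Prop) : Prop :=
  forall (x : H) (eps : posreal), exists y, D y /\ norm (minus x y) < eps.

Definition closed_operator (T : Operator H) : Prop :=
  forall (s : nat -> H) (x y : H),
    (forall n, dom T (s n)) ->
    filterlim s eventually (locally x) ->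
    filterlim (fun n => T (s n)) eventually (locally y) ->
    dom T x /\ T x = y.

(* The graph of T*, a function when T is densely defined: [y] is in the domain
   of T* and T* y = z. *)
Definition adjoint_graph (T : Operator H) (y z : H) : Prop :=
  forall x, dom T x -> inner (T x) y = inner x z.

Definition regular (T : Operator H) : Prop :=
  module_linear T /\
  dense (dom T) /\
  closed_operator T /\
  dense (fun y => exists z, adjoint_graph T y z) /\
  dense (fun w => exists x z,
           dom T x /\ adjoint_graph T (T x) z /\ w = plus x z).

Definition selfadjoint (T : Operator H) : Prop :=
  forall y z, adjoint_graph T y z <-> dom T y /\ T y = z.

Definition bounded_continuous (f : R -> C) : Prop :=
  (forall l, continuous f l) /\ exists M : R, forall l, Cmod (f l) <= M.

(* The resolvent condition reads Phi (1/(l + i)) = (P + i)^-1; together with the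
   *-homomorphism identities it determines Phi on bounded continuous functions.
   Values of Phi at other functions are irrelevant. *)
Definition is_functional_calculus (P : Operator H)
    (Phi : (R -> C) -> H -> H) : Prop :=
  (forall f, bounded_continuous f -> forall x y,
     inner (Phi f x) y = inner x (Phi (fun l => Cconj (f l)) y)) /\
  (forall f g, bounded_continuous f -> bounded_continuous g -> forall x,
     Phi (fun l => Cplus (f l) (g l)) x = plus (Phi f x) (Phi g x)) /\
  (forall (z : C) f, bounded_continuous f -> forall x,
     Phi (fun l => Cmult z (f l)) x = scal z (Phi f x)) /\
  (forall f g, bounded_continuous f -> bounded_continuous g -> forall x,
     Phi (fun l => Cmult (f l) (g l)) x = Phi f (Phi g x)) /\
  (forall x, Phi (fun _ => RtoC 1) x = x) /\
  (forall x, let y := Phi (fun l => Cinv (Cplus (RtoC l) Ci)) x in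
     dom P y /\ plus (P y) (scal Ci y) = x).

(* The continuous functional calculus f |-> f(P); [is_functional_calculus] has a
   solution, unique on bounded continuous functions, when P is regular and
   selfadjoint. *)
Definition cfc (P : Operator H) : (R -> C) -> H -> H :=
  epsilon (inhabits (fun _ x => x)) (is_functional_calculus P).

(* e^{itP} *)
Definition exp_i (P : Operator H) (t : R) : H -> H :=
  cfc P (fun l => (cos (t * l), sin (t * l))).

Fixpoint dom_pow (P : Operator H) (k : nat) (x : H) : Prop :=
  match k with
  | O => True
  | S k' => dom P x /\ dom_pow P k' (P x)
  end.

Definition Hinf (P : Operator H) (x : H) : Prop := forall k, dom_pow P k x.

(* (1 + P^2)^k u, meaningful for u in the domain of P^(2k) *)
Definition one_plus_sqr_pow (P : Operator H) (k : nat) (u : H) : H :=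
  Nat.iter k (fun v => plus v (P (P v))) u.

(* The H^k norm |<(1 + P^2)^k u, u>|^(1/2), used on H^oo only. *)
Definition Hnorm (P : Operator H) (k : nat) (u : H) : R :=
  sqrt (norm (inner (one_plus_sqr_pow P k u) u)).

(* u'(t) = v, the difference quotients converging in the Frechet space H^oo *)
Definition is_derive_Hinf (P : Operator H) (u : R -> H) (t : R) (v : H) : Prop :=
  Hinf P v /\
  forall k : nat,
    is_lim (fun h => Hnorm P k
              (minus (scal (RtoC (/ h)) (minus (u (t + h)) (u t))) v)) 0 0.

(* u is in C^oo(R, H^oo); [d n] is the n-th derivative. *)
Definition smooth_Hinf (P : Operator H) (u : R -> H) : Prop :=
  exists d : nat -> R -> H,
    (forall t, d 0%nat t = u t) /\
    (forall n t, Hinf P (d n t)) /\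
    (forall n t, is_derive_Hinf P (d n) t (d (S n) t)).

Definition solves_cauchy (P : Operator H) (f : R -> H) (g : H) (u : R -> H) :
    Prop :=
  (exists du : R -> H,
     (forall t, is_derive_Hinf P u t (du t)) /\
     (forall t, plus (du t) (scal Ci (P (u t))) = f t)) /\
  u 0 = g.

End Operators.

(* Main.v *)
(* Since [cfc] is defined by choice, the functional calculus has to be shown to exist.
   As |(P + i)x| = |(P - i)x| for x in dom P, the triangle inequality for
   2ix = (P + i)x - (P - i)x gives |x| <= |(P + i)x|; with regularity, P + i and P - i are
   bijective and U = (P - i)(P + i)^-1 is unitary.  For a trigonometric polynomial p of
   degree N, interpolation at the (2N+1)-st roots of unity gives
   |p(U)| <= (2N + 1) sup |p|; applied to the powers of p(U)^* p(U), it gives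
   |p(U)| <= 2 sup |p|.  Fejer means of f, transported to the circle by the Cayley
   transform, are bounded and converge to f locally uniformly, so that their values at U
   converge strongly, to f(P).

   For the Cauchy problem, the norm of H^k is |(P + i)^k u| on H^oo and e^(itP) commutes
   with P + i.  If y is differentiable with values in H^oo, then so is e^(ictP) y(t), with
   derivative e^(ictP) (y'(t) + icP y(t)).  The case c = -1,
   y(t) = g + int_0^t e^(isP) f(s) ds gives existence, and the case c = 1 applied to the
   difference of two solutions gives uniqueness. *)

Require Import Defs.
From Stdlib Require Import Reals Lra Lia ZArith List ClassicalEpsilon FunctionalExtensionality.
From Coquelicot Require Import Coquelicot.
Open Scope R_scope.

(** * Linear identities in complex vector spaces *)

(** No estimate uses the order of [A], and this shapes the proof. Cauchy-Schwarz is available only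
    with a factor 2, the bound |x| <= |(P + i)x| comes from the triangle inequality rather than from
    <Px, Px> + <x, x>, and bounds on p(U) are won from finite sums of unitaries. The resulting
    constants 2 are harmless, since only convergence is at stake.

    A bounded continuous function on the line need not have limits at infinity, so on the circle it
    may be discontinuous at 1 and admit no uniform approximation by trigonometric polynomials. But
    the symbol of (P + i)^-1 has modulus sin (t / 2) and vanishes at that very point: approximation
    with this weight is enough on the range of (P + i)^-1, which is dense, and the uniform bound on
    p(U) extends it to all vectors.

    The choice behind [cfc P] reveals nothing beyond the identities of [is_functional_calculus].
    Whatever is used about e^(itP), including linearity and norm bounds, is therefore derived from
    these identities and not from the construction that proves existence. *)

Ltac C_eq :=
  apply injective_projections;
  cbn -[Rmult Rplus Ropp Rinv Rminus Rdiv IZR INR cos sin sqrt].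

Inductive vexpr :=
| VVar (n : nat)
| VZero
| VPlus (a b : vexpr)
| VOpp (a : vexpr)
| VScal (z : C) (a : vexpr).

Fixpoint vcoef (e : vexpr) (i : nat) : C :=
  match e with
  | VVar n => if Nat.eqb n i then RtoC 1 else RtoC 0
  | VZero => RtoC 0
  | VPlus a b => Cplus (vcoef a i) (vcoef b i)
  | VOpp a => Copp (vcoef a i)
  | VScal z a => Cmult z (vcoef a i)
  end.

Section VectorExpressions.
Context {V : CompleteNormedModule C_AbsRing}.

Fixpoint vden (env : list V) (e : vexpr) : V :=
  match e with
  | VVar n => nth n env zero
  | VZero => zero
  | VPlus a b => plus (vden env a) (vden env b)
  | VOpp a => opp (vden env a)
  | VScal z a => scal z (vden env a)
  end.

Fixpoint vlin (env : list V) (c : nat -> C) : V :=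
  match env with
  | nil => zero
  | cons x env => plus (scal (c 0%nat) x) (vlin env (fun i => c (S i)))
  end.

Lemma vlin_zero (env : list V) : vlin env (fun _ => RtoC 0) = zero.
Proof.
induction env as [|x env IH]; cbn; [ reflexivity | ].
rewrite IH, plus_zero_r. exact (scal_zero_l x).
Qed.

Lemma vlin_plus (env : list V) (c d : nat -> C) :
  vlin env (fun i => Cplus (c i) (d i)) = plus (vlin env c) (vlin env d).
Proof.
revert c d; induction env as [|x env IH]; intros c d; cbn.
- now rewrite plus_zero_r.
- rewrite (IH (fun i => c (S i)) (fun i => d (S i))).
  replace (scal (Cplus (c 0%nat) (d 0%nat)) x)
    with (plus (scal (c 0%nat) x) (scal (d 0%nat) x))
    by (symmetry; exact (scal_distr_r (c 0%nat) (d 0%nat) x)).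
  rewrite <- !plus_assoc. f_equal. rewrite !plus_assoc. f_equal. apply plus_comm.
Qed.

Lemma vlin_scal (env : list V) (z : C) (c : nat -> C) :
  vlin env (fun i => Cmult z (c i)) = scal z (vlin env c).
Proof.
revert c; induction env as [|x env IH]; intros c; cbn.
- symmetry; exact (scal_zero_r z).
- rewrite (IH (fun i => c (S i))), scal_distr_l. f_equal.
  symmetry; exact (scal_assoc z (c 0%nat) x).
Qed.

Lemma vlin_var (env : list V) (n : nat) :
  vlin env (vcoef (VVar n)) = nth n env zero.
Proof.
revert n; induction env as [|x env IH]; intros [|n]; cbn; try reflexivity.
- rewrite vlin_zero, plus_zero_r. exact (scal_one x).
- rewrite <- (IH n). cbn.
  replace (scal (RtoC 0) x) with (@zero V) by (symmetry; exact (scal_zero_l x)).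
  apply plus_zero_l.
Qed.

Lemma vden_vlin (env : list V) (e : vexpr) : vden env e = vlin env (vcoef e).
Proof.
induction e as [n| |a IHa b IHb|a IHa|z a IHa]; cbn [vden vcoef].
- symmetry; apply vlin_var.
- symmetry; apply vlin_zero.
- rewrite IHa, IHb. symmetry; apply vlin_plus.
- rewrite IHa.
  transitivity (scal (Copp (RtoC 1)) (vlin env (vcoef a))).
  + symmetry; exact (scal_opp_one (vlin env (vcoef a))).
  + rewrite <- vlin_scal. f_equal. apply functional_extensionality; intros i.
    ring.
- rewrite IHa. symmetry; apply vlin_scal.
Qed.

Lemma vlin_ext (env : list V) (c d : nat -> C) :
  (forall i, (i < length env)%nat -> c i = d i) -> vlin env c = vlin env d.
Proof.
revert c d; induction env as [|x env IH]; intros c d E; cbn; [ reflexivity | ].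
rewrite (E 0%nat) by (cbn; lia). f_equal. apply IH; intros i Hi; apply E; cbn; lia.
Qed.

(** A bounded quantifier that unfolds by computation into one conjunct per atom, so that
    [repeat split] separates the scalar identities. *)
Fixpoint all_below (n : nat) (Q : nat -> Prop) : Prop :=
  match n with O => True | S m => Q 0%nat /\ all_below m (fun i => Q (S i)) end.

Lemma all_below_spec (n : nat) (Q : nat -> Prop) :
  all_below n Q -> forall i, (i < n)%nat -> Q i.
Proof.
revert Q; induction n as [|n IH]; intros Q Hq i Hi; [ lia | ].
destruct Hq as [H0 Hq]. destruct i as [|i]; [ exact H0 | ].
apply (IH (fun i => Q (S i)) Hq). lia.
Qed.

Lemma vden_eq (env : list V) (e1 e2 : vexpr) :
  all_below (length env) (fun i => vcoef e1 i = vcoef e2 i) ->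
  vden env e1 = vden env e2.
Proof.
intros E. rewrite !vden_vlin. apply vlin_ext. exact (all_below_spec _ _ E).
Qed.

End VectorExpressions.

Ltac mem_list x l :=
  lazymatch l with
  | nil => constr:(false)
  | cons x _ => constr:(true)
  | cons _ ?l' => mem_list x l'
  end.

Ltac index_list x l :=
  lazymatch l with
  | cons x _ => constr:(0%nat)
  | cons _ ?l' => let n := index_list x l' in constr:(S n)
  end.

Ltac vatoms t l :=
  lazymatch t with
  | plus ?a ?b => let l := vatoms a l in vatoms b l
  | minus ?a ?b => let l := vatoms a l in vatoms b l
  | opp ?a => vatoms a l
  | scal _ ?a => vatoms a l
  | zero => l
  | _ => let b := mem_list t l in
         lazymatch b with true => l | false => constr:(cons t l) end
  end.

Ltac vreify t l :=
  lazymatch t with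
  | plus ?a ?b => let a := vreify a l in let b := vreify b l in constr:(VPlus a b)
  | minus ?a ?b =>
      let a := vreify a l in let b := vreify b l in constr:(VPlus a (VOpp b))
  | opp ?a => let a := vreify a l in constr:(VOpp a)
  | scal ?z ?a => let a := vreify a l in constr:(VScal z a)
  | zero => constr:(VZero)
  | _ => let n := index_list t l in constr:(VVar n)
  end.

(* Reduces a linear identity between vectors to identities between the complex
   coefficients of the atomic vectors. *)
Ltac vlinear V :=
  lazymatch goal with
  | |- ?a = ?b =>
      let l := vatoms a (@nil V) in let l := vatoms b l in
      let ea := vreify a l in let eb := vreify b l in
      change (@vden V l ea = @vden V l eb); apply vden_eq;
      cbn [all_below length vcoef Nat.eqb]; repeat split
  end.

Ltac vring V := vlinear V; C_eq; first [ ring | field ].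

(** * Norms and inner products *)

(** Normed modules only provide the inequality <=; the reverse one is the same inequality for the
    scalar 1 / z and the vector z x. *)
Lemma norm_scal_C {V : CompleteNormedModule C_AbsRing} (z : C) (x : V) :
  norm (scal z x) = Cmod z * norm x.
Proof.
apply Rle_antisym; [ exact (norm_scal z x) | ].
destruct (Ceq_dec z (RtoC 0)) as [->|Hz].
- rewrite Cmod_0, Rmult_0_l. apply norm_ge_0.
- assert (Hm : 0 < Cmod z) by now apply Cmod_gt_0.
  assert (E : x = scal (Cinv z) (scal z x)).
  { rewrite scal_assoc.
    transitivity (scal (RtoC 1) x); [ vring V | ].
    f_equal. symmetry. exact (Cinv_l z Hz). }
  apply Rle_trans with (Cmod z * (Cmod (Cinv z) * norm (scal z x))).
  + apply Rmult_le_compat_l; [ lra | ]. rewrite E at 1. exact (norm_scal (Cinv z) _).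
  + rewrite Cmod_inv by exact Hz. right. field. lra.
Qed.

Lemma norm_opp_C {V : CompleteNormedModule C_AbsRing} (x : V) :
  norm (opp x) = norm x.
Proof.
transitivity (norm (scal (Copp (RtoC 1)) x)); [ f_equal; vring V | ].
rewrite norm_scal_C, Cmod_opp, Cmod_1. apply Rmult_1_l.
Qed.

Lemma norm_plus_le {V : CompleteNormedModule C_AbsRing} (x y : V) :
  norm (plus x y) <= norm x + norm y.
Proof. exact (norm_triangle x y). Qed.

Lemma norm_minus_le {V : CompleteNormedModule C_AbsRing} (x y : V) :
  norm (minus x y) <= norm x + norm y.
Proof. rewrite <- (norm_opp_C y). exact (norm_triangle x (opp y)). Qed.

Lemma norm_minus_sym {V : CompleteNormedModule C_AbsRing} (x y : V) :
  norm (minus x y) = norm (minus y x).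
Proof. rewrite <- norm_opp_C. f_equal. vring V. Qed.

Lemma norm_minus_trans {V : CompleteNormedModule C_AbsRing} (y x z : V) :
  norm (minus x z) <= norm (minus x y) + norm (minus y z).
Proof.
replace (minus x z) with (plus (minus x y) (minus y z)) by vring V.
apply norm_plus_le.
Qed.

Lemma norm_le_eq {V : CompleteNormedModule C_AbsRing} (y x : V) (r : R) :
  x = y -> norm y <= r -> norm x <= r.
Proof. now intros ->. Qed.

Lemma norm_scal_le {V : CompleteNormedModule C_AbsRing} (z : C) (x : V) (r : R) :
  Cmod z * norm x <= r -> norm (scal z x) <= r.
Proof. intros E. now rewrite norm_scal_C. Qed.

Lemma norm_plus_le2 {V : CompleteNormedModule C_AbsRing} (x y : V) (a b : R) :
  norm x <= a -> norm y <= b -> norm (plus x y) <= a + b.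
Proof. intros Ha Hb. pose proof (norm_plus_le x y). lra. Qed.

Lemma norm_le_zero {V : CompleteNormedModule C_AbsRing} (x : V) :
  norm x <= 0 -> x = zero.
Proof.
intros E. exact (norm_eq_zero x (Rle_antisym _ _ E (norm_ge_0 x))).
Qed.

Lemma norm_zero_C {V : CompleteNormedModule C_AbsRing} : norm (@zero V) = 0.
Proof. exact (@norm_zero C_AbsRing V). Qed.

Lemma norm_minus_zero {V : CompleteNormedModule C_AbsRing} (x y : V) :
  norm (minus x y) <= 0 -> x = y.
Proof.
intros E. assert (E0 : minus x y = zero)
  by now apply norm_le_zero.
transitivity (plus (minus x y) y); [ vring V | rewrite E0; vring V ].
Qed.

Section HilbertModules.
Context {A : CStarAlgebra} {H : HilbertModule A}.

Lemma inner_plus_l (x y w : H) : inner (plus x y) w = plus (inner x w) (inner y w).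
Proof.
rewrite <- (inner_star _ H w (plus x y)), (inner_plus_r _ H w x y), astar_plus.
now rewrite !inner_star.
Qed.

Lemma inner_scal_l (z : C) (x y : H) :
  inner (scal z x) y = scal (Cconj z) (inner x y).
Proof.
rewrite <- (inner_star _ H y (scal z x)), (inner_scal_r _ H z y x), astar_scal.
now rewrite !inner_star.
Qed.

Lemma inner_ract_l (x y : H) (a : A) :
  inner (ract x a) y = amul (astar a) (inner x y).
Proof.
rewrite <- (inner_star _ H y (ract x a)), (inner_ract_r _ H y x a), astar_mul.
now rewrite !inner_star.
Qed.

Lemma inner_opp_r (x y : H) : inner x (opp y) = opp (inner x y).
Proof.
transitivity (inner x (scal (Copp (RtoC 1)) y)).
- f_equal. vring H.
- rewrite inner_scal_r. vring A.
Qed.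

Lemma inner_opp_l (x y : H) : inner (opp x) y = opp (inner x y).
Proof.
transitivity (inner (scal (Copp (RtoC 1)) x) y).
- f_equal. vring H.
- rewrite inner_scal_l. vring A.
Qed.

Lemma inner_minus_l (x y w : H) : inner (minus x y) w = minus (inner x w) (inner y w).
Proof. unfold minus. now rewrite inner_plus_l, inner_opp_l. Qed.

Lemma inner_minus_r (x y w : H) : inner x (minus y w) = minus (inner x y) (inner x w).
Proof. unfold minus. now rewrite inner_plus_r, inner_opp_r. Qed.

Lemma inner_zero_l (y : H) : inner zero y = zero.
Proof.
transitivity (inner (scal (RtoC 0) (@zero H)) y).
- f_equal. vring H.
- rewrite inner_scal_l. vring A.
Qed.

Lemma inner_zero_r (y : H) : inner y zero = zero.
Proof.
transitivity (inner y (scal (RtoC 0) (@zero H))).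
- f_equal. vring H.
- rewrite inner_scal_r. vring A.
Qed.

Lemma norm_sqr (x : H) : norm x * norm x = norm (inner x x).
Proof.
rewrite (norm_inner _ H x). apply sqrt_sqrt, norm_ge_0.
Qed.

(** The C*-identity gives |b|^2 = |b^* b| <= |b^*| |b|; after cancelling |b|, take b = a and b =
    a^*. *)
Lemma norm_astar (a : A) : norm (astar a) = norm a.
Proof.
assert (L : forall b : A, norm b <= norm (astar b)).
{ intros b. destruct (Rle_lt_dec (norm b) 0) as [H0|H0].
  - apply Rle_trans with 0; [ exact H0 | apply norm_ge_0 ].
  - apply Rmult_le_reg_r with (norm b); [ exact H0 | ].
    rewrite <- norm_cstar. apply norm_amul. }
apply Rle_antisym; [ | apply L ].
rewrite <- (astar_involutive A a) at 2. apply L.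
Qed.

Lemma norm_ract (x : H) (a : A) : norm (ract x a) <= norm x * norm a.
Proof.
apply Rsqr_incr_0_var; [ | apply Rmult_le_pos; apply norm_ge_0 ].
unfold Rsqr. rewrite norm_sqr, inner_ract_l, inner_ract_r.
eapply Rle_trans; [ apply norm_amul | ]. rewrite norm_astar.
apply Rle_trans with (norm a * (norm (inner x x) * norm a)).
- apply Rmult_le_compat_l; [ apply norm_ge_0 | apply norm_amul ].
- rewrite <- norm_sqr. right. ring.
Qed.

(* With a = <x,y>, polarization reads
   4 t a*a = <xa + ty, xa + ty> - <xa - ty, xa - ty>;
   the factor 2 is the price for not using the order of A. *)
Lemma cauchy_schwarz_weak (x y : H) :
  norm (inner x y) <= 2 * (norm x * norm y).
Proof.
set (a := inner x y).
pose proof (norm_ge_0 x) as Hx. pose proof (norm_ge_0 y) as Hy.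
pose proof (norm_ge_0 a) as Ha.
destruct (Rle_lt_dec (norm a) 0) as [Ha0|Ha0].
{ apply Rle_trans with 0; [ exact Ha0 | ].
  apply Rmult_le_pos; [ lra | now apply Rmult_le_pos ]. }
assert (B : forall t, 0 < t ->
  4 * t * (norm a * norm a) <=
    2 * ((norm x * norm a + t * norm y) * (norm x * norm a + t * norm y))).
{ intros t Ht.
  set (p := plus (ract x a) (scal (RtoC t) y)).
  set (q := minus (ract x a) (scal (RtoC t) y)).
  assert (Hp : norm p <= norm x * norm a + t * norm y).
  { eapply Rle_trans; [ apply norm_plus_le | ].
    apply Rplus_le_compat; [ apply norm_ract | ].
    apply norm_scal_le; rewrite Cmod_R, Rabs_pos_eq; lra. }
  assert (Hq : norm q <= norm x * norm a + t * norm y).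
  { eapply Rle_trans; [ apply norm_minus_le | ].
    apply Rplus_le_compat; [ apply norm_ract | ].
    apply norm_scal_le; rewrite Cmod_R, Rabs_pos_eq; lra. }
  assert (E : scal (RtoC (4 * t)) (amul (astar a) a) = minus (inner p p) (inner q q)).
  { unfold p, q, minus.
    rewrite !inner_plus_l, !inner_plus_r, !inner_opp_l, !inner_opp_r,
      !inner_scal_l, !inner_scal_r, !inner_ract_l, !inner_ract_r.
    rewrite <- (inner_star _ H x y). fold a. vring A. }
  rewrite <- norm_cstar.
  replace (4 * t) with (Cmod (RtoC (4 * t)))
    by (rewrite Cmod_R; apply Rabs_pos_eq; lra).
  rewrite <- norm_scal_C, E.
  eapply Rle_trans; [ apply norm_minus_le | ].
  rewrite <- !norm_sqr.
  assert (norm p * norm p <= (norm x * norm a + t * norm y) * (norm x * norm a + t * norm y))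
    by (apply Rmult_le_compat; try apply norm_ge_0; assumption).
  assert (norm q * norm q <= (norm x * norm a + t * norm y) * (norm x * norm a + t * norm y))
    by (apply Rmult_le_compat; try apply norm_ge_0; assumption).
  lra. }
destruct (Rle_lt_dec (norm y) 0) as [Hy0|Hy0].
{ assert (E : y = zero) by (apply norm_le_zero; lra).
  assert (Ea : a = zero) by (unfold a; rewrite E; apply inner_zero_r).
  rewrite Ea, norm_zero_C in Ha0. lra. }
destruct (Rle_lt_dec (norm x) 0) as [Hx0|Hx0].
{ assert (E : x = zero) by (apply norm_le_zero; lra).
  assert (Ea : a = zero) by (unfold a; rewrite E; apply inner_zero_l).
  rewrite Ea, norm_zero_C in Ha0. lra. }
(* This t makes the two terms |x| |a| and t |y| equal, which minimizes the right-hand side of [B]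
   divided by t. *)
set (t := norm x * norm a / norm y).
assert (Ht : 0 < t)
  by (apply Rdiv_lt_0_compat; [ now apply Rmult_lt_0_compat | assumption ]).
specialize (B t Ht).
assert (Et : t * norm y = norm x * norm a) by (unfold t; field; lra).
rewrite Et in B.
apply Rmult_le_reg_l with (t * norm a); [ now apply Rmult_lt_0_compat | ].
apply Rmult_le_reg_l with 4; [ lra | ].
replace (4 * (t * norm a * norm a)) with (4 * t * (norm a * norm a)) by ring.
eapply Rle_trans; [ exact B | ].
replace (4 * (t * norm a * (2 * (norm x * norm y))))
  with (8 * (t * norm y) * norm x * norm a) by ring.
rewrite Et. right. ring.
Qed.

End HilbertModules.

(** * Norm convergence of sequences and completeness *)

Section Convergence.
Context {V : CompleteNormedModule C_AbsRing}.

Definition conv (s : nat -> V) (l : V) : Prop :=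
  is_lim_seq (fun n => norm (minus (s n) l)) 0.

Lemma is_lim_seq_squeeze0 (a b : nat -> R) :
  (forall n, 0 <= a n <= b n) -> is_lim_seq b 0 -> is_lim_seq a 0.
Proof.
intros Hab Hb. apply (is_lim_seq_le_le (fun _ => 0) a b 0 Hab); [ | exact Hb ].
apply is_lim_seq_const.
Qed.

Lemma is_lim_seq0_plus (a b : nat -> R) :
  is_lim_seq a 0 -> is_lim_seq b 0 -> is_lim_seq (fun n => a n + b n) 0.
Proof. intros Ha Hb. rewrite <- (Rplus_0_r 0). now apply is_lim_seq_plus'. Qed.

Lemma is_lim_seq0_scal (c : R) (a : nat -> R) :
  is_lim_seq a 0 -> is_lim_seq (fun n => c * a n) 0.
Proof.
intros Ha. rewrite <- (Rmult_0_r c). apply (is_lim_seq_scal_l a c 0 Ha).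
Qed.

Lemma is_lim_seq0_eps (a : nat -> R) :
  (forall n, 0 <= a n) ->
  (is_lim_seq a 0 <->
   forall eps, 0 < eps -> exists N, forall n, (N <= n)%nat -> a n <= eps).
Proof.
intros Ha. split.
- intros Hl eps Heps. apply is_lim_seq_spec in Hl.
  destruct (Hl (mkposreal eps Heps)) as [N HN]. exists N. intros n Hn.
  specialize (HN n Hn). cbn in HN. rewrite Rminus_0_r, Rabs_pos_eq in HN by apply Ha.
  lra.
- intros Hl. apply is_lim_seq_spec. intros eps.
  destruct (Hl (pos eps / 2)) as [N HN]; [ destruct eps; cbn; lra | ].
  exists N. intros n Hn. specialize (HN n Hn).
  rewrite Rminus_0_r, Rabs_pos_eq by apply Ha. destruct eps; cbn in *; lra.
Qed.

Lemma conv_le (s : nat -> V) (l : V) (b : nat -> R) :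
  (forall n, norm (minus (s n) l) <= b n) -> is_lim_seq b 0 -> conv s l.
Proof.
intros Hb. apply is_lim_seq_squeeze0. intros n. split; [ apply norm_ge_0 | apply Hb ].
Qed.

Lemma conv_eps (s : nat -> V) (l : V) :
  conv s l <-> forall eps, 0 < eps ->
    exists N, forall n, (N <= n)%nat -> norm (minus (s n) l) <= eps.
Proof. apply is_lim_seq0_eps. intros n. apply norm_ge_0. Qed.

Lemma conv_filterlim (s : nat -> V) (l : V) :
  conv s l -> filterlim s eventually (locally l).
Proof.
intros Hs.
apply (proj2 (@filterlim_locally_ball_norm C_AbsRing nat V eventually _ s l)).
intros eps. apply is_lim_seq_spec in Hs. destruct (Hs eps) as [N HN].
exists N. intros n Hn. specialize (HN n Hn).
rewrite Rminus_0_r, Rabs_pos_eq in HN by apply norm_ge_0. exact HN.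
Qed.

Lemma conv_const (l : V) : conv (fun _ => l) l.
Proof.
apply conv_le with (fun _ => 0); [ | apply is_lim_seq_const ].
intros n. replace (minus l l) with (@zero V) by vring V. rewrite norm_zero_C. lra.
Qed.

Lemma conv_plus (s t : nat -> V) (l m : V) :
  conv s l -> conv t m -> conv (fun n => plus (s n) (t n)) (plus l m).
Proof.
intros Hs Ht.
apply conv_le with (fun n => norm (minus (s n) l) + norm (minus (t n) m)).
- intros n.
  apply (norm_le_eq (plus (minus (s n) l) (minus (t n) m))); [ vring V | ].
  apply norm_plus_le.
- now apply is_lim_seq0_plus.
Qed.

Lemma conv_scal (z : C) (s : nat -> V) (l : V) :
  conv s l -> conv (fun n => scal z (s n)) (scal z l).
Proof.
intros Hs. apply conv_le with (fun n => Cmod z * norm (minus (s n) l)).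
- intros n.
  apply (norm_le_eq (scal z (minus (s n) l))); [ vring V | ].
  apply norm_scal_le. lra.
- now apply is_lim_seq0_scal.
Qed.

Lemma conv_unique (s : nat -> V) (l m : V) : conv s l -> conv s m -> l = m.
Proof.
intros Hl Hm. apply norm_minus_zero.
assert (L : is_lim_seq (fun n => norm (minus (s n) l) + norm (minus (s n) m)) 0)
  by now apply is_lim_seq0_plus.
apply (is_lim_seq_le (fun _ => norm (minus l m)) _ (norm (minus l m)) 0) in L.
- exact L.
- intros n. rewrite (norm_minus_sym (s n) l). apply norm_minus_trans.
- apply is_lim_seq_const.
Qed.

(** Completeness is an axiom about Cauchy filters for the uniform structure; the work is to pass
    from norms to balls for the hypothesis and back from balls to norms for the limit. *)
Lemma conv_complete (s : nat -> V) :
  (forall eps, 0 < eps -> exists N, forall n m, (N <= n)%nat -> (N <= m)%nat ->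
     norm (minus (s n) (s m)) <= eps) ->
  exists l, conv s l.
Proof.
intros Hc. set (F := filtermap s eventually).
assert (PF : ProperFilter F) by (apply filtermap_proper_filter, eventually_filter).
assert (CF : @cauchy V F).
{ intros eps. destruct (Hc (pos eps / 2)) as [N HN]; [ destruct eps; cbn; lra | ].
  exists (s N). exists N. intros n Hn.
  apply (@norm_compat1 C_AbsRing V).
  apply Rle_lt_trans with (pos eps / 2); [ | destruct eps; cbn; lra ].
  apply HN; [ exact Hn | apply le_n ]. }
pose proof (@complete_cauchy V F PF CF) as L.
exists (@Hierarchy.lim V F). apply conv_eps. intros eps Heps.
assert (Q : @locally_norm C_AbsRing V (@Hierarchy.lim V F)
  (fun y => norm (minus y (@Hierarchy.lim V F)) <= eps)).
{ exists (mkposreal eps Heps). intros y Hy. apply Rlt_le. exact Hy. }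
destruct (@locally_le_locally_norm C_AbsRing V _ _ Q) as [d Hd].
destruct (L d) as [N HN]. exists N. intros n Hn. apply Hd. exact (HN n Hn).
Qed.

End Convergence.

(** * Resolvents and the Cayley transform *)

Section Resolvents.
Context {A : CStarAlgebra} {H : HilbertModule A} (P : Operator H).
Hypothesis (Preg : regular P) (Psa : selfadjoint P).

Definition shift (z : C) (x : H) : H := plus (P x) (scal z x).

(** Treating i and -i together yields the Cayley transform and its inverse from the same lemmas. *)
Definition imaginary_unit (z : C) : Prop := z = Ci \/ z = Copp Ci.

Lemma dom_plus (x y : H) : dom P x -> dom P y -> dom P (plus x y).
Proof. intros Hx Hy. destruct Preg as [[_ [L _]] _]. apply (L x y Hx Hy). Qed.

Lemma app_plus (x y : H) :
  dom P x -> dom P y -> P (plus x y) = plus (P x) (P y).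
Proof. intros Hx Hy. destruct Preg as [[_ [L _]] _]. apply (L x y Hx Hy). Qed.

Lemma dom_scal (z : C) (x : H) : dom P x -> dom P (scal z x).
Proof. intros Hx. destruct Preg as [[_ [_ [L _]]] _]. apply (L z x Hx). Qed.

Lemma app_scal (z : C) (x : H) : dom P x -> P (scal z x) = scal z (P x).
Proof. intros Hx. destruct Preg as [[_ [_ [L _]]] _]. apply (L z x Hx). Qed.

Lemma minus_scal (x y : H) : minus x y = plus x (scal (Copp (RtoC 1)) y).
Proof. vring H. Qed.

Lemma dom_minus (x y : H) : dom P x -> dom P y -> dom P (minus x y).
Proof. intros Hx Hy. rewrite minus_scal. apply dom_plus, dom_scal; assumption. Qed.

Lemma app_minus (x y : H) :
  dom P x -> dom P y -> P (minus x y) = minus (P x) (P y).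
Proof.
intros Hx Hy. rewrite !minus_scal, app_plus, app_scal;
  try apply dom_scal; try assumption. reflexivity.
Qed.

Lemma symmetric (x y : H) : dom P x -> dom P y -> inner (P x) y = inner x (P y).
Proof. intros Hx Hy. apply (proj2 (Psa y (P y)) (conj Hy eq_refl) x Hx). Qed.

Lemma shift_plus (z : C) (x y : H) : dom P x -> dom P y ->
  shift z (plus x y) = plus (shift z x) (shift z y).
Proof. intros Hx Hy. unfold shift. rewrite app_plus by assumption. vring H. Qed.

Lemma shift_scal (z c : C) (x : H) : dom P x ->
  shift z (scal c x) = scal c (shift z x).
Proof. intros Hx. unfold shift. rewrite app_scal by assumption. vring H. Qed.

Lemma shift_minus (z : C) (x y : H) : dom P x -> dom P y ->
  shift z (minus x y) = minus (shift z x) (shift z y).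
Proof. intros Hx Hy. unfold shift. rewrite app_minus by assumption. vring H. Qed.

(** The cross terms add up to (z + conj z) <x, Py>, which vanishes because z is imaginary. The
    right-hand side is the same for i and -i, which is the source of unitarity. *)
Lemma inner_shift (z : C) (x y : H) : imaginary_unit z -> dom P x -> dom P y ->
  inner (shift z x) (shift z y) = plus (inner (P x) (P y)) (inner x y).
Proof.
intros Hz Hx Hy. unfold shift.
rewrite !inner_plus_l, !inner_plus_r, !inner_scal_l, !inner_scal_r.
rewrite (symmetric x y) by assumption.
destruct Hz as [-> | ->]; vring A.
Qed.

Lemma norm_shift_eq (z w : C) (x : H) :
  imaginary_unit z -> imaginary_unit w -> dom P x -> norm (shift z x) = norm (shift w x).
Proof.
intros Hz Hw Hx. rewrite !(norm_inner _ H). now rewrite !inner_shift.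
Qed.

Lemma imaginary_unit_opp (z : C) : imaginary_unit z -> imaginary_unit (Copp z).
Proof.
intros [-> | ->]; [ right; reflexivity | left ]. C_eq; ring.
Qed.

Lemma Cmod_imaginary_unit (z : C) : imaginary_unit z -> Cmod z = 1.
Proof.
intros [-> | ->]; rewrite ?Cmod_opp; unfold Cmod, Ci; cbn -[sqrt];
  (transitivity (sqrt 1); [ f_equal; ring | exact sqrt_1 ]).
Qed.

Lemma norm_le_shift (z : C) (x : H) :
  imaginary_unit z -> dom P x -> norm x <= norm (shift z x).
Proof.
intros Hz Hx. pose proof (imaginary_unit_opp z Hz) as Hz'.
apply Rmult_le_reg_l with 2; [ lra | ].
apply Rle_trans with (norm (minus (shift z x) (shift (Copp z) x))).
- apply Rle_trans with (norm (scal (Cmult (RtoC 2) z) x)).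
  + rewrite norm_scal_C, Cmod_mult, Cmod_R, (Cmod_imaginary_unit z Hz), Rabs_pos_eq; lra.
  + right. f_equal. unfold shift. vring H.
- eapply Rle_trans; [ apply norm_minus_le | ].
  rewrite (norm_shift_eq (Copp z) z) by assumption. lra.
Qed.

(** Since z^2 = -1, (P + z)(P - z) = 1 + P^2, and this is 1 + P^*P, whose range is dense by
    regularity. *)
Lemma shift_dense (z : C) : imaginary_unit z ->
  dense (fun w => exists y, dom P y /\ w = shift z y).
Proof.
intros Hz w eps. destruct Preg as [_ [_ [_ [_ D]]]].
destruct (D w eps) as [v [[x [y [Hx [Hy ->]]]] Hv]].
apply Psa in Hy. destruct Hy as [HPx <-].
exists (plus x (P (P x))). split; [ | exact Hv ].
exists (shift (Copp z) x). split.
- apply dom_plus; [ assumption | now apply dom_scal ].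
- unfold shift. rewrite app_plus, app_scal; try assumption; [ | now apply dom_scal ].
  destruct Hz as [-> | ->]; vring H.
Qed.

(** The range is dense, and it is closed: by [norm_le_shift], preimages of a convergent sequence
    form a Cauchy sequence, and the graph of P is closed. *)
Lemma shift_surjective (z : C) : imaginary_unit z ->
  forall w, exists y, dom P y /\ shift z y = w.
Proof.
intros Hz w.
assert (C0 : forall n : nat, exists y,
  dom P y /\ norm (minus (shift z y) w) <= / (INR n + 1)).
{ intros n. assert (Hn : 0 < / (INR n + 1)) by apply RinvN_pos.
  destruct (shift_dense z Hz w (mkposreal _ Hn)) as [v [[y [Hy ->]] Hv]].
  exists y. split; [ exact Hy | ]. rewrite norm_minus_sym. apply Rlt_le. exact Hv. }
set (s := fun n => proj1_sig (constructive_indefinite_description _ (C0 n))).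
assert (Hs : forall n, dom P (s n) /\ norm (minus (shift z (s n)) w) <= / (INR n + 1))
  by (intros n; exact (proj2_sig (constructive_indefinite_description _ (C0 n)))).
assert (Lw : conv (fun n => shift z (s n)) w).
{ apply conv_le with (fun n => / (INR n + 1)); [ apply Hs | ].
  apply is_lim_seq_spec. intros eps.
  destruct (archimed_cor1 eps (cond_pos eps)) as [N [HN HN0]].
  exists N. intros n Hn. rewrite Rminus_0_r, Rabs_pos_eq.
  - apply Rle_lt_trans with (/ INR N); [ | exact HN ].
    apply Rinv_le_contravar; [ now apply lt_0_INR | ].
    apply le_INR in Hn. lra.
  - apply Rlt_le, RinvN_pos. }
destruct (conv_complete s) as [y Hy].
{ intros eps Heps.
  destruct (proj1 (conv_eps _ _) Lw (eps / 2)) as [N HN]; [ lra | ].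
  exists N. intros n m Hn Hm.
  eapply Rle_trans; [ apply (norm_le_shift z _ Hz) | ].
  - apply dom_minus; apply Hs.
  - rewrite shift_minus by apply Hs.
    eapply Rle_trans; [ apply (norm_minus_trans w) | ].
    rewrite (norm_minus_sym w). specialize (HN n Hn) as Hn'. specialize (HN m Hm) as Hm'.
    lra. }
destruct Preg as [_ [_ [Cl _]]].
destruct (Cl s y (minus w (scal z y))) as [Dy Ey].
- apply Hs.
- now apply conv_filterlim.
- apply conv_filterlim.
  (* Closedness asks for convergence of P s_n, obtained as the difference of (P + z) s_n and z
     s_n. *)
  assert (L : conv (fun n => plus (shift z (s n)) (scal (Copp (RtoC 1)) (scal z (s n))))
                (plus w (scal (Copp (RtoC 1)) (scal z y)))).
  { apply conv_plus; [ exact Lw | ]. now apply conv_scal, conv_scal. }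
  rewrite <- minus_scal in L.
  apply is_lim_seq_ext with (2 := L). intros n. f_equal. f_equal. unfold shift. vring H.
- exists y. split; [ exact Dy | ]. unfold shift. rewrite Ey. vring H.
Qed.

Definition resolvent (z : C) (x : H) : H :=
  epsilon (inhabits zero) (fun y => dom P y /\ shift z y = x).

Lemma dom_resolvent (z : C) (x : H) : imaginary_unit z -> dom P (resolvent z x).
Proof.
intros Hz. apply (epsilon_spec (inhabits zero) _ (shift_surjective z Hz x)).
Qed.

Lemma shift_resolvent (z : C) (x : H) :
  imaginary_unit z -> shift z (resolvent z x) = x.
Proof.
intros Hz. apply (epsilon_spec (inhabits zero) _ (shift_surjective z Hz x)).
Qed.

Lemma shift_injective (z : C) (x y : H) : imaginary_unit z ->
  dom P x -> dom P y -> shift z x = shift z y -> x = y.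
Proof.
intros Hz Hx Hy E. apply norm_minus_zero.
eapply Rle_trans; [ apply (norm_le_shift z _ Hz); now apply dom_minus | ].
rewrite shift_minus, E by assumption.
apply (norm_le_eq zero); [ vring H | ]. rewrite norm_zero_C. lra.
Qed.

Lemma resolvent_shift (z : C) (x : H) : imaginary_unit z -> dom P x ->
  resolvent z (shift z x) = x.
Proof.
intros Hz Hx. apply (shift_injective z); try assumption.
- now apply dom_resolvent.
- now apply shift_resolvent.
Qed.

Lemma resolvent_plus (z : C) (x y : H) : imaginary_unit z ->
  resolvent z (plus x y) = plus (resolvent z x) (resolvent z y).
Proof.
intros Hz. pose proof (dom_resolvent z x Hz). pose proof (dom_resolvent z y Hz).
rewrite <- (resolvent_shift z (plus (resolvent z x) (resolvent z y)) Hz)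
  by now apply dom_plus.
rewrite shift_plus by assumption. now rewrite !shift_resolvent.
Qed.

Lemma resolvent_scal (z c : C) (x : H) : imaginary_unit z ->
  resolvent z (scal c x) = scal c (resolvent z x).
Proof.
intros Hz. pose proof (dom_resolvent z x Hz).
rewrite <- (resolvent_shift z (scal c (resolvent z x)) Hz) by now apply dom_scal.
rewrite shift_scal by assumption. now rewrite !shift_resolvent.
Qed.

(* The Cayley transform (P - z)(P + z)^-1 of P for z = i, and its inverse for
   z = -i. *)
Definition cayley (z : C) (x : H) : H :=
  minus x (scal (Cmult (RtoC 2) z) (resolvent z x)).

Lemma cayley_plus (z : C) (x y : H) : imaginary_unit z ->
  cayley z (plus x y) = plus (cayley z x) (cayley z y).
Proof. intros Hz. unfold cayley. rewrite resolvent_plus by assumption. vring H. Qed.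

Lemma cayley_scal (z c : C) (x : H) : imaginary_unit z ->
  cayley z (scal c x) = scal c (cayley z x).
Proof. intros Hz. unfold cayley. rewrite resolvent_scal by assumption. vring H. Qed.

Lemma cayley_shift (z : C) (x : H) : imaginary_unit z -> dom P x ->
  cayley z (shift z x) = shift (Copp z) x.
Proof.
intros Hz Hx. unfold cayley. rewrite resolvent_shift by assumption.
unfold shift. vring H.
Qed.

Lemma cayley_cancel (z : C) (x : H) : imaginary_unit z ->
  cayley (Copp z) (cayley z x) = x.
Proof.
intros Hz. pose proof (dom_resolvent z x Hz) as D.
rewrite <- (shift_resolvent z x Hz) at 1.
rewrite cayley_shift, cayley_shift; try assumption; [ | now apply imaginary_unit_opp ].
replace (Copp (Copp z)) with z by (C_eq; ring). now apply shift_resolvent.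
Qed.

(** On vectors (P + z)x' and (P + z)y' the transform only changes the sign of z, and [inner_shift]
    does not see this sign. *)
Lemma inner_cayley (z : C) (x y : H) : imaginary_unit z ->
  inner (cayley z x) (cayley z y) = inner x y.
Proof.
intros Hz. pose proof (dom_resolvent z x Hz). pose proof (dom_resolvent z y Hz).
rewrite <- (shift_resolvent z x Hz), <- (shift_resolvent z y Hz), !cayley_shift
  by assumption.
rewrite !inner_shift; try assumption; [ reflexivity | now apply imaginary_unit_opp ].
Qed.

End Resolvents.

(** * Roots of unity and discrete orthogonality of characters *)

Definition cis (t : R) : C := (cos t, sin t).

Lemma cis_plus (s t : R) : cis (s + t) = Cmult (cis s) (cis t).
Proof. unfold cis. C_eq; [ apply cos_plus | rewrite sin_plus; ring ]. Qed.

Lemma cis_0 : cis 0 = RtoC 1.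
Proof. unfold cis. now rewrite cos_0, sin_0. Qed.

Lemma Cconj_cis (t : R) : Cconj (cis t) = cis (- t).
Proof. unfold cis, Cconj. cbn. now rewrite cos_neg, sin_neg. Qed.

Lemma Cmod_cis (t : R) : Cmod (cis t) = 1.
Proof.
unfold Cmod, cis. rewrite <- sqrt_1. f_equal. cbn -[cos sin].
pose proof (sin2_cos2 t) as E. unfold Rsqr in E. lra.
Qed.

(** Factoring out the midpoint: e^(it) - 1 = 2i sin(t/2) e^(it/2). *)
Lemma Cmod_cis_minus_1 (t : R) : Cmod (Cminus (cis t) (RtoC 1)) = 2 * Rabs (sin (t / 2)).
Proof.
assert (E : cis t = Cmult (cis (t / 2)) (cis (t / 2)))
  by (rewrite <- cis_plus; f_equal; field).
assert (F : Cminus (cis t) (RtoC 1) =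
            Cmult (Cmult (RtoC 2) Ci) (Cmult (RtoC (sin (t / 2))) (cis (t / 2)))).
{ rewrite E. pose proof (sin2_cos2 (t / 2)) as S. unfold Rsqr in S.
  unfold cis. C_eq; [ | ring ].
  transitivity (cos (t / 2) * cos (t / 2) - sin (t / 2) * sin (t / 2) -
    (sin (t / 2) * sin (t / 2) + cos (t / 2) * cos (t / 2))); [ rewrite S | ]; ring. }
rewrite F, !Cmod_mult, !Cmod_R, Cmod_cis, (Cmod_imaginary_unit Ci) by now left.
rewrite (Rabs_pos_eq 2) by lra. ring.
Qed.

Lemma geometric_cis (t : R) (n : nat) :
  Cmult (Cminus (cis t) (RtoC 1)) (sum_n (fun j => cis (INR j * t)) n) =
  Cminus (cis (INR (S n) * t)) (RtoC 1).
Proof.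
induction n as [|n IH].
- rewrite sum_O. cbn [INR]. rewrite Rmult_0_l, Rmult_1_l, cis_0. ring.
- rewrite sum_Sn.
  change (plus (sum_n (fun j => cis (INR j * t)) n) (cis (INR (S n) * t)))
    with (Cplus (sum_n (fun j => cis (INR j * t)) n) (cis (INR (S n) * t))).
  rewrite Cmult_plus_distr_l, IH.
  replace (INR (S (S n)) * t) with (INR (S n) * t + t) by (rewrite (S_INR (S n)); ring).
  rewrite cis_plus. ring.
Qed.

(** Angles of the (n+1)-st roots of unity; the shift by one matches [sum_n], whose range 0, ..., n
    includes both ends. *)
Definition node (n j : nat) : R := 2 * PI * INR j / INR (S n).

Lemma node_range (n j : nat) : (j <= n)%nat -> 0 <= node n j < 2 * PI.
Proof.
intros Hj. pose proof PI_RGT_0 as Hpi. pose proof (lt_0_INR (S n) ltac:(lia)) as Hn.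
pose proof (pos_INR j) as Hj0. unfold node. split.
- apply Rmult_le_pos; [ apply Rmult_le_pos; lra | ].
  now apply Rlt_le, Rinv_0_lt_compat.
- apply Rmult_lt_reg_r with (INR (S n)); [ exact Hn | ].
  unfold Rdiv. rewrite Rmult_assoc, Rinv_l, Rmult_1_r by lra.
  apply Rmult_lt_compat_l; [ lra | ]. apply lt_INR. lia.
Qed.

Lemma sin_half_neq_0 (t : R) : 0 < Rabs t < 2 * PI -> sin (t / 2) <> 0.
Proof.
intros Ht. destruct (Rle_dec 0 t) as [H0|H0].
- rewrite Rabs_pos_eq in Ht by assumption.
  apply Rgt_not_eq, sin_gt_0; lra.
- rewrite Rabs_left in Ht by lra.
  replace (t / 2) with (- (- t / 2)) by field. rewrite sin_neg.
  apply Rlt_not_eq. enough (0 < sin (- t / 2)) by lra. apply sin_gt_0; lra.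
Qed.

Lemma cis_2PI_Z (k : Z) : cis (IZR k * (2 * PI)) = RtoC 1.
Proof.
assert (N : forall n : nat, cis (INR n * (2 * PI)) = RtoC 1).
{ induction n as [|n IH]; [ now rewrite Rmult_0_l, cis_0 | ].
  replace (INR (S n) * (2 * PI)) with (INR n * (2 * PI) + 2 * PI)
    by (rewrite S_INR; ring).
  rewrite cis_plus, IH. unfold cis. rewrite cos_2PI, sin_2PI. C_eq; ring. }
destruct (Z_le_gt_dec 0 k) as [Hk|Hk].
- rewrite <- (Z2Nat.id k Hk), <- INR_IZR_INZ. apply N.
- replace (IZR k) with (- INR (Z.to_nat (- k)))
    by (rewrite INR_IZR_INZ, Z2Nat.id, opp_IZR by lia; ring).
  rewrite Ropp_mult_distr_l_reverse, <- Cconj_cis, N.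
  C_eq; ring.
Qed.

(** For k <> 0 the sum is geometric with numerator e^(2 pi i k) - 1 = 0. Its denominator is nonzero
    because |k| <= n excludes the nonzero multiples of n + 1, for which all the terms would be 1. *)
Lemma dft_orthogonality (n : nat) (k : Z) : (Z.abs k <= Z.of_nat n)%Z ->
  sum_n (fun j => cis (IZR k * node n j)) n =
  if Z.eq_dec k 0 then RtoC (INR (S n)) else RtoC 0.
Proof.
intros Hk. pose proof (lt_0_INR (S n) ltac:(lia)) as Hn.
set (t := IZR k * (2 * PI / INR (S n))).
assert (E : forall j, cis (IZR k * node n j) = cis (INR j * t))
  by (intros j; f_equal; unfold node, t; field; lra).
rewrite (sum_n_ext _ _ n E). destruct (Z.eq_dec k 0) as [K0|K0].
- assert (T0 : t = 0) by (unfold t; rewrite K0; ring).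
  clear -T0. rewrite T0. clear T0. induction n as [|n IH].
  + rewrite sum_O, Rmult_0_r. apply cis_0.
  + rewrite sum_Sn, IH, Rmult_0_r, cis_0, (S_INR (S n)). C_eq; ring.
- pose proof (geometric_cis t n) as G.
  replace (INR (S n) * t) with (IZR k * (2 * PI)) in G by (unfold t; field; lra).
  rewrite cis_2PI_Z in G.
  assert (NZ : Cminus (cis t) (RtoC 1) <> RtoC 0).
  { intros Z0. apply (f_equal Cmod) in Z0. rewrite Cmod_cis_minus_1, Cmod_0 in Z0.
    assert (S0 : sin (t / 2) <> 0).
    { apply sin_half_neq_0. unfold t. rewrite Rabs_mult.
      pose proof PI_RGT_0 as Hpi.
      rewrite (Rabs_pos_eq (2 * PI / INR (S n)))
        by (apply Rlt_le, Rdiv_lt_0_compat; lra).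
      rewrite <- abs_IZR. split.
      - apply Rmult_lt_0_compat; [ apply IZR_lt; lia | apply Rdiv_lt_0_compat; lra ].
      - apply Rmult_lt_reg_r with (INR (S n)); [ exact Hn | ].
        replace (IZR (Z.abs k) * (2 * PI / INR (S n)) * INR (S n))
          with (2 * PI * IZR (Z.abs k)) by (field; lra).
        apply Rmult_lt_compat_l; [ lra | ]. rewrite INR_IZR_INZ. apply IZR_lt. lia. }
    apply Rabs_no_R0 in S0. lra. }
  set (s := sum_n (fun j => cis (INR j * t)) n) in *.
  transitivity (Cmult (Cinv (Cminus (cis t) (RtoC 1)))
                  (Cmult (Cminus (cis t) (RtoC 1)) s)).
  { now rewrite Cmult_assoc, Cinv_l, Cmult_1_l. }
  rewrite G. C_eq; ring.
Qed.

Lemma norm_sum_n_le {V : CompleteNormedModule C_AbsRing} (v : nat -> V) (n : nat) (a : R) :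
  (forall j, (j <= n)%nat -> norm (v j) <= a) -> norm (sum_n v n) <= INR (S n) * a.
Proof.
induction n as [|n IH]; intros Ha.
- rewrite sum_O. cbn [INR]. rewrite Rmult_1_l. now apply Ha.
- rewrite sum_Sn, (S_INR (S n)), Rmult_plus_distr_r, Rmult_1_l.
  apply norm_plus_le2; [ apply IH; intros j Hj; apply Ha; lia | now apply Ha ].
Qed.

Lemma sum_n_single {G : AbelianMonoid} (v : nat -> G) (n m : nat) : (m <= n)%nat ->
  (forall j, (j <= n)%nat -> j <> m -> v j = zero) -> sum_n v n = v m.
Proof.
assert (Z0 : forall n, (forall j, (j <= n)%nat -> v j = zero) -> sum_n v n = zero).
{ clear n. induction n as [|n IH]; intros Hv.
  - rewrite sum_O. now apply Hv.
  - rewrite sum_Sn, IH, Hv by (intros; try apply Hv; lia). apply plus_zero_l. }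
induction n as [|n IH]; intros Hm Hv.
- rewrite sum_O. now replace m with 0%nat by lia.
- rewrite sum_Sn. destruct (Nat.eq_dec m (S n)) as [->|Hne].
  + rewrite Z0 by (intros j Hj; apply Hv; lia). apply plus_zero_l.
  + rewrite (Hv (S n)) by lia. rewrite plus_zero_r. apply IH; [ lia | ].
    intros j Hj. apply Hv. lia.
Qed.

(** If t = 1 + e with e > 0, Bernoulli's inequality for t^(2^j), squared, bounds t^(2^(j+1)) below
    by 4^j e^2, which outgrows K 2^(j+1). *)
Lemma le_1_of_pow_le (t K : R) :
  (forall j : nat, t ^ (2 ^ j) <= K * 2 ^ j) -> t <= 1.
Proof.
intros Hb. destruct (Rle_lt_dec t 1) as [Ht|Ht]; [ exact Ht | exfalso ].
set (e := t - 1). assert (He : 0 < e) by (unfold e; lra).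
assert (B : forall j : nat, 2 ^ j * (e * e) <= 2 * K).
{ intros j. specialize (Hb (S j)).
  pose proof (pow_lt 2 j ltac:(lra)) as H2.
  assert (L : 2 ^ j * e <= t ^ (2 ^ j)).
  { replace t with (1 + e) by (unfold e; ring).
    pose proof (poly (2 ^ j) e He) as Q. rewrite pow_INR in Q. cbn [INR] in Q.
    replace (1 + 1) with 2 in Q by ring. lra. }
  replace (2 ^ S j)%nat with (2 ^ j + 2 ^ j)%nat in Hb by (cbn; lia).
  rewrite pow_add in Hb.
  assert (Q : (2 ^ j * e) * (2 ^ j * e) <= t ^ (2 ^ j) * t ^ (2 ^ j))
    by (apply Rmult_le_compat; try (apply Rmult_le_pos; lra); exact L).
  apply Rmult_le_reg_l with (2 ^ j); [ exact H2 | ].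
  replace (2 ^ S j) with (2 * 2 ^ j) in Hb by (cbn; ring). lra. }
assert (He2 : 0 < e * e) by now apply Rmult_lt_0_compat.
destruct (Pow_x_infinity 2 ltac:(rewrite Rabs_pos_eq; lra) (2 * K / (e * e) + 1))
  as [N HN].
specialize (HN N (le_n N)). specialize (B N).
rewrite Rabs_pos_eq in HN by (apply pow_le; lra).
assert (Q : (2 * K / (e * e) + 1) * (e * e) <= 2 ^ N * (e * e))
  by (apply Rmult_le_compat_r; lra).
replace ((2 * K / (e * e) + 1) * (e * e)) with (2 * K + e * e) in Q by (field; lra).
lra.
Qed.
(** * Trigonometric polynomials of the Cayley transform *)

Section TrigonometricPolynomials.
Context {A : CStarAlgebra} {H : HilbertModule A} (P : Operator H).
Hypothesis (Preg : regular P) (Psa : selfadjoint P).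

Let iu_pos : imaginary_unit Ci := or_introl eq_refl.
Let iu_neg : imaginary_unit (Copp Ci) := or_intror eq_refl.

(** [Z.to_nat] sends negative integers to 0, so at most one of the two iterations is nontrivial. *)
Definition cayley_pow (k : Z) (x : H) : H :=
  Nat.iter (Z.to_nat k) (cayley P Ci)
    (Nat.iter (Z.to_nat (- k)) (cayley P (Copp Ci)) x).

Lemma cayley_neg_pos (x : H) : cayley P (Copp Ci) (cayley P Ci x) = x.
Proof. exact (cayley_cancel P Preg Psa Ci x iu_pos). Qed.

Lemma cayley_pos_neg (x : H) : cayley P Ci (cayley P (Copp Ci) x) = x.
Proof.
pose proof (cayley_cancel P Preg Psa (Copp Ci) x iu_neg) as E.
now replace (Copp (Copp Ci)) with Ci in E by (C_eq; ring).
Qed.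

Lemma cayley_pow_succ (k : Z) (x : H) :
  cayley_pow (k + 1) x = cayley P Ci (cayley_pow k x).
Proof.
unfold cayley_pow. destruct (Z_le_gt_dec 0 k) as [Hk|Hk].
- replace (Z.to_nat (- k)) with 0%nat by lia.
  replace (Z.to_nat (- (k + 1))) with 0%nat by lia.
  replace (Z.to_nat (k + 1)) with (S (Z.to_nat k)) by lia. reflexivity.
- replace (Z.to_nat k) with 0%nat by lia.
  replace (Z.to_nat (k + 1)) with 0%nat by lia.
  replace (Z.to_nat (- k)) with (S (Z.to_nat (- (k + 1)))) by lia.
  cbn. now rewrite cayley_pos_neg.
Qed.

Lemma cayley_pow_pred (k : Z) (x : H) :
  cayley_pow (k - 1) x = cayley P (Copp Ci) (cayley_pow k x).
Proof.
replace (cayley_pow k x) with (cayley_pow (k - 1 + 1) x) by (f_equal; lia).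
now rewrite cayley_pow_succ, cayley_neg_pos.
Qed.

Lemma cayley_pow_add (k l : Z) (x : H) :
  cayley_pow (k + l) x = cayley_pow k (cayley_pow l x).
Proof.
revert k. apply Z.peano_ind.
- now replace (0 + l)%Z with l by lia.
- intros k IH. replace (Z.succ k + l)%Z with (k + l + 1)%Z by lia.
  replace (Z.succ k) with (k + 1)%Z by lia. now rewrite !cayley_pow_succ, IH.
- intros k IH. replace (Z.pred k + l)%Z with (k + l - 1)%Z by lia.
  replace (Z.pred k) with (k - 1)%Z by lia. now rewrite !cayley_pow_pred, IH.
Qed.

Lemma cayley_pow_plus (k : Z) (x y : H) :
  cayley_pow k (plus x y) = plus (cayley_pow k x) (cayley_pow k y).
Proof.
revert k. apply Z.peano_ind; [ reflexivity | | ]; intros k IH.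
- replace (Z.succ k) with (k + 1)%Z by lia.
  now rewrite !cayley_pow_succ, IH, cayley_plus.
- replace (Z.pred k) with (k - 1)%Z by lia.
  now rewrite !cayley_pow_pred, IH, cayley_plus.
Qed.

Lemma cayley_pow_scal (k : Z) (c : C) (x : H) :
  cayley_pow k (scal c x) = scal c (cayley_pow k x).
Proof.
revert k. apply Z.peano_ind; [ reflexivity | | ]; intros k IH.
- replace (Z.succ k) with (k + 1)%Z by lia.
  now rewrite !cayley_pow_succ, IH, cayley_scal.
- replace (Z.pred k) with (k - 1)%Z by lia.
  now rewrite !cayley_pow_pred, IH, cayley_scal.
Qed.

Lemma inner_cayley_pow (k : Z) (x y : H) :
  inner (cayley_pow k x) (cayley_pow k y) = inner x y.
Proof.
revert k. apply Z.peano_ind; [ reflexivity | | ]; intros k IH.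
- replace (Z.succ k) with (k + 1)%Z by lia.
  now rewrite !cayley_pow_succ, inner_cayley.
- replace (Z.pred k) with (k - 1)%Z by lia.
  now rewrite !cayley_pow_pred, inner_cayley.
Qed.

Lemma inner_cayley_pow_l (k : Z) (x y : H) :
  inner (cayley_pow k x) y = inner x (cayley_pow (- k) y).
Proof.
rewrite <- (inner_cayley_pow k x (cayley_pow (- k) y)), <- cayley_pow_add.
now replace (k + - k)%Z with 0%Z by lia.
Qed.

Lemma norm_cayley_pow (k : Z) (x : H) : norm (cayley_pow k x) = norm x.
Proof. rewrite !(norm_inner _ H). now rewrite inner_cayley_pow. Qed.

(* [trig N p T]: p(t) is a trigonometric polynomial sum c_k e^(ikt) of degree at
   most N and T = sum c_k U^k, where U = (P - i)(P + i)^-1. *)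
Inductive trig : nat -> (R -> C) -> (H -> H) -> Prop :=
| trig_mono N k : (Z.abs k <= Z.of_nat N)%Z ->
    trig N (fun t => cis (IZR k * t)) (cayley_pow k)
| trig_plus N p q S T : trig N p S -> trig N q T ->
    trig N (fun t => Cplus (p t) (q t)) (fun x => plus (S x) (T x))
| trig_scal N z p T : trig N p T ->
    trig N (fun t => Cmult z (p t)) (fun x => scal z (T x)).

Lemma trig_ext (N : nat) (p q : R -> C) (S T : H -> H) :
  trig N p S -> (forall t, q t = p t) -> (forall x, T x = S x) -> trig N q T.
Proof.
intros Ht Hp HS.
now rewrite (functional_extensionality _ _ Hp), (functional_extensionality _ _ HS).
Qed.

Lemma trig_le (N M : nat) (p : R -> C) (T : H -> H) :
  (N <= M)%nat -> trig N p T -> trig M p T.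
Proof.
intros L Ht. induction Ht as [N k Hk | N p q S T HS IHS HT IHT | N z p T HT IHT].
- apply trig_mono. lia.
- apply trig_plus; auto.
- apply trig_scal; auto.
Qed.

Lemma trig_id (N : nat) : trig N (fun _ => RtoC 1) (fun x => x).
Proof.
apply (trig_ext N (fun t => cis (IZR 0 * t)) _ (cayley_pow 0)).
- apply trig_mono. lia.
- intros t. now rewrite Rmult_0_l, cis_0.
- reflexivity.
Qed.

Lemma trig_app_plus (N : nat) (p : R -> C) (T : H -> H) (x y : H) :
  trig N p T -> T (plus x y) = plus (T x) (T y).
Proof.
intros Ht. induction Ht as [N k Hk | N p q S T HS IHS HT IHT | N z p T HT IHT].
- apply cayley_pow_plus.
- rewrite IHS, IHT. vring H.
- rewrite IHT. vring H.
Qed.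

Lemma trig_app_scal (N : nat) (p : R -> C) (T : H -> H) (c : C) (x : H) :
  trig N p T -> T (scal c x) = scal c (T x).
Proof.
intros Ht. induction Ht as [N k Hk | N p q S T HS IHS HT IHT | N z p T HT IHT].
- apply cayley_pow_scal.
- rewrite IHS, IHT. vring H.
- rewrite IHT. vring H.
Qed.

Lemma trig_app_minus (N : nat) (p : R -> C) (T : H -> H) (x y : H) :
  trig N p T -> T (minus x y) = minus (T x) (T y).
Proof.
intros Ht. rewrite !minus_scal, (trig_app_plus N p T _ _ Ht).
now rewrite (trig_app_scal N p T _ _ Ht).
Qed.

Lemma trig_minus (N M : nat) (p q : R -> C) (S T : H -> H) :
  trig N p S -> trig M q T ->
  trig (N + M) (fun t => Cminus (p t) (q t)) (fun x => minus (S x) (T x)).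
Proof.
intros HS HT.
apply (trig_le N (N + M)) in HS; [ | lia ]. apply (trig_le M (N + M)) in HT; [ | lia ].
apply (trig_scal _ (Copp (RtoC 1))) in HT.
apply (trig_ext _ _ _ _ _ (trig_plus _ _ _ _ _ HS HT)).
- intros t. ring.
- intros x. vring H.
Qed.

Lemma trig_mult (N M : nat) (p q : R -> C) (S T : H -> H) :
  trig N p S -> trig M q T ->
  trig (N + M) (fun t => Cmult (p t) (q t)) (fun x => S (T x)).
Proof.
intros HS HT. revert S p N HS.
induction HT as [M l Hl | M q r T T' HT IHT HT' IHT' | M z q T HT IHT];
  intros S p N HS.
- induction HS as [N k Hk | N p p' S S' HS IHS HS' IHS' | N z p S HS IHS].
  + apply (trig_ext (N + M) (fun t => cis (IZR (k + l) * t)) _ (cayley_pow (k + l))).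
    * apply trig_mono. lia.
    * intros t. rewrite <- cis_plus, plus_IZR. f_equal. ring.
    * intros x. now rewrite cayley_pow_add.
  + apply (trig_ext _ _ _ _ _ (trig_plus _ _ _ _ _ IHS IHS')); [ | reflexivity ].
    intros t. ring.
  + apply (trig_ext _ _ _ _ _ (trig_scal _ z _ _ IHS)); [ | reflexivity ].
    intros t. ring.
- apply (trig_ext _ _ _ _ _ (trig_plus _ _ _ _ _ (IHT _ _ _ HS) (IHT' _ _ _ HS))).
  + intros t. ring.
  + intros x. exact (trig_app_plus _ _ _ _ _ HS).
- apply (trig_ext _ _ _ _ _ (trig_scal _ z _ _ (IHT _ _ _ HS))).
  + intros t. ring.
  + intros x. exact (trig_app_scal _ _ _ _ _ HS).
Qed.

Lemma trig_adjoint (N : nat) (p : R -> C) (T : H -> H) : trig N p T ->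
  exists S, trig N (fun t => Cconj (p t)) S /\
    forall x y, inner (T x) y = inner x (S y).
Proof.
intros Ht. induction Ht as
  [N k Hk | N p q S T HS [S' [HS' ES]] HT [T' [HT' ET]] | N z p T HT [T' [HT' ET]]].
- exists (cayley_pow (- k)). split.
  + apply (trig_ext N (fun t => cis (IZR (- k) * t)) _ (cayley_pow (- k))).
    * apply trig_mono. lia.
    * intros t. rewrite Cconj_cis, opp_IZR. f_equal. ring.
    * reflexivity.
  + intros x y. apply inner_cayley_pow_l.
- exists (fun x => plus (S' x) (T' x)). split.
  + apply (trig_ext _ _ _ _ _ (trig_plus _ _ _ _ _ HS' HT')); [ | reflexivity ].
    intros t. C_eq; ring.
  + intros x y. now rewrite inner_plus_l, inner_plus_r, ES, ET.
- exists (fun x => scal (Cconj z) (T' x)). split.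
  + apply (trig_ext _ _ _ _ _ (trig_scal _ (Cconj z) _ _ HT')); [ | reflexivity ].
    intros t. C_eq; ring.
  + intros x y. now rewrite inner_scal_l, inner_scal_r, ET.
Qed.

(** The point is that the degree grows only linearly in m, while the sup norm is raised to the power
    m. *)
Lemma trig_iter (N m : nat) (p : R -> C) (T : H -> H) : trig N p T ->
  exists q, trig (m * N) q (Nat.iter m T) /\ forall t, Cmod (q t) = Cmod (p t) ^ m.
Proof.
intros HT. induction m as [|m [q [Hq Eq]]].
- exists (fun _ => RtoC 1). split; [ apply trig_id | ]. intros t. apply Cmod_1.
- exists (fun t => Cmult (p t) (q t)). split.
  + exact (trig_mult _ _ _ _ _ _ HT Hq).
  + intros t. rewrite Cmod_mult, Eq. reflexivity.
Qed.

(** The normalized Dirichlet kernel (2N+1)^-1 sum_k e^(ik(t - s_j)), |k| <= N, centred at the j-th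
    node s_j and evaluated at U; the index l stands for k = l - N. *)
Definition fourier_atom (N j : nat) (x : H) : H :=
  scal (RtoC (/ INR (S (2 * N))))
    (sum_n (fun l => scal (cis (IZR (Z.of_nat N - Z.of_nat l) * node (2 * N) j))
                       (cayley_pow (Z.of_nat l - Z.of_nat N) x)) (2 * N)).

(** By linearity it suffices to take p = e^(ikt), where discrete orthogonality over the 2N+1 nodes
    isolates U^k. So T depends on p only through its values at the nodes. *)
Lemma trig_interpolation (N : nat) (p : R -> C) (T : H -> H) (x : H) : trig N p T ->
  T x = sum_n (fun j => scal (p (node (2 * N) j)) (fourier_atom N j x)) (2 * N).
Proof.
intros Ht. induction Ht as [N k Hk | N p q S T HS IHS HT IHT | N z p T HT IHT].
- set (c := RtoC (/ INR (S (2 * N)))).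
  set (u := fun l => cayley_pow (Z.of_nat l - Z.of_nat N) x).
  set (e := fun j l => cis (IZR (k + Z.of_nat N - Z.of_nat l) * node (2 * N) j)).
  transitivity (sum_n (fun j => sum_n (fun l =>
      scal (e j l) (scal c (u l))) (2 * N)) (2 * N)).
  + rewrite sum_n_switch.
    transitivity (sum_n (fun l =>
        scal (sum_n (fun j => e j l) (2 * N)) (scal c (u l))) (2 * N)).
    (* Only the frequency l - N = k survives the sum over the nodes; the other differences k + N - l
       are nonzero and at most 2N in absolute value. *)
    * rewrite (sum_n_single _ _ (Z.to_nat (k + Z.of_nat N))); [ | lia | ].
      -- unfold e. rewrite (dft_orthogonality (2 * N)) by lia.
         destruct Z.eq_dec; [ | lia ].
         unfold u. replace (Z.of_nat (Z.to_nat (k + Z.of_nat N)) - Z.of_nat N)%Z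
           with k by lia.
         pose proof (lt_0_INR (S (2 * N)) ltac:(lia)) as Hd. unfold c.
         revert Hd. generalize (INR (S (2 * N))) as d. intros d Hd.
         vlinear H; C_eq; field; lra.
      -- intros l Hl Hne. unfold e. rewrite (dft_orthogonality (2 * N)) by lia.
         destruct Z.eq_dec; [ lia | ]. vring H.
    * apply sum_n_ext. intros l. generalize (scal c (u l)) as v. intros v.
      generalize (2 * N)%nat as n. induction n as [|n IH].
      -- now rewrite !sum_O.
      -- rewrite !sum_Sn, <- IH. exact (scal_distr_r _ _ _).
  + apply sum_n_ext. intros j. unfold fourier_atom. fold c.
    rewrite <- !sum_n_scal_l. apply sum_n_ext. intros l. fold (u l).
    transitivity (scal (Cmult (cis (IZR k * node (2 * N) j))
      (cis (IZR (Z.of_nat N - Z.of_nat l) * node (2 * N) j))) (scal c (u l))).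
    * rewrite <- cis_plus. unfold e. f_equal. f_equal.
      rewrite !minus_IZR, plus_IZR. ring.
    * vring H.
- rewrite IHS, IHT, <- sum_n_plus. apply sum_n_ext. intros j. vring H.
- rewrite IHT, <- sum_n_scal_l. apply sum_n_ext. intros j. vring H.
Qed.

(** An average of 2N+1 isometries with coefficients of modulus 1 is a contraction. *)
Lemma norm_fourier_atom (N j : nat) (x : H) : norm (fourier_atom N j x) <= norm x.
Proof.
pose proof (lt_0_INR (S (2 * N)) ltac:(lia)) as Hn.
pose proof (Rinv_0_lt_compat _ Hn) as Hn'.
unfold fourier_atom. apply norm_scal_le. rewrite Cmod_R, Rabs_pos_eq by lra.
apply Rmult_le_reg_l with (INR (S (2 * N))); [ exact Hn | ].
rewrite <- Rmult_assoc, Rinv_r, Rmult_1_l by lra.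
apply norm_sum_n_le. intros l _. apply norm_scal_le.
rewrite Cmod_cis, norm_cayley_pow. lra.
Qed.

Lemma norm_trig_degree (N : nat) (p : R -> C) (T : H -> H) (M : R) (x : H) :
  trig N p T -> (forall t, 0 <= t < 2 * PI -> Cmod (p t) <= M) ->
  norm (T x) <= INR (S (2 * N)) * (M * norm x).
Proof.
intros HT HM. rewrite (trig_interpolation N p T x HT).
apply norm_sum_n_le. intros j Hj. apply norm_scal_le.
apply Rmult_le_compat; [ apply Cmod_ge_0 | apply norm_ge_0 | | apply norm_fourier_atom ].
apply HM, node_range, Hj.
Qed.

Lemma inner_iter (S : H -> H) (m : nat) (x y : H) :
  (forall x y, inner (S x) y = inner x (S y)) ->
  inner (Nat.iter m S x) y = inner x (Nat.iter m S y).
Proof.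
intros HS. revert y. induction m as [|m IH]; intros y; [ reflexivity | ].
cbn. rewrite HS, IH. f_equal. clear. induction m as [|m IH]; [ reflexivity | ].
cbn. now rewrite <- IH.
Qed.

(* The spectral radius trick: |S^m x|^2 = |<S^2m x, x>| lets the polynomially
   growing constant of [norm_trig_degree] be removed along m = 2^j. *)
Lemma norm_trig_selfadjoint (N : nat) (p : R -> C) (S : H -> H) (M : R) (x : H) :
  trig N p S -> (forall x y, inner (S x) y = inner x (S y)) -> 0 < M ->
  (forall t, 0 <= t < 2 * PI -> Cmod (p t) <= M) ->
  norm (S x) <= 2 * M * norm x.
Proof.
intros HS Hsa HM Hp.
destruct (Rle_lt_dec (norm x) 0) as [Hx|Hx].
{ eapply Rle_trans; [ apply (norm_trig_degree N p S M x HS Hp) | ].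
  assert (E : norm x = 0) by (apply Rle_antisym; [ exact Hx | apply norm_ge_0 ]).
  rewrite E. lra. }
(* The 2 in the denominator absorbs the factor of [cauchy_schwarz_weak], so that b_j^2 <= b_(j+1)
   holds without a constant. *)
set (b := fun j : nat => norm (Nat.iter (2 ^ j) S x) / (2 * norm x)).
assert (b0 : forall j, 0 <= b j).
{ intros j. unfold b. apply Rmult_le_pos; [ apply norm_ge_0 | ].
  apply Rlt_le, Rinv_0_lt_compat. lra. }
assert (bS : forall j, b j * b j <= b (Datatypes.S j)).
{ intros j. unfold b. set (m := (2 ^ j)%nat).
  assert (E : norm (Nat.iter m S x) * norm (Nat.iter m S x) <=
              2 * (norm (Nat.iter (2 ^ Datatypes.S j) S x) * norm x)).
  { rewrite norm_sqr, <- (inner_iter S m _ _ Hsa), <- Nat.iter_add.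
    replace (2 ^ Datatypes.S j)%nat with (m + m)%nat by (unfold m; cbn; lia).
    apply cauchy_schwarz_weak. }
  apply Rmult_le_reg_r with (4 * (norm x * norm x)).
  - apply Rmult_lt_0_compat; [ lra | now apply Rmult_lt_0_compat ].
  - replace (norm (Nat.iter m S x) / (2 * norm x) * (norm (Nat.iter m S x) / (2 * norm x)) *
        (4 * (norm x * norm x)))
      with (norm (Nat.iter m S x) * norm (Nat.iter m S x)) by (field; lra).
    replace (norm (Nat.iter (2 ^ Datatypes.S j) S x) / (2 * norm x) *
        (4 * (norm x * norm x)))
      with (2 * (norm (Nat.iter (2 ^ Datatypes.S j) S x) * norm x)) by (field; lra).
    exact E. }
assert (bpow : forall j, b 0%nat ^ (2 ^ j) <= b j).
{ induction j as [|j IH]; [ cbn; lra | ].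
  replace (2 ^ Datatypes.S j)%nat with (2 ^ j + 2 ^ j)%nat by (cbn; lia).
  rewrite pow_add. eapply Rle_trans; [ | apply bS ].
  apply Rmult_le_compat; try assumption; apply pow_le, b0. }
(* S^(2^j) has degree at most 2^j N, so the crude bound carries the factor 2 * 2^j N + 1; half of it
   is at most (N + 1) 2^j. *)
assert (bbound : forall j, (b 0%nat / M) ^ (2 ^ j) <= (INR N + 1) * 2 ^ j).
{ intros j. destruct (trig_iter N (2 ^ j) p S HS) as [q [Hq Eq]].
  assert (Bq : forall t, 0 <= t < 2 * PI -> Cmod (q t) <= M ^ (2 ^ j)).
  { intros t Ht. rewrite Eq. apply pow_incr. split; [ apply Cmod_ge_0 | now apply Hp ]. }
  pose proof (norm_trig_degree _ _ _ _ x Hq Bq) as D.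
  assert (HMj : 0 < M ^ (2 ^ j)) by now apply pow_lt.
  unfold Rdiv. rewrite Rpow_mult_distr, pow_inv.
  apply Rmult_le_reg_r with (M ^ (2 ^ j)); [ exact HMj | ].
  rewrite Rmult_assoc, Rinv_l, Rmult_1_r by lra.
  eapply Rle_trans; [ apply bpow | ].
  unfold b. apply Rmult_le_reg_r with (2 * norm x); [ lra | ].
  replace (norm (Nat.iter (2 ^ j) S x) / (2 * norm x) * (2 * norm x))
    with (norm (Nat.iter (2 ^ j) S x)) by (field; lra).
  eapply Rle_trans; [ exact D | ].
  replace ((INR N + 1) * 2 ^ j * M ^ (2 ^ j) * (2 * norm x))
    with (2 * (INR N + 1) * 2 ^ j * (M ^ (2 ^ j) * norm x)) by ring.
  apply Rmult_le_compat_r; [ apply Rmult_le_pos; lra | ].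
  rewrite S_INR, !mult_INR, pow_INR. cbn [INR].
  replace (1 + 1) with 2 by ring.
  assert (1 <= 2 ^ j) by (apply pow_R1_Rle; lra). nra. }
pose proof (le_1_of_pow_le _ _ bbound) as L.
apply Rmult_le_compat_r with (r := M) in L; [ | lra ].
unfold b in L. cbn [Nat.pow Nat.iter nat_rect] in L.
replace (norm (S x) / (2 * norm x) / M * M) with (norm (S x) / (2 * norm x)) in L
  by (field; lra).
apply Rmult_le_compat_r with (r := 2 * norm x) in L; [ | lra ].
replace (norm (S x) / (2 * norm x) * (2 * norm x)) with (norm (S x)) in L
  by (field; lra).
lra.
Qed.

(** |Tx|^2 = |<T^*T x, x>|, and T^*T is selfadjoint with symbol |p|^2 <= M^2. Cauchy-Schwarz here
    and the selfadjoint case contribute a factor 2 each, that is 4 M^2 under the square root. *)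
Lemma norm_trig (N : nat) (p : R -> C) (T : H -> H) (M : R) (x : H) :
  trig N p T -> 0 < M -> (forall t, 0 <= t < 2 * PI -> Cmod (p t) <= M) ->
  norm (T x) <= 2 * M * norm x.
Proof.
intros HT HM Hp. destruct (trig_adjoint N p T HT) as [T' [HT' E]].
pose proof (trig_mult _ _ _ _ _ _ HT' HT) as HS.
assert (E' : forall x y, inner (T' x) y = inner x (T y)).
{ intros u v. rewrite <- (inner_star _ H v (T' u)), <- E. apply inner_star. }
assert (Hsa : forall x y, inner (T' (T x)) y = inner x (T' (T y)))
  by (intros u v; now rewrite E', E).
assert (L : norm (T' (T x)) <= 2 * (M * M) * norm x).
{ apply (norm_trig_selfadjoint _ _ _ _ x HS Hsa).
  - now apply Rmult_lt_0_compat.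
  - intros t Ht. rewrite Cmod_mult, Cmod_conj.
    apply Rmult_le_compat; try apply Cmod_ge_0; now apply Hp. }
apply Rsqr_incr_0_var.
- unfold Rsqr. rewrite norm_sqr, <- E'.
  eapply Rle_trans; [ apply cauchy_schwarz_weak | ].
  apply Rmult_le_compat_r with (r := norm x) in L; [ | apply norm_ge_0 ]. lra.
- apply Rmult_le_pos; [ lra | apply norm_ge_0 ].
Qed.

End TrigonometricPolynomials.
(** * Fejer means *)

(** The Fejer kernel, written as a squared modulus so that positivity is immediate. *)
Definition fejer (n : nat) (t : R) : R :=
  / INR (S n) * (Cmod (sum_n (fun k => cis (INR k * t)) n)) ^ 2.

Lemma fejer_ge_0 (n : nat) (t : R) : 0 <= fejer n t.
Proof.
apply Rmult_le_pos; [ | apply pow2_ge_0 ].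
apply Rlt_le, Rinv_0_lt_compat, lt_0_INR. lia.
Qed.

(** Summing the geometric series, the left-hand side is |e^(i(n+1)t) - 1|^2 / (4 (n+1)), and a chord
    of the circle has length at most 2. The product form also covers t = 0. *)
Lemma fejer_decay (n : nat) (t : R) : (sin (t / 2)) ^ 2 * fejer n t <= / INR (S n).
Proof.
pose proof (geometric_cis t n) as G. apply (f_equal Cmod) in G.
rewrite Cmod_mult, Cmod_cis_minus_1 in G. unfold fejer.
set (d := Cmod (sum_n (fun k => cis (INR k * t)) n)) in *.
assert (L : 2 * Rabs (sin (t / 2)) * d <= 2).
{ rewrite G. unfold Cminus. eapply Rle_trans; [ apply Cmod_triangle | ].
  rewrite Cmod_opp, Cmod_cis, Cmod_1. lra. }
assert (d0 : 0 <= d) by apply Cmod_ge_0.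
assert (Q : (sin (t / 2)) ^ 2 * d ^ 2 <= 1).
{ replace ((sin (t / 2)) ^ 2) with ((Rabs (sin (t / 2))) ^ 2) by apply pow2_abs.
  rewrite <- Rpow_mult_distr. apply Rle_trans with (1 ^ 2); [ | lra ].
  apply pow_incr. split; [ apply Rmult_le_pos; [ apply Rabs_pos | exact d0 ] | lra ]. }
pose proof (Rinv_0_lt_compat _ (lt_0_INR (S n) ltac:(lia))).
nra.
Qed.

Lemma Cconj_sum_n (a : nat -> C) (n : nat) :
  Cconj (sum_n a n) = sum_n (fun k => Cconj (a k)) n.
Proof.
induction n as [|n IH]; [ now rewrite !sum_O | ].
rewrite !sum_Sn, <- IH. exact (Cplus_conj _ _).
Qed.

Lemma RtoC_sum_n (a : nat -> R) (n : nat) :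
  RtoC (sum_n a n) = sum_n (fun k => RtoC (a k)) n.
Proof.
induction n as [|n IH]; [ now rewrite !sum_O | ].
rewrite !sum_Sn, <- IH. exact (RtoC_plus _ _).
Qed.

Lemma Cmult_sum_n_l (z : C) (a : nat -> C) (n : nat) :
  Cmult z (sum_n a n) = sum_n (fun k => Cmult z (a k)) n.
Proof. symmetry. exact (@sum_n_mult_l C_Ring z a n). Qed.

Lemma Cmult_sum_n_r (z : C) (a : nat -> C) (n : nat) :
  Cmult (sum_n a n) z = sum_n (fun k => Cmult (a k) z) n.
Proof. symmetry. exact (@sum_n_mult_r C_Ring z a n). Qed.

Lemma fejer_expansion (n : nat) (t : R) :
  RtoC (fejer n t) = Cmult (RtoC (/ INR (S n)))
    (sum_n (fun k => sum_n (fun l => cis (IZR (Z.of_nat k - Z.of_nat l) * t)) n) n).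
Proof.
unfold fejer. rewrite RtoC_mult, RtoC_pow. f_equal.
set (d := sum_n (fun k => cis (INR k * t)) n).
transitivity (Cmult d (Cconj d)).
{ pose proof (Cmod2_conj d) as E. rewrite RtoC_pow in E. exact E. }
unfold d. rewrite Cconj_sum_n, Cmult_sum_n_r.
apply sum_n_ext. intros k. rewrite Cmult_sum_n_l.
apply sum_n_ext. intros l. rewrite Cconj_cis, <- cis_plus. f_equal.
rewrite minus_IZR, <- !INR_IZR_INZ. ring.
Qed.

(** The kernel has the frequencies k - l with |k - l| <= n, so summation over the n + 1 nodes keeps
    exactly the n + 1 diagonal terms. *)
Lemma fejer_average (n : nat) (t : R) :
  / INR (S n) * sum_n (fun j => fejer n (t - node n j)) n = 1.
Proof.
pose proof (lt_0_INR (S n) ltac:(lia)) as Hn.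
set (e := fun k l : nat => cis (IZR (Z.of_nat k - Z.of_nat l) * t)).
set (g := fun (j k l : nat) => cis (IZR (Z.of_nat l - Z.of_nat k) * node n j)).
assert (E : RtoC (sum_n (fun j => fejer n (t - node n j)) n) = RtoC (INR (S n))).
{ rewrite RtoC_sum_n.
  transitivity (sum_n (fun j => Cmult (RtoC (/ INR (S n)))
    (sum_n (fun k => sum_n (fun l => Cmult (e k l) (g j k l)) n) n)) n).
  { apply sum_n_ext. intros j. rewrite fejer_expansion. f_equal.
    apply sum_n_ext. intros k. apply sum_n_ext. intros l.
    unfold e, g. rewrite <- cis_plus. f_equal. rewrite !minus_IZR. ring. }
  rewrite <- Cmult_sum_n_l, sum_n_switch.
  transitivity (Cmult (RtoC (/ INR (S n)))
    (sum_n (fun k : nat => RtoC (INR (S n))) n)).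
  { f_equal. apply sum_n_ext_loc. intros k Hk.
    rewrite sum_n_switch.
    transitivity (sum_n (fun l => Cmult (e k l) (sum_n (fun j => g j k l) n)) n).
    { apply sum_n_ext. intros l. symmetry. apply Cmult_sum_n_l. }
    rewrite (sum_n_single _ _ k Hk).
    - unfold e, g. rewrite dft_orthogonality by lia.
      destruct Z.eq_dec; [ | lia ].
      rewrite Z.sub_diag, Rmult_0_l, cis_0. C_eq; ring.
    - intros l Hl Hne. unfold g. rewrite dft_orthogonality by lia.
      destruct Z.eq_dec; [ lia | ]. C_eq; ring. }
  rewrite <- RtoC_sum_n, sum_n_const, <- RtoC_mult. f_equal. field. lra. }
apply RtoC_inj in E. rewrite E. field. lra.
Qed.

(* Averages over the nodes instead of an integral over the circle: the orthogonality
   of characters is exact, and only finite sums occur. *)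
Definition fejer_mean (F : R -> C) (n : nat) (t : R) : C :=
  Cmult (RtoC (/ INR (S n)))
    (sum_n (fun j => Cmult (F (node n j)) (RtoC (fejer n (t - node n j)))) n).

Lemma Cmod_sum_n_le (a : nat -> C) (b : nat -> R) (n : nat) :
  (forall j, (j <= n)%nat -> Cmod (a j) <= b j) -> Cmod (sum_n a n) <= sum_n b n.
Proof.
induction n as [|n IH]; intros Hab.
- rewrite !sum_O. now apply Hab.
- rewrite !sum_Sn. eapply Rle_trans; [ exact (Cmod_triangle _ _) | ].
  apply Rplus_le_compat; [ apply IH; intros; apply Hab; lia | now apply Hab ].
Qed.

Lemma sum_n_R_plus (a b : nat -> R) (n : nat) :
  sum_n (fun j => a j + b j) n = sum_n a n + sum_n b n.
Proof. exact (sum_n_plus a b n). Qed.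

Lemma sum_n_R_mult (c : R) (a : nat -> R) (n : nat) :
  sum_n (fun j => c * a j) n = c * sum_n a n.
Proof. exact (@sum_n_mult_l R_Ring c a n). Qed.

Lemma Cmod_fejer_mean (F : R -> C) (M : R) (n : nat) (t : R) :
  (forall s, Cmod (F s) <= M) -> Cmod (fejer_mean F n t) <= M.
Proof.
intros HF. pose proof (Rinv_0_lt_compat _ (lt_0_INR (S n) ltac:(lia))) as Hn.
unfold fejer_mean. rewrite Cmod_mult, Cmod_R, Rabs_pos_eq by lra.
apply Rle_trans with (/ INR (S n) * sum_n (fun j => M * fejer n (t - node n j)) n).
- apply Rmult_le_compat_l; [ lra | ]. apply Cmod_sum_n_le. intros j _.
  rewrite Cmod_mult, Cmod_R, Rabs_pos_eq by apply fejer_ge_0.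
  apply Rmult_le_compat_r; [ apply fejer_ge_0 | apply HF ].
- rewrite sum_n_R_mult. pose proof (fejer_average n t) as E.
  rewrite <- Rmult_assoc, (Rmult_comm _ M), Rmult_assoc, E. lra.
Qed.

(** The weights have total mass 1 by [fejer_average], so F(t) can be moved under the sum. *)
Lemma fejer_mean_minus (F : R -> C) (n : nat) (t : R) :
  Cminus (fejer_mean F n t) (F t) =
  Cmult (RtoC (/ INR (S n)))
    (sum_n (fun j => Cmult (Cminus (F (node n j)) (F t))
                      (RtoC (fejer n (t - node n j)))) n).
Proof.
pose proof (fejer_average n t) as E. apply (f_equal RtoC) in E.
rewrite RtoC_mult, RtoC_sum_n in E.
set (k := fun j => RtoC (fejer n (t - node n j))) in *.
change (Cmult (RtoC (/ INR (S n))) (sum_n k n) = RtoC 1) in E.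
transitivity (Cminus (fejer_mean F n t)
  (Cmult (F t) (Cmult (RtoC (/ INR (S n))) (sum_n k n)))).
{ rewrite E. ring. }
unfold fejer_mean. fold k.
transitivity (Cmult (RtoC (/ INR (S n)))
  (Cplus (sum_n (fun j => Cmult (F (node n j)) (k j)) n)
    (sum_n (fun j => Cmult (Copp (F t)) (k j)) n))).
{ rewrite <- (Cmult_sum_n_l (Copp (F t))). fold k. unfold k. C_eq; ring. }
f_equal. etransitivity; [ symmetry; exact (sum_n_plus _ _ n) | ].
apply sum_n_ext. intros j. fold (k j). C_eq; ring.
Qed.

(* [sin ((a - b) / 2)] is half the chord between the points of the circle with
   angles [a] and [b]. *)
Lemma chord_modulus (g : R -> R) (B : R) :
  (forall x, 0 <= x <= 2 * PI -> continuous g x) -> g 0 = 0 -> g (2 * PI) = 0 ->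
  (forall x, Rabs (g x) <= B) ->
  forall eps, 0 < eps -> exists K, 0 <= K /\
    forall a b, 0 <= a <= 2 * PI -> 0 <= b <= 2 * PI ->
      Rabs (g a - g b) <= eps + K * (sin ((a - b) / 2)) ^ 2.
Proof.
intros Hg g0 g2 HB eps Heps. pose proof PI_RGT_0 as Hpi.
destruct (unifcont_1d g 0 (2 * PI) Hg (mkposreal (eps / 2) ltac:(lra))) as [d0 Hd0].
set (d := Rmin d0 PI).
assert (Hd : 0 < d) by (apply Rmin_pos; [ apply cond_pos | lra ]).
assert (Hdpi : d <= PI) by apply Rmin_r.
assert (U : forall a b, 0 <= a <= 2 * PI -> 0 <= b <= 2 * PI -> Rabs (a - b) < d ->
  Rabs (g a - g b) <= eps / 2).
{ intros a b Ha Hb Hab. destruct (Rle_dec (Rabs (g a - g b)) (eps / 2)) as [L|L];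
    [ exact L | exfalso ].
  apply (Hd0 a b Ha Hb).
  - change (Rabs (b - a) < d0). rewrite Rabs_minus_sym.
    eapply Rlt_le_trans; [ exact Hab | apply Rmin_l ].
  - intros Q. change (Rabs (g b - g a) < eps / 2) in Q. rewrite Rabs_minus_sym in Q. lra. }
assert (Hs : 0 < sin (d / 2)) by (apply sin_gt_0; lra).
assert (HB0 : 0 <= B) by (eapply Rle_trans; [ apply Rabs_pos | apply (HB 0) ]).
(* With this K the second term alone dominates the trivial bound 2B as soon as the chord is at least
   that of d. *)
set (K := 2 * B / (sin (d / 2)) ^ 2).
assert (HK : 0 <= K).
{ apply Rmult_le_pos; [ lra | ]. apply Rlt_le, Rinv_0_lt_compat, pow_lt, Hs. }
exists K. split; [ exact HK | ].
assert (W : forall a b, 0 <= a <= 2 * PI -> 0 <= b <= 2 * PI -> a <= b ->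
  Rabs (g b - g a) <= eps + K * (sin ((b - a) / 2)) ^ 2).
{ intros a b Ha Hb Hab.
  assert (K0 : 0 <= K * (sin ((b - a) / 2)) ^ 2)
    by (apply Rmult_le_pos; [ exact HK | apply pow2_ge_0 ]).
  destruct (Rlt_dec (b - a) d) as [L1|L1].
  { assert (Rabs (g b - g a) <= eps / 2)
      by (apply U; try assumption; rewrite Rabs_pos_eq; lra). lra. }
  (* Here a and b are close on the circle but at opposite ends of the interval: both values are
     compared with g 0 = g (2 PI) = 0. *)
  destruct (Rlt_dec (2 * PI - d) (b - a)) as [L2|L2].
  { assert (Q1 : Rabs (g 0 - g a) <= eps / 2)
      by (apply U; try lra; rewrite Rabs_left1; lra).
    assert (Q2 : Rabs (g (2 * PI) - g b) <= eps / 2)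
      by (apply U; try lra; rewrite Rabs_pos_eq; lra).
    rewrite g0 in Q1. rewrite g2 in Q2.
    apply Rabs_le_between in Q1. apply Rabs_le_between in Q2.
    apply Rabs_le. lra. }
  assert (S : sin (d / 2) <= sin ((b - a) / 2)).
  { destruct (Rle_dec ((b - a) / 2) (PI / 2)) as [L3|L3].
    - apply sin_incr_1; lra.
    - rewrite <- (sin_PI_x ((b - a) / 2)). apply sin_incr_1; lra. }
  assert (S2 : (sin (d / 2)) ^ 2 <= (sin ((b - a) / 2)) ^ 2) by (apply pow_incr; lra).
  assert (Q : 2 * B <= K * (sin ((b - a) / 2)) ^ 2).
  { apply Rle_trans with (K * (sin (d / 2)) ^ 2).
    - right. unfold K. field. lra.
    - now apply Rmult_le_compat_l. }
  pose proof (HB a) as Qa. pose proof (HB b) as Qb.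
  apply Rabs_le_between in Qa. apply Rabs_le_between in Qb.
  apply Rabs_le. lra. }
intros a b Ha Hb. destruct (Rle_dec a b) as [L|L].
- rewrite Rabs_minus_sym. replace ((a - b) / 2) with (- ((b - a) / 2)) by field.
  rewrite sin_neg. replace ((- sin ((b - a) / 2)) ^ 2) with ((sin ((b - a) / 2)) ^ 2) by ring.
  now apply W.
- apply W; lra.
Qed.

Lemma Cmod_le_components (z : C) : Cmod z <= Rabs (fst z) + Rabs (snd z).
Proof.
replace z with (Cplus (RtoC (fst z)) (Cmult Ci (RtoC (snd z)))) at 1 by (C_eq; ring).
eapply Rle_trans; [ apply Cmod_triangle | ].
rewrite Cmod_mult, !Cmod_R, (Cmod_imaginary_unit Ci) by now left. lra.
Qed.

(* For [0 < t < 2 PI] the point l = tan ((t - PI) / 2) satisfies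
   e^(it) = (l - i) / (l + i); at [t = 0], which stands for l = oo, the value is junk and
   is always weighted by [sin (t / 2)]. *)
Definition on_circle (f : R -> C) (t : R) : C := f (tan ((t - PI) / 2)).

(** [on_circle f] has no modulus of continuity near 0 and 2 PI, but its product with w = sin (t / 2)
    does. The usual Fejer argument then applies: differences are at most eps plus a multiple of the
    squared half-chord, which the kernel turns into O(1/n). *)
Lemma fejer_approximation (f : R -> C) :
  bounded_continuous f -> forall eps, 0 < eps ->
  exists N, forall n, (N <= n)%nat -> forall t, 0 <= t < 2 * PI ->
    Cmod (Cminus (fejer_mean (on_circle f) n t) (on_circle f t)) * sin (t / 2) <= eps.
Proof.
intros [Hc [M HM]] eps Heps. pose proof PI_RGT_0 as Hpi.
set (F := on_circle f).
assert (HF : forall s, Cmod (F s) <= M) by (intros s; apply HM).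
assert (HM0 : 0 <= M) by (eapply Rle_trans; [ apply Cmod_ge_0 | apply (HM 0) ]).
set (w := fun t => sin (t / 2)).
assert (wc : forall x, continuous w x).
{ intros x. apply (@ex_derive_continuous R_AbsRing R_NormedModule).
  unfold w. auto_derive. trivial. }
assert (w0 : w 0 = 0) by (unfold w; replace (0 / 2) with 0 by field; apply sin_0).
assert (w2 : w (2 * PI) = 0)
  by (unfold w; replace (2 * PI / 2) with PI by field; apply sin_PI).
assert (w1 : forall x, Rabs (w x) <= 1) by (intros x; apply Rabs_le, SIN_bound).
(* At the ends of the interval continuity comes from w vanishing there while F stays bounded;
   inside, from continuity of the tangent and of f. *)
assert (Gc : forall pr : C -> R, (forall z, continuous pr z) ->
  (forall z, Rabs (pr z) <= Cmod z) ->
  forall x, 0 <= x <= 2 * PI -> continuous (fun t => w t * pr (F t)) x).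
{ intros pr prc prb x Hx.
  assert (Zero : w x = 0 -> continuous (fun t => w t * pr (F t)) x).
  { intros Hw. apply (proj2 (filterlim_locally _ _)). intros e.
    assert (He : 0 < pos e / (M + 1))
      by (apply Rdiv_lt_0_compat; [ apply cond_pos | lra ]).
    pose proof (proj1 (filterlim_locally _ _) (wc x) (mkposreal _ He)) as Q.
    apply filter_imp with (2 := Q). intros t Ht.
    change (Rabs (w t * pr (F t) - w x * pr (F x)) < e).
    change (Rabs (w t - w x) < pos e / (M + 1)) in Ht.
    rewrite Hw in Ht |- *. rewrite Rmult_0_l, Rminus_0_r, Rabs_mult.
    rewrite Rminus_0_r in Ht.
    apply Rle_lt_trans with (Rabs (w t) * (M + 1)).
    - apply Rmult_le_compat_l; [ apply Rabs_pos | ].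
      pose proof (prb (F t)). pose proof (HF t). lra.
    - apply Rmult_lt_compat_r with (r := M + 1) in Ht; [ | lra ].
      replace (pos e / (M + 1) * (M + 1)) with (pos e) in Ht by (field; lra). exact Ht. }
  destruct (Req_dec x 0) as [->|H0]; [ now apply Zero | ].
  destruct (Req_dec x (2 * PI)) as [->|H2]; [ now apply Zero | ].
  apply (continuous_mult w (fun t => pr (F t)) x); [ apply wc | ].
  apply (continuous_comp F pr); [ | apply prc ].
  apply (continuous_comp (fun t => tan ((t - PI) / 2)) f); [ | apply Hc ].
  apply (continuous_comp (fun t => (t - PI) / 2) tan).
  - apply (@ex_derive_continuous R_AbsRing R_NormedModule). auto_derive. trivial.
  - apply continuous_tan. apply Rgt_not_eq. apply cos_gt_0; lra. }
assert (Gb : forall pr : C -> R, (forall z, Rabs (pr z) <= Cmod z) ->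
  forall x, Rabs (w x * pr (F x)) <= M).
{ intros pr prb x. rewrite Rabs_mult.
  replace M with (1 * M) by ring. apply Rmult_le_compat; try apply Rabs_pos.
  - apply w1.
  - eapply Rle_trans; [ apply prb | apply HF ]. }
assert (p1 : forall z : C, Rabs (fst z) <= Cmod z)
  by (intros z; eapply Rle_trans; [ apply Rmax_l | apply Rmax_Cmod ]).
assert (p2 : forall z : C, Rabs (snd z) <= Cmod z)
  by (intros z; eapply Rle_trans; [ apply Rmax_r | apply Rmax_Cmod ]).
(* The real part of wF, its imaginary part and w itself cost eps / 6 each; the last modulus is
   divided by M + 1 since it gets multiplied by |F|. The other eps / 2 is left for K / (n + 1). *)
destruct (chord_modulus (fun t => w t * fst (F t)) M) with (eps := eps / 6)
  as [K1 [HK1 C1]]; try lra.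
{ apply Gc; [ intros z; apply continuous_fst | exact p1 ]. }
{ rewrite w0. ring. }
{ rewrite w2. ring. }
{ now apply Gb. }
destruct (chord_modulus (fun t => w t * snd (F t)) M) with (eps := eps / 6)
  as [K2 [HK2 C2]]; try lra.
{ apply Gc; [ intros z; apply continuous_snd | exact p2 ]. }
{ rewrite w0. ring. }
{ rewrite w2. ring. }
{ now apply Gb. }
destruct (chord_modulus w 1) with (eps := eps / (6 * (M + 1)))
  as [K3 [HK3 C3]]; try assumption.
{ intros x _. apply wc. }
{ apply Rdiv_lt_0_compat; lra. }
set (K := K1 + K2 + (M + 1) * K3).
assert (HK : 0 <= K) by (unfold K; nra).
destruct (archimed_cor1 (eps / (2 * (K + 1)))) as [N [HN HN0]].
{ apply Rdiv_lt_0_compat; lra. }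
exists N. intros n Hn t Ht.
assert (Hw : 0 <= w t) by (apply sin_ge_0; lra).
assert (L : forall j, (j <= n)%nat ->
  Cmod (Cminus (F (node n j)) (F t)) * w t <=
  eps / 2 + K * (sin ((t - node n j) / 2)) ^ 2).
{ intros j Hj. pose proof (node_range n j Hj) as Hs. set (s := node n j) in *.
  specialize (C1 t s ltac:(lra) ltac:(lra)). specialize (C2 t s ltac:(lra) ltac:(lra)).
  specialize (C3 t s ltac:(lra) ltac:(lra)).
  set (q := (sin ((t - s) / 2)) ^ 2) in *.
  (* The weight is taken at t only, whereas the moduli control w(t)F(t) - w(s)F(s); the correction
     (w(t) - w(s)) F(s) is the reason for the modulus of w. *)
  assert (D : Cmod (Cminus (F s) (F t)) * w t =
    Cmod (Cminus (Cmult (RtoC (w t - w s)) (F s))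
      (Cminus (Cmult (RtoC (w t)) (F t)) (Cmult (RtoC (w s)) (F s))))).
  { rewrite <- (Rabs_pos_eq (w t)) at 1 by exact Hw.
    rewrite <- Cmod_R, <- Cmod_mult. f_equal. rewrite RtoC_minus. ring. }
  rewrite D. unfold Cminus at 1. eapply Rle_trans; [ apply Cmod_triangle | ].
  rewrite Cmod_opp, Cmod_mult, Cmod_R.
  pose proof (Cmod_le_components
    (Cminus (Cmult (RtoC (w t)) (F t)) (Cmult (RtoC (w s)) (F s)))) as Q.
  replace (fst (Cminus (Cmult (RtoC (w t)) (F t)) (Cmult (RtoC (w s)) (F s))))
    with (w t * fst (F t) - w s * fst (F s)) in Q by (cbn; ring).
  replace (snd (Cminus (Cmult (RtoC (w t)) (F t)) (Cmult (RtoC (w s)) (F s))))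
    with (w t * snd (F t) - w s * snd (F s)) in Q by (cbn; ring).
  assert (Q3 : Rabs (w t - w s) * Cmod (F s) <=
    (eps / (6 * (M + 1)) + K3 * q) * (M + 1)).
  { apply Rmult_le_compat; [ apply Rabs_pos | apply Cmod_ge_0 | exact C3 | ].
    pose proof (HF s). lra. }
  replace ((eps / (6 * (M + 1)) + K3 * q) * (M + 1))
    with (eps / 6 + (M + 1) * K3 * q) in Q3 by (field; lra).
  unfold K. lra. }
fold F. rewrite fejer_mean_minus, Cmod_mult, Cmod_R.
pose proof (lt_0_INR (S n) ltac:(lia)) as Hn1.
pose proof (Rinv_0_lt_compat _ Hn1) as Hn2.
rewrite Rabs_pos_eq by lra. fold (w t).
apply Rle_trans with (/ INR (S n) * sum_n (fun j =>
  eps / 2 * fejer n (t - node n j) + K * / INR (S n)) n).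
- rewrite Rmult_assoc. apply Rmult_le_compat_l; [ lra | ].
  rewrite Rmult_comm, <- (Rabs_pos_eq (w t)) by exact Hw.
  rewrite <- Cmod_R, <- Cmod_mult, Cmult_sum_n_l.
  apply Cmod_sum_n_le. intros j Hj.
  rewrite !Cmod_mult, !Cmod_R, (Rabs_pos_eq (w t)), (Rabs_pos_eq (fejer _ _))
    by (assumption || apply fejer_ge_0).
  specialize (L j Hj). pose proof (fejer_decay n (t - node n j)) as Q.
  pose proof (fejer_ge_0 n (t - node n j)) as Q0.
  apply Rmult_le_compat_r with (r := fejer n (t - node n j)) in L; [ | exact Q0 ].
  apply Rmult_le_compat_l with (r := K) in Q; [ | exact HK ]. lra.
- rewrite sum_n_R_plus, sum_n_R_mult, sum_n_const, Rmult_plus_distr_l.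
  pose proof (fejer_average n t) as E.
  replace (/ INR (S n) * (eps / 2 * sum_n (fun j => fejer n (t - node n j)) n))
    with (eps / 2 * (/ INR (S n) * sum_n (fun j => fejer n (t - node n j)) n)) by ring.
  rewrite E.
  replace (/ INR (S n) * (INR (S n) * (K * / INR (S n)))) with (K * / INR (S n))
    by (field; lra).
  assert (L1 : / INR (S n) <= / INR N).
  { apply Rinv_le_contravar; [ now apply lt_0_INR | ]. apply le_INR. lia. }
  assert (L2 : K * / INR (S n) <= (K + 1) * (eps / (2 * (K + 1))))
    by (apply Rmult_le_compat; lra).
  replace ((K + 1) * (eps / (2 * (K + 1)))) with (eps / 2) in L2 by (field; lra).
  lra.
Qed.
(** * The continuous functional calculus *)

Lemma continuous_C (f : R -> C) (x : R) :
  continuous f x <->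
  continuous (fun t => fst (f t)) x /\ continuous (fun t => snd (f t)) x.
Proof.
split.
- intros Hf. split.
  + apply (continuous_comp f fst); [ exact Hf | apply continuous_fst ].
  + apply (continuous_comp f snd); [ exact Hf | apply continuous_snd ].
- intros [H1 H2]. apply (proj2 (filterlim_locally _ _)). intros e.
  pose proof (proj1 (filterlim_locally _ _) H1 e) as Q1.
  pose proof (proj1 (filterlim_locally _ _) H2 e) as Q2.
  generalize (filter_and _ _ Q1 Q2). apply filter_imp.
  intros t [B1 B2]. split; assumption.
Qed.

Lemma bounded_continuous_plus (f g : R -> C) :
  bounded_continuous f -> bounded_continuous g ->
  bounded_continuous (fun l => Cplus (f l) (g l)).
Proof.
intros [Cf [M HM]] [Cg [N HN]]. split.
- intros l. destruct (proj1 (continuous_C f l) (Cf l)) as [F1 F2].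
  destruct (proj1 (continuous_C g l) (Cg l)) as [G1 G2].
  apply continuous_C. split.
  + exact (continuous_plus _ _ l F1 G1).
  + exact (continuous_plus _ _ l F2 G2).
- exists (M + N). intros l. eapply Rle_trans; [ apply Cmod_triangle | ].
  specialize (HM l). specialize (HN l). lra.
Qed.

Lemma bounded_continuous_mult (f g : R -> C) :
  bounded_continuous f -> bounded_continuous g ->
  bounded_continuous (fun l => Cmult (f l) (g l)).
Proof.
intros [Cf [M HM]] [Cg [N HN]]. split.
- intros l. destruct (proj1 (continuous_C f l) (Cf l)) as [F1 F2].
  destruct (proj1 (continuous_C g l) (Cg l)) as [G1 G2].
  apply continuous_C. split.
  + apply (continuous_minus (fun t => fst (f t) * fst (g t))
             (fun t => snd (f t) * snd (g t)) l).
    * exact (continuous_mult (fun t => fst (f t)) (fun t => fst (g t)) l F1 G1).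
    * exact (continuous_mult (fun t => snd (f t)) (fun t => snd (g t)) l F2 G2).
  + apply (continuous_plus (fun t => fst (f t) * snd (g t))
             (fun t => snd (f t) * fst (g t)) l).
    * exact (continuous_mult (fun t => fst (f t)) (fun t => snd (g t)) l F1 G2).
    * exact (continuous_mult (fun t => snd (f t)) (fun t => fst (g t)) l F2 G1).
- exists (M * N). intros l. rewrite Cmod_mult.
  apply Rmult_le_compat; try apply Cmod_ge_0; auto.
Qed.

Lemma bounded_continuous_const (z : C) : bounded_continuous (fun _ => z).
Proof.
split.
- intros l. apply continuous_const.
- exists (Cmod z). intros _. lra.
Qed.

Lemma bounded_continuous_conj (f : R -> C) :
  bounded_continuous f -> bounded_continuous (fun l => Cconj (f l)).
Proof.
intros [Cf [M HM]]. split.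
- intros l. destruct (proj1 (continuous_C f l) (Cf l)) as [F1 F2].
  apply continuous_C. split; [ exact F1 | exact (continuous_opp _ l F2) ].
- exists M. intros l. rewrite Cmod_conj. apply HM.
Qed.

Definition resolvent_fun (l : R) : C := Cinv (Cplus (RtoC l) Ci).

Lemma resolvent_fun_eq (l : R) :
  resolvent_fun l = (l / (l * l + 1), - / (l * l + 1)).
Proof.
unfold resolvent_fun. assert (0 <= l * l) by nra.
C_eq; field; nra.
Qed.

Lemma Cmod_resolvent_fun (l : R) : Cmod (resolvent_fun l) = / sqrt (l * l + 1).
Proof.
assert (0 <= l * l) by nra.
rewrite resolvent_fun_eq, <- sqrt_inv. unfold Cmod. f_equal. cbn. field. nra.
Qed.

Lemma Cmod_resolvent_fun_le_1 (l : R) : Cmod (resolvent_fun l) <= 1.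
Proof.
rewrite Cmod_resolvent_fun, <- Rinv_1.
apply Rinv_le_contravar; [ lra | ]. rewrite <- sqrt_1 at 1. apply sqrt_le_1_alt. nra.
Qed.

Lemma bounded_continuous_resolvent_fun : bounded_continuous resolvent_fun.
Proof.
split; [ | exists 1; apply Cmod_resolvent_fun_le_1 ].
intros l. apply (continuous_ext (fun l => (l / (l * l + 1), - / (l * l + 1)))).
- intros t. symmetry. apply resolvent_fun_eq.
- assert (0 <= l * l) by nra.
  apply continuous_C. split; cbn;
    apply (@ex_derive_continuous R_AbsRing R_NormedModule); auto_derive; lra.
Qed.

(** With e^(it) = (l - i)/(l + i), one has 1 - e^(it) = 2i/(l + i). *)
Lemma resolvent_fun_on_circle (t : R) : 0 < t < 2 * PI ->
  on_circle resolvent_fun t =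
  Cmult (Cinv (Cmult (RtoC 2) Ci)) (Cminus (RtoC 1) (cis t)).
Proof.
intros Ht. pose proof PI_RGT_0 as Hpi. unfold on_circle.
set (p := (t - PI) / 2).
assert (Hc : 0 < cos p) by (apply cos_gt_0; unfold p; lra).
replace t with (2 * p + PI) by (unfold p; field).
rewrite resolvent_fun_eq. unfold tan, cis.
rewrite neg_cos, neg_sin, cos_2a, sin_2a.
pose proof (sin2_cos2 p) as E. unfold Rsqr in E.
assert (D : sin p / cos p * (sin p / cos p) + 1 = / (cos p * cos p)).
{ transitivity ((sin p * sin p + cos p * cos p) * / (cos p * cos p));
    [ field; lra | rewrite E; ring ]. }
rewrite D, Rinv_inv.
C_eq.
- field. lra.
- field_simplify. lra.
Qed.

(** * Functions of P as strong limits of trigonometric polynomials of U *)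

Section CalculusConstruction.
Context {A : CStarAlgebra} {H : HilbertModule A} (P : Operator H).
Hypothesis (Preg : regular P) (Psa : selfadjoint P).

Lemma trig_sum (N n : nat) (a : nat -> R -> C) :
  (forall j, exists T, trig P N (a j) T) ->
  exists T, trig P N (fun t => sum_n (fun j => a j t) n) T.
Proof.
intros Ha. induction n as [|n [S HS]].
- destruct (Ha 0%nat) as [T HT]. exists T.
  apply (trig_ext P N (a 0%nat) _ T); [ exact HT | | reflexivity ].
  intros t. apply sum_O.
- destruct (Ha (Datatypes.S n)) as [T HT]. exists (fun x => plus (S x) (T x)).
  apply (trig_ext P _ _ _ _ _ (trig_plus P _ _ _ _ _ HS HT)); [ | reflexivity ].
  intros t. exact (sum_Sn (fun j => a j t) n).
Qed.

(** Capping the index at n extends the family to all j without changing the sum. *)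
Lemma trig_sum_degree (N n : nat) (a : nat -> R -> C) :
  (forall j, (j <= n)%nat -> exists T, trig P N (a j) T) ->
  exists T, trig P N (fun t => sum_n (fun j => a j t) n) T.
Proof.
intros Ha.
destruct (trig_sum N n (fun j => a (Nat.min j n))) as [T HT].
- intros j. apply Ha. lia.
- exists T. apply (trig_ext P _ _ _ _ _ HT); [ | reflexivity ].
  intros t. apply sum_n_ext_loc. intros j Hj. now rewrite Nat.min_l.
Qed.

Lemma trig_fejer_mean (F : R -> C) (n : nat) :
  exists T, trig P n (fejer_mean F n) T.
Proof.
set (c := RtoC (/ INR (S n))).
destruct (trig_sum_degree n n (fun j t =>
  Cmult (F (node n j)) (RtoC (fejer n (t - node n j))))) as [T HT].
- intros j _.
  destruct (trig_sum_degree n n (fun k t => sum_n (fun l =>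
    cis (IZR (Z.of_nat k - Z.of_nat l) * (t - node n j))) n)) as [T HT].
  + intros k Hk. apply trig_sum_degree. intros l Hl.
    set (m := (Z.of_nat k - Z.of_nat l)%Z).
    exists (fun x => scal (cis (- (IZR m * node n j))) (cayley_pow P m x)).
    apply (trig_ext P n (fun t => Cmult (cis (- (IZR m * node n j))) (cis (IZR m * t)))
      _ (fun x => scal (cis (- (IZR m * node n j))) (cayley_pow P m x))).
    * apply trig_scal, trig_mono. lia.
    * intros t. rewrite <- cis_plus. f_equal. ring.
    * reflexivity.
  + exists (fun x => scal (F (node n j)) (scal c (T x))).
    apply (trig_ext P _ _ _ _ _
      (trig_scal P _ (F (node n j)) _ _ (trig_scal P _ c _ _ HT))); [ | reflexivity ].
    intros t. now rewrite fejer_expansion.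
- exists (fun x => scal c (T x)).
  apply (trig_ext P _ _ _ _ _ (trig_scal P _ c _ _ HT)); reflexivity.
Qed.

(** Bounded, locally uniform convergence on the line, in the coordinate of the circle: sin (t / 2)
    is the modulus of 1 / (l + i). The degree may depend on n. *)
Definition approximates (f : R -> C) (p : nat -> R -> C) (T : nat -> H -> H) : Prop :=
  (forall n, exists N, trig P N (p n) (T n)) /\
  (exists M, 0 < M /\ forall n t, 0 <= t < 2 * PI -> Cmod (p n t) <= M) /\
  (forall eps, 0 < eps -> exists N, forall n, (N <= n)%nat ->
     forall t, 0 <= t < 2 * PI ->
     Cmod (Cminus (p n t) (on_circle f t)) * sin (t / 2) <= eps).

Definition approximant (f : R -> C) (n : nat) : H -> H :=
  proj1_sig (constructive_indefinite_description _ (trig_fejer_mean (on_circle f) n)).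

Lemma approximates_approximant (f : R -> C) : bounded_continuous f ->
  approximates f (fejer_mean (on_circle f)) (approximant f).
Proof.
intros Hf. split; [ | split ].
- intros n. exists n. unfold approximant.
  exact (proj2_sig (constructive_indefinite_description _
    (trig_fejer_mean (on_circle f) n))).
- destruct Hf as [_ [M HM]]. exists (Rmax M 1).
  split; [ eapply Rlt_le_trans; [ | apply Rmax_r ]; lra | ].
  intros n t _. apply Cmod_fejer_mean. intros s.
  eapply Rle_trans; [ apply HM | apply Rmax_l ].
- now apply fejer_approximation.
Qed.

(** The definition U = 1 - 2i (P + i)^-1, solved for the resolvent. *)
Lemma trig_resolvent :
  trig P 1 (fun t => Cmult (Cinv (Cmult (RtoC 2) Ci)) (Cminus (RtoC 1) (cis t)))
    (resolvent P Ci).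
Proof.
pose proof (trig_mono P 1 1 ltac:(lia)) as HU.
pose proof (trig_plus P _ _ _ _ _ (trig_id P 1)
  (trig_scal P _ (Copp (RtoC 1)) _ _ HU)) as HS.
apply (trig_scal P _ (Cinv (Cmult (RtoC 2) Ci))) in HS.
apply (trig_ext P _ _ _ _ _ HS).
- intros t. rewrite Rmult_1_l. C_eq; field.
- intros x. change (cayley_pow P 1 x) with (cayley P Ci x). unfold cayley.
  vlinear H; C_eq; field.
Qed.

Lemma sin_half_ge_0 (t : R) : 0 <= t < 2 * PI -> 0 <= sin (t / 2) <= 1.
Proof.
intros Ht. pose proof (SIN_bound (t / 2)).
split; [ apply sin_ge_0; lra | lra ].
Qed.

Lemma Cmod_resolvent_symbol (t : R) : 0 <= t < 2 * PI ->
  Cmod (Cmult (Cinv (Cmult (RtoC 2) Ci)) (Cminus (RtoC 1) (cis t))) = sin (t / 2).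
Proof.
intros Ht. pose proof (sin_half_ge_0 t Ht).
assert (E : Cmod (Cmult (RtoC 2) Ci) = 2).
{ rewrite Cmod_mult, Cmod_R, (Cmod_imaginary_unit Ci) by now left.
  rewrite Rabs_pos_eq; lra. }
rewrite Cmod_mult, Cmod_inv, E.
2: { intros Z0. rewrite Z0, Cmod_0 in E. lra. }
replace (Cminus (RtoC 1) (cis t)) with (Copp (Cminus (cis t) (RtoC 1))) by ring.
rewrite Cmod_opp, Cmod_cis_minus_1, Rabs_pos_eq by lra. field.
Qed.

(** Approximate x by some y = (P + i)^-1 v in the dense domain. Then Ty = p(U)(P + i)^-1 v has a
    symbol of modulus |p| sin (t / 2), which is small, and T(x - y) is controlled by M. It matters
    that d does not depend on the degree. *)
Lemma trig_small (M : R) (x : H) (eps : R) : 0 < M -> 0 < eps ->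
  exists d, 0 < d /\ forall N p T, trig P N p T ->
    (forall t, 0 <= t < 2 * PI -> Cmod (p t) <= M) ->
    (forall t, 0 <= t < 2 * PI -> Cmod (p t) * sin (t / 2) <= d) ->
    norm (T x) <= eps.
Proof.
intros HM Heps.
assert (He : 0 < eps / (4 * M)) by (apply Rdiv_lt_0_compat; lra).
destruct Preg as [_ [D _]]. destruct (D x (mkposreal _ He)) as [y [Hy Hxy]].
cbn in Hxy.
assert (iu : imaginary_unit Ci) by now left.
set (v := shift P Ci y). pose proof (norm_ge_0 v) as Hv.
(* The constants allow for the factor 2 of [norm_trig]: eps / 2 goes to T (x - y) and eps / 2 to T
   y. *)
exists (eps / (4 * (norm v + 1))).
assert (Hd : 0 < eps / (4 * (norm v + 1))) by (apply Rdiv_lt_0_compat; lra).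
split; [ exact Hd | ].
intros N p T HT B1 B2.
apply (norm_le_eq (plus (T (minus x y)) (T y))).
{ rewrite (trig_app_minus P Preg Psa N p T x y HT). vring H. }
replace eps with (2 * M * (eps / (4 * M)) + eps / 2) by (field; lra).
apply norm_plus_le2.
- eapply Rle_trans; [ apply (norm_trig P Preg Psa N p T M _ HT HM B1) | ].
  apply Rmult_le_compat_l; [ lra | ]. now apply Rlt_le.
- rewrite <- (resolvent_shift P Preg Psa Ci y iu Hy). fold v.
  eapply Rle_trans.
  + apply (norm_trig P Preg Psa _ _ _ (eps / (4 * (norm v + 1))) v
      (trig_mult P Preg Psa _ _ _ _ _ _ HT trig_resolvent) Hd).
    intros t Ht. rewrite Cmod_mult, Cmod_resolvent_symbol by exact Ht. now apply B2.
  + replace (eps / 2) with (2 * (eps / (4 * (norm v + 1))) * (norm v + 1))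
      by (field; lra).
    apply Rmult_le_compat_l; lra.
Qed.

(** Taken with S = T this is the Cauchy property; with two sequences it shows that the limit does
    not depend on the choice. *)
Lemma approximates_close (f : R -> C) (p q : nat -> R -> C) (S T : nat -> H -> H)
    (x : H) (eps : R) :
  approximates f p S -> approximates f q T -> 0 < eps ->
  exists N, forall n m, (N <= n)%nat -> (N <= m)%nat ->
    norm (minus (S n x) (T m x)) <= eps.
Proof.
intros [HS [[M [HM Bp]] Lp]] [HT [[M' [HM' Bq]] Lq]] Heps.
destruct (trig_small (M + M') x eps) as [d [Hd D]]; [ lra | exact Heps | ].
destruct (Lp (d / 2)) as [N1 H1]; [ lra | ].
destruct (Lq (d / 2)) as [N2 H2]; [ lra | ].
exists (Nat.max N1 N2). intros n m Hn Hm.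
destruct (HS n) as [K HK]. destruct (HT m) as [L HL].
apply (D _ _ _ (trig_minus P _ _ _ _ _ _ HK HL)).
- intros t Ht. specialize (Bp n t Ht). specialize (Bq m t Ht).
  unfold Cminus. eapply Rle_trans; [ apply Cmod_triangle | ]. rewrite Cmod_opp. lra.
- intros t Ht. specialize (H1 n ltac:(lia) t Ht). specialize (H2 m ltac:(lia) t Ht).
  pose proof (sin_half_ge_0 t Ht) as Hs.
  replace (Cminus (p n t) (q m t)) with
    (Cplus (Cminus (p n t) (on_circle f t)) (Copp (Cminus (q m t) (on_circle f t))))
    by ring.
  eapply Rle_trans; [ apply Rmult_le_compat_r; [ lra | apply Cmod_triangle ] | ].
  rewrite Cmod_opp. lra.
Qed.

Definition calculus (f : R -> C) (x : H) : H :=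
  epsilon (inhabits zero) (conv (fun n => approximant f n x)).

Lemma conv_approximant (f : R -> C) (x : H) : bounded_continuous f ->
  conv (fun n => approximant f n x) (calculus f x).
Proof.
intros Hf. apply (epsilon_spec (inhabits zero) (conv (fun n => approximant f n x))).
apply conv_complete. intros eps Heps.
apply (approximates_close f _ _ _ _ x eps (approximates_approximant f Hf)
  (approximates_approximant f Hf) Heps).
Qed.

(** The algebraic identities rest on this freedom: sums, products and adjoints of approximants are
    approximating sequences, but not the Fejer means themselves. *)
Lemma conv_approximates (f : R -> C) (p : nat -> R -> C) (T : nat -> H -> H) (x : H) :
  bounded_continuous f -> approximates f p T -> conv (fun n => T n x) (calculus f x).
Proof.
intros Hf HT. apply conv_eps. intros eps Heps.
destruct (approximates_close f _ _ _ _ x (eps / 2) HT (approximates_approximant f Hf))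
  as [N1 H1]; [ lra | ].
destruct (proj1 (conv_eps _ _) (conv_approximant f x Hf) (eps / 2)) as [N2 H2]; [ lra | ].
exists (Nat.max N1 N2). intros n Hn.
eapply Rle_trans; [ apply (norm_minus_trans (approximant f n x)) | ].
specialize (H1 n n ltac:(lia) ltac:(lia)). specialize (H2 n ltac:(lia)). lra.
Qed.

Lemma approximates_plus (f g : R -> C) (p q : nat -> R -> C) (S T : nat -> H -> H) :
  approximates f p S -> approximates g q T ->
  approximates (fun l => Cplus (f l) (g l)) (fun n t => Cplus (p n t) (q n t))
    (fun n x => plus (S n x) (T n x)).
Proof.
intros [HS [[M [HM Bp]] Lp]] [HT [[M' [HM' Bq]] Lq]]. split; [ | split ].
- intros n. destruct (HS n) as [K HK]. destruct (HT n) as [L HL]. exists (K + L)%nat.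
  apply trig_plus; [ apply trig_le with (2 := HK) | apply trig_le with (2 := HL) ]; lia.
- exists (M + M'). split; [ lra | ]. intros n t Ht.
  eapply Rle_trans; [ apply Cmod_triangle | ].
  specialize (Bp n t Ht). specialize (Bq n t Ht). lra.
- intros eps Heps. destruct (Lp (eps / 2)) as [N1 H1]; [ lra | ].
  destruct (Lq (eps / 2)) as [N2 H2]; [ lra | ].
  exists (Nat.max N1 N2). intros n Hn t Ht.
  specialize (H1 n ltac:(lia) t Ht). specialize (H2 n ltac:(lia) t Ht).
  pose proof (sin_half_ge_0 t Ht) as Hs.
  change (on_circle (fun l => Cplus (f l) (g l)) t)
    with (Cplus (on_circle f t) (on_circle g t)).
  replace (Cminus (Cplus (p n t) (q n t)) (Cplus (on_circle f t) (on_circle g t)))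
    with (Cplus (Cminus (p n t) (on_circle f t)) (Cminus (q n t) (on_circle g t))) by ring.
  eapply Rle_trans; [ apply Rmult_le_compat_r; [ lra | apply Cmod_triangle ] | ].
  lra.
Qed.

Lemma approximates_mult (f g : R -> C) (p q : nat -> R -> C) (S T : nat -> H -> H) :
  bounded_continuous f -> approximates f p S -> approximates g q T ->
  approximates (fun l => Cmult (f l) (g l)) (fun n t => Cmult (p n t) (q n t))
    (fun n x => S n (T n x)).
Proof.
intros [_ [B HB]] [HS [[M [HM Bp]] Lp]] [HT [[M' [HM' Bq]] Lq]].
assert (HB0 : 0 <= B) by (eapply Rle_trans; [ apply Cmod_ge_0 | apply (HB 0) ]).
split; [ | split ].
- intros n. destruct (HS n) as [K HK]. destruct (HT n) as [L HL]. exists (K + L)%nat.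
  now apply trig_mult.
- exists (M * M'). split; [ now apply Rmult_lt_0_compat | ]. intros n t Ht.
  rewrite Cmod_mult. apply Rmult_le_compat; try apply Cmod_ge_0; auto.
- intros eps Heps.
  destruct (Lp (eps / (2 * M'))) as [N1 H1]; [ apply Rdiv_lt_0_compat; lra | ].
  destruct (Lq (eps / (2 * (B + 1)))) as [N2 H2]; [ apply Rdiv_lt_0_compat; lra | ].
  exists (Nat.max N1 N2). intros n Hn t Ht.
  specialize (H1 n ltac:(lia) t Ht). specialize (H2 n ltac:(lia) t Ht).
  specialize (Bq n t Ht). pose proof (sin_half_ge_0 t Ht) as Hs.
  change (on_circle (fun l => Cmult (f l) (g l)) t)
    with (Cmult (on_circle f t) (on_circle g t)).
  replace (Cminus (Cmult (p n t) (q n t)) (Cmult (on_circle f t) (on_circle g t)))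
    with (Cplus (Cmult (q n t) (Cminus (p n t) (on_circle f t)))
            (Cmult (on_circle f t) (Cminus (q n t) (on_circle g t)))) by ring.
  eapply Rle_trans; [ apply Rmult_le_compat_r; [ lra | apply Cmod_triangle ] | ].
  rewrite !Cmod_mult, Rmult_plus_distr_r, !Rmult_assoc.
  replace eps with (M' * (eps / (2 * M')) + (B + 1) * (eps / (2 * (B + 1))))
    by (field; lra).
  apply Rplus_le_compat; apply Rmult_le_compat; try assumption; try apply Cmod_ge_0;
    try (apply Rmult_le_pos; [ apply Cmod_ge_0 | lra ]).
  pose proof (HB (tan ((t - PI) / 2))). unfold on_circle. lra.
Qed.

(** Agreement is asked on the open interval only; at t = 0, the point at infinity of the line, the
    weight is sin 0 = 0. *)
Lemma approximates_exact (f : R -> C) (N : nat) (p : R -> C) (T : H -> H) (M : R) :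
  trig P N p T -> 0 < M -> (forall t, 0 <= t < 2 * PI -> Cmod (p t) <= M) ->
  (forall t, 0 < t < 2 * PI -> on_circle f t = p t) ->
  approximates f (fun _ => p) (fun _ => T).
Proof.
intros HT HM Bp E. split; [ | split ].
- intros _. now exists N.
- exists M. split; [ exact HM | ]. intros _. exact Bp.
- intros eps Heps. exists 0%nat. intros n _ t Ht.
  destruct (Req_dec t 0) as [->|H0].
  + replace (0 / 2) with 0 by field. rewrite sin_0. lra.
  + rewrite E by lra. replace (Cminus (p t) (p t)) with (RtoC 0) by ring.
    rewrite Cmod_0. lra.
Qed.

Lemma conv_inner (s : nat -> H) (l y : H) :
  conv s l -> conv (fun n => inner (s n) y) (inner l y).
Proof.
intros Hs. apply conv_le with (fun n => 2 * norm y * norm (minus (s n) l)).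
- intros n. apply (norm_le_eq (inner (minus (s n) l) y)).
  + symmetry. exact (inner_minus_l (s n) l y).
  + pose proof (cauchy_schwarz_weak (minus (s n) l) y). lra.
- now apply is_lim_seq0_scal.
Qed.

Lemma conv_inner_r (s : nat -> H) (l y : H) :
  conv s l -> conv (fun n => inner y (s n)) (inner y l).
Proof.
intros Hs. apply conv_le with (fun n => 2 * norm y * norm (minus (s n) l)).
- intros n. apply (norm_le_eq (inner y (minus (s n) l))).
  + symmetry. exact (inner_minus_r y (s n) l).
  + pose proof (cauchy_schwarz_weak y (minus (s n) l)). lra.
- now apply is_lim_seq0_scal.
Qed.

Lemma calculus_adjoint (f : R -> C) (x y : H) : bounded_continuous f ->
  inner (calculus f x) y = inner x (calculus (fun l => Cconj (f l)) y).
Proof.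
intros Hf. pose proof (approximates_approximant f Hf) as [HS [[M [HM Bp]] Lp]].
set (p := fejer_mean (on_circle f)) in *.
assert (Ad : forall n, exists T, (exists N, trig P N (fun t => Cconj (p n t)) T) /\
  forall x y, inner (approximant f n x) y = inner x (T y)).
{ intros n. destruct (HS n) as [N HN].
  destruct (trig_adjoint P Preg Psa N _ _ HN) as [T [HT ET]].
  exists T. split; [ now exists N | exact ET ]. }
set (T := fun n => proj1_sig (constructive_indefinite_description _ (Ad n))).
assert (HT : forall n, (exists N, trig P N (fun t => Cconj (p n t)) (T n)) /\
  forall x y, inner (approximant f n x) y = inner x (T n y))
  by (intros n; exact (proj2_sig (constructive_indefinite_description _ (Ad n)))).
assert (Ap : approximates (fun l => Cconj (f l)) (fun n t => Cconj (p n t)) T).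
{ split; [ | split ].
  - intros n. apply HT.
  - exists M. split; [ exact HM | ]. intros n t Ht. rewrite Cmod_conj. now apply Bp.
  - intros eps Heps. destruct (Lp eps Heps) as [N HN]. exists N. intros n Hn t Ht.
    change (on_circle (fun l => Cconj (f l)) t) with (Cconj (on_circle f t)).
    replace (Cminus (Cconj (p n t)) (Cconj (on_circle f t)))
      with (Cconj (Cminus (p n t) (on_circle f t))) by (C_eq; ring).
    rewrite Cmod_conj. now apply HN. }
apply (conv_unique (fun n => inner (approximant f n x) y)).
- apply conv_inner, conv_approximant, Hf.
- pose proof (conv_inner_r _ _ x
    (conv_approximates _ _ _ y (bounded_continuous_conj f Hf) Ap)) as L.
  apply is_lim_seq_ext with (2 := L). intros n. now rewrite (proj2 (HT n)).
Qed.

Lemma calculus_mult (f g : R -> C) (x : H) :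
  bounded_continuous f -> bounded_continuous g ->
  calculus (fun l => Cmult (f l) (g l)) x = calculus f (calculus g x).
Proof.
intros Hf Hg. pose proof (approximates_approximant f Hf) as Af.
pose proof (approximates_approximant g Hg) as Ag.
apply (conv_unique (fun n => approximant f n (approximant g n x))).
- apply (conv_approximates _ _ _ x (bounded_continuous_mult f g Hf Hg)
    (approximates_mult f g _ _ _ _ Hf Af Ag)).
- destruct Af as [HS [[M [HM Bp]] Lp]].
  (* The product of strongly convergent sequences converges because the left factors are uniformly
     bounded, here by 2M. *)
  apply conv_le with (fun n => 2 * M * norm (minus (approximant g n x) (calculus g x)) +
    norm (minus (approximant f n (calculus g x)) (calculus f (calculus g x)))).
  + intros n. destruct (HS n) as [N HN].
    eapply Rle_trans; [ apply (norm_minus_trans (approximant f n (calculus g x))) | ].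
    apply Rplus_le_compat_r. rewrite <- (trig_app_minus P Preg Psa _ _ _ _ _ HN).
    apply (norm_trig P Preg Psa _ _ _ _ _ HN HM (Bp n)).
  + apply is_lim_seq0_plus; [ apply is_lim_seq0_scal | ]; now apply conv_approximant.
Qed.

Lemma calculus_is_functional_calculus : is_functional_calculus P calculus.
Proof.
assert (One : forall z x, calculus (fun _ => z) x = scal z x).
{ intros z x. apply (conv_unique (fun _ => scal z x)); [ | apply conv_const ].
  apply (conv_approximates (fun _ => z) (fun _ _ => z) (fun _ x => scal z x) x
    (bounded_continuous_const z)).
  apply (approximates_exact _ 0 _ _ (Cmod z + 1)).
  - pose proof (trig_scal P 0 z _ _ (trig_id P 0)) as Q.
    apply (trig_ext P _ _ _ _ _ Q); [ | reflexivity ]. intros t. ring.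
  - pose proof (Cmod_ge_0 z). lra.
  - intros _ _. lra.
  - reflexivity. }
split; [ | split; [ | split; [ | split; [ | split ] ] ] ].
- intros f Hf x y. now apply calculus_adjoint.
- intros f g Hf Hg x.
  apply (conv_unique (fun n => plus (approximant f n x) (approximant g n x))).
  + apply (conv_approximates _ _ _ x (bounded_continuous_plus f g Hf Hg)
      (approximates_plus f g _ _ _ _ (approximates_approximant f Hf)
        (approximates_approximant g Hg))).
  + apply conv_plus; now apply conv_approximant.
- intros z f Hf x.
  rewrite (calculus_mult (fun _ => z) f x (bounded_continuous_const z) Hf).
  apply One.
- intros f g Hf Hg x. now apply calculus_mult.
- intros x. rewrite One. exact (scal_one x).
- intros x y. assert (iu : imaginary_unit Ci) by now left.
  assert (E : calculus resolvent_fun x = resolvent P Ci x).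
  { apply (conv_unique (fun _ => resolvent P Ci x)); [ | apply conv_const ].
    eapply (conv_approximates resolvent_fun _ (fun _ => resolvent P Ci) x
      bounded_continuous_resolvent_fun).
    apply (approximates_exact _ 1 _ _ 1 trig_resolvent); [ lra | | ].
    - intros t Ht. rewrite Cmod_resolvent_symbol by exact Ht.
      apply (sin_half_ge_0 t Ht).
    - exact resolvent_fun_on_circle. }
  change (calculus resolvent_fun x) with y in E. rewrite E. split.
  + now apply dom_resolvent.
  + exact (shift_resolvent P Preg Psa Ci x iu).
Qed.

Lemma cfc_is_functional_calculus : is_functional_calculus P (cfc P).
Proof.
apply (epsilon_spec (inhabits (fun (_ : R -> C) (x : H) => x))
  (is_functional_calculus P)).
exists calculus. exact calculus_is_functional_calculus.
Qed.

End CalculusConstruction.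
(** * The unitary group *)

Lemma Rabs_sin_le (x : R) : Rabs (sin x) <= Rabs x.
Proof.
assert (Pos : forall y, 0 < y -> Rabs (sin y) <= y).
{ intros y Hy. pose proof (sin_lt_x y Hy). pose proof (SIN_bound y).
  apply Rabs_le. split; [ | lra ].
  destruct (Rle_dec y 1); [ | lra ].
  pose proof PI_RGT_0. pose proof (sin_ge_0 y ltac:(lra)) as Q.
  pose proof PI2_1. lra. }
destruct (Rtotal_order x 0) as [Hx|[->|Hx]].
- rewrite <- (Rabs_Ropp (sin x)), <- sin_neg, (Rabs_left x Hx). apply Pos. lra.
- rewrite sin_0. lra.
- rewrite (Rabs_pos_eq x) by lra. now apply Pos.
Qed.

Lemma Cmod_cis_minus_1_le (a : R) : Cmod (Cminus (cis a) (RtoC 1)) <= Rabs a.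
Proof.
rewrite Cmod_cis_minus_1. pose proof (Rabs_sin_le (a / 2)) as L.
unfold Rdiv in L at 2. rewrite Rabs_mult, (Rabs_pos_eq (/ 2)) in L by lra. lra.
Qed.

(** The coordinates cos a - 1 and sin a - a are both at most a^2 in absolute value, the second by
    the mean value theorem. The constant is not sharp. *)
Lemma Cmod_cis_taylor2 (a : R) :
  Cmod (Cminus (Cminus (cis a) (RtoC 1)) (Cmult Ci (RtoC a))) <= 2 * (a * a).
Proof.
assert (Cb : forall c, Rabs (cos c - 1) <= Rabs c /\ Rabs (cos c - 1) <= c * c).
{ intros c. pose proof (Rabs_sin_le (c / 2)) as L. pose proof (SIN_bound (c / 2)) as B.
  assert (E : cos c - 1 = - (2 * (sin (c / 2) * sin (c / 2)))).
  { replace c with (2 * (c / 2)) at 1 by field. rewrite cos_2a_sin. ring. }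
  assert (S : Rabs (sin (c / 2)) <= 1) by (apply Rabs_le; lra).
  assert (E2 : Rabs (cos c - 1) = 2 * (Rabs (sin (c / 2)) * Rabs (sin (c / 2)))).
  { rewrite E, Rabs_Ropp, !Rabs_mult, (Rabs_pos_eq 2) by lra. reflexivity. }
  unfold Rdiv in L at 2. rewrite Rabs_mult, (Rabs_pos_eq (/ 2)) in L by lra.
  pose proof (Rabs_pos (sin (c / 2))) as S0. rewrite E2. split.
  - assert (Rabs (sin (c / 2)) * Rabs (sin (c / 2)) <= 1 * Rabs (sin (c / 2)))
      by (apply Rmult_le_compat_r; lra). lra.
  - assert (Q : Rabs (sin (c / 2)) * Rabs (sin (c / 2)) <= (Rabs c * / 2) * (Rabs c * / 2))
      by (apply Rmult_le_compat; lra).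
    replace (c * c) with (Rabs c * Rabs c)
      by (rewrite <- Rabs_mult; apply Rabs_pos_eq; nra).
    pose proof (Rabs_pos c). nra. }
assert (Sb : Rabs (sin a - a) <= a * a).
{ destruct (MVT_gen (fun c => sin c - c) 0 a (fun c => cos c - 1)) as [c [Hc E]].
  - intros x _. auto_derive; [ trivial | ring ].
  - intros x _. apply continuity_pt_minus.
    + apply continuity_sin.
    + apply (derivable_continuous_pt id x). apply derivable_pt_id.
  - rewrite sin_0 in E.
    assert (E' : sin a - a = (cos c - 1) * a) by lra.
    rewrite E', Rabs_mult.
    assert (Hca : Rabs c <= Rabs a).
    { destruct (Rle_dec 0 a) as [Ha|Ha].
      - rewrite Rmin_left, Rmax_right in Hc by assumption.
        rewrite !Rabs_pos_eq; lra.
      - rewrite Rmin_right, Rmax_left in Hc by lra.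
        rewrite !Rabs_left1; lra. }
    replace (a * a) with (Rabs a * Rabs a)
      by (rewrite <- Rabs_mult; apply Rabs_pos_eq; nra).
    apply Rmult_le_compat_r; [ apply Rabs_pos | ].
    exact (Rle_trans _ _ _ (proj1 (Cb c)) Hca). }
eapply Rle_trans; [ apply Cmod_le_components | ].
replace (fst (Cminus (Cminus (cis a) (RtoC 1)) (Cmult Ci (RtoC a)))) with (cos a - 1)
  by (cbn; ring).
replace (snd (Cminus (Cminus (cis a) (RtoC 1)) (Cmult Ci (RtoC a)))) with (sin a - a)
  by (cbn; ring).
pose proof (proj2 (Cb a)). lra.
Qed.

Lemma bounded_continuous_cis (s : R) : bounded_continuous (fun l => cis (s * l)).
Proof.
split.
- intros l. apply continuous_C. split; cbn;
    apply (@ex_derive_continuous R_AbsRing R_NormedModule); auto_derive; trivial.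
- exists 1. intros l. rewrite Cmod_cis. lra.
Qed.

(** * Norm estimates and the unitary group, from the identities of a functional calculus *)

Section CalculusProperties.
Context {A : CStarAlgebra} {H : HilbertModule A} (P : Operator H).
Hypothesis (Preg : regular P) (Psa : selfadjoint P).
Variable Phi : (R -> C) -> H -> H.
Hypothesis HPhi : is_functional_calculus P Phi.

Let iu : imaginary_unit Ci := or_introl eq_refl.

Lemma inner_ext (x y : H) : (forall w, inner x w = inner y w) -> x = y.
Proof.
intros E. apply norm_minus_zero. rewrite (norm_inner _ H).
rewrite inner_minus_l, E.
right. rewrite <- sqrt_0. f_equal.
apply Rle_antisym; [ | apply norm_ge_0 ].
apply (norm_le_eq zero); [ vring A | ]. rewrite norm_zero_C. lra.
Qed.

Lemma Phi_adjoint (f : R -> C) (x y : H) : bounded_continuous f ->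
  inner (Phi f x) y = inner x (Phi (fun l => Cconj (f l)) y).
Proof. intros Hf. apply HPhi, Hf. Qed.

Lemma Phi_plus (f g : R -> C) (x : H) : bounded_continuous f -> bounded_continuous g ->
  Phi (fun l => Cplus (f l) (g l)) x = plus (Phi f x) (Phi g x).
Proof. intros Hf Hg. now apply HPhi. Qed.

Lemma Phi_scal (z : C) (f : R -> C) (x : H) : bounded_continuous f ->
  Phi (fun l => Cmult z (f l)) x = scal z (Phi f x).
Proof. intros Hf. now apply HPhi. Qed.

Lemma Phi_mult (f g : R -> C) (x : H) : bounded_continuous f -> bounded_continuous g ->
  Phi (fun l => Cmult (f l) (g l)) x = Phi f (Phi g x).
Proof. intros Hf Hg. now apply HPhi. Qed.

Lemma Phi_one (x : H) : Phi (fun _ => RtoC 1) x = x.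
Proof. apply HPhi. Qed.

Lemma Phi_ext (f g : R -> C) (x : H) : (forall l, f l = g l) -> Phi f x = Phi g x.
Proof. intros E. now rewrite (functional_extensionality _ _ E). Qed.

Lemma Phi_const (z : C) (x : H) : Phi (fun _ => z) x = scal z x.
Proof.
rewrite (Phi_ext _ (fun l => Cmult z (RtoC 1))) by (intros l; ring).
rewrite Phi_scal by apply bounded_continuous_const. now rewrite Phi_one.
Qed.

Lemma Phi_resolvent (x : H) : Phi resolvent_fun x = resolvent P Ci x.
Proof.
destruct HPhi as [_ [_ [_ [_ [_ HR]]]]]. destruct (HR x) as [D E].
apply (shift_injective P Preg Psa Ci _ _ iu).
- exact D.
- now apply dom_resolvent.
- rewrite (shift_resolvent P Preg Psa Ci x iu). exact E.
Qed.

(** Additivity in the vector is not among the defining identities; it follows from the existence of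
    an adjoint. *)
Lemma Phi_app_plus (f : R -> C) (x y : H) : bounded_continuous f ->
  Phi f (plus x y) = plus (Phi f x) (Phi f y).
Proof.
intros Hf. apply inner_ext. intros w.
now rewrite Phi_adjoint, !inner_plus_l, !Phi_adjoint.
Qed.

Lemma Phi_app_scal (f : R -> C) (z : C) (x : H) : bounded_continuous f ->
  Phi f (scal z x) = scal z (Phi f x).
Proof.
intros Hf. apply inner_ext. intros w.
now rewrite Phi_adjoint, !inner_scal_l, !Phi_adjoint.
Qed.

Lemma Phi_app_minus (f : R -> C) (x y : H) : bounded_continuous f ->
  Phi f (minus x y) = minus (Phi f x) (Phi f y).
Proof.
intros Hf. rewrite !minus_scal, Phi_app_plus by assumption.
now rewrite Phi_app_scal.
Qed.

Lemma Phi_comm (f g : R -> C) (x : H) : bounded_continuous f -> bounded_continuous g ->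
  Phi f (Phi g x) = Phi g (Phi f x).
Proof.
intros Hf Hg. rewrite <- !Phi_mult by assumption. apply Phi_ext. intros l. ring.
Qed.

(** Phi(h)^* Phi(h) = Phi(|h|^2) = M^2. *)
Lemma norm_Phi_modulus_one (h : R -> C) (x : H) (M : R) : 0 <= M ->
  bounded_continuous h -> (forall l, Cmult (Cconj (h l)) (h l) = RtoC (M * M)) ->
  norm (Phi h x) = M * norm x.
Proof.
intros HM Hh E. apply Rsqr_inj.
- apply norm_ge_0.
- apply Rmult_le_pos; [ exact HM | apply norm_ge_0 ].
- unfold Rsqr. rewrite norm_sqr, Phi_adjoint, <- Phi_mult
    by (try assumption; now apply bounded_continuous_conj).
  rewrite (Phi_ext _ _ x E), Phi_const, inner_scal_r.
  etransitivity; [ exact (norm_scal_C (RtoC (M * M)) (inner x x)) | ].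
  rewrite Cmod_R, <- norm_sqr, Rabs_pos_eq by now apply Rmult_le_pos. ring.
Qed.

(* [f = (h + conj h) / 2] with [h = f + i sqrt (M^2 - f^2)] of constant modulus [M]. *)
Lemma norm_Phi_real (f : R -> R) (x : H) (M : R) :
  (forall l, continuous f l) -> (forall l, Rabs (f l) <= M) ->
  norm (Phi (fun l => RtoC (f l)) x) <= M * norm x.
Proof.
intros Hc HM.
assert (HM0 : 0 <= M) by (eapply Rle_trans; [ apply Rabs_pos | apply (HM 0) ]).
assert (Hf2 : forall l, 0 <= M * M - f l * f l).
{ intros l. specialize (HM l). apply Rabs_le_between in HM. nra. }
set (h := fun l => (f l, sqrt (M * M - f l * f l)) : C).
assert (Hh2 : forall l, Cmult (Cconj (h l)) (h l) = RtoC (M * M)).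
{ intros l. pose proof (sqrt_sqrt _ (Hf2 l)) as E. unfold h.
  set (s := sqrt (M * M - f l * f l)) in *. C_eq; lra. }
assert (Hh : bounded_continuous h).
{ split.
  - intros l. apply continuous_C. split; [ apply Hc | ]. cbn -[sqrt].
    apply (continuous_comp (fun t => M * M - f t * f t) sqrt).
    + apply (continuous_minus (fun _ => M * M) (fun t => f t * f t) l).
      * apply continuous_const.
      * exact (continuous_mult f f l (Hc l) (Hc l)).
    + apply continuous_sqrt.
  - exists M. intros l. apply Rsqr_incr_0_var; [ | exact HM0 ].
    unfold Rsqr. rewrite <- (Cmod_conj (h l)) at 1. rewrite <- Cmod_mult, Hh2, Cmod_R.
    rewrite Rabs_pos_eq by now apply Rmult_le_pos. lra. }
pose proof (bounded_continuous_conj h Hh) as Hh'.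
rewrite (Phi_ext _ (fun l => Cmult (RtoC (/ 2)) (Cplus (h l) (Cconj (h l)))))
  by (intros l; unfold h; C_eq; field).
rewrite Phi_scal by now apply bounded_continuous_plus.
rewrite Phi_plus by assumption.
apply norm_scal_le. rewrite Cmod_R, Rabs_pos_eq by lra.
apply Rmult_le_reg_l with 2; [ lra | ].
rewrite <- Rmult_assoc, Rinv_r, Rmult_1_l by lra.
replace (2 * (M * norm x)) with (M * norm x + M * norm x) by ring.
apply norm_plus_le2; right; apply norm_Phi_modulus_one; try assumption.
intros l. rewrite <- (Hh2 l). C_eq; ring.
Qed.

(** Real and imaginary parts are estimated separately, whence the factor 2. *)
Lemma norm_Phi (f : R -> C) (x : H) (M : R) :
  bounded_continuous f -> (forall l, Cmod (f l) <= M) ->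
  norm (Phi f x) <= 2 * M * norm x.
Proof.
intros [Hc HB] HM.
assert (B1 : bounded_continuous (fun l => RtoC (fst (f l)))).
{ split.
  - intros l. apply continuous_C. cbn. split; [ | apply continuous_const ].
    apply (proj1 (continuous_C f l) (Hc l)).
  - exists M. intros l. rewrite Cmod_R. eapply Rle_trans; [ | apply (HM l) ].
    eapply Rle_trans; [ apply Rmax_l | apply Rmax_Cmod ]. }
assert (B2 : bounded_continuous (fun l => RtoC (snd (f l)))).
{ split.
  - intros l. apply continuous_C. cbn. split; [ | apply continuous_const ].
    apply (proj1 (continuous_C f l) (Hc l)).
  - exists M. intros l. rewrite Cmod_R. eapply Rle_trans; [ | apply (HM l) ].
    eapply Rle_trans; [ apply Rmax_r | apply Rmax_Cmod ]. }
rewrite (Phi_ext f (fun l => Cplus (RtoC (fst (f l))) (Cmult Ci (RtoC (snd (f l))))))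
  by (intros l; C_eq; ring).
rewrite Phi_plus, Phi_scal;
  try assumption; [ | apply (bounded_continuous_mult (fun _ => Ci));
    [ apply bounded_continuous_const | assumption ] ].
replace (2 * M * norm x) with (M * norm x + M * norm x) by ring.
apply norm_plus_le2.
- apply norm_Phi_real; intros l.
  + apply (proj1 (continuous_C f l) (Hc l)).
  + eapply Rle_trans; [ | apply (HM l) ].
    eapply Rle_trans; [ apply Rmax_l | apply Rmax_Cmod ].
- apply norm_scal_le. rewrite (Cmod_imaginary_unit Ci iu), Rmult_1_l.
  apply norm_Phi_real; intros l.
  + apply (proj1 (continuous_C f l) (Hc l)).
  + eapply Rle_trans; [ | apply (HM l) ].
    eapply Rle_trans; [ apply Rmax_r | apply Rmax_Cmod ].
Qed.

(** For [Phi := cfc P] this is convertible to [exp_i P]. *)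
Definition group (t : R) : H -> H := Phi (fun l => cis (t * l)).

Lemma group_plus (t : R) (x y : H) :
  group t (plus x y) = plus (group t x) (group t y).
Proof. apply Phi_app_plus, bounded_continuous_cis. Qed.

Lemma group_scal (t : R) (z : C) (x : H) : group t (scal z x) = scal z (group t x).
Proof. apply Phi_app_scal, bounded_continuous_cis. Qed.

Lemma group_zero (t : R) : group t zero = zero.
Proof.
transitivity (group t (scal (RtoC 0) zero)); [ f_equal; vring H | ].
rewrite group_scal. vring H.
Qed.

Lemma group_minus (t : R) (x y : H) :
  group t (minus x y) = minus (group t x) (group t y).
Proof. apply Phi_app_minus, bounded_continuous_cis. Qed.

Lemma group_add (s t : R) (x : H) : group (s + t) x = group s (group t x).
Proof.
unfold group. rewrite <- Phi_mult by apply bounded_continuous_cis.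
apply Phi_ext. intros l. rewrite <- cis_plus. f_equal. ring.
Qed.

Lemma group_0 (x : H) : group 0 x = x.
Proof.
unfold group. rewrite (Phi_ext _ (fun _ => RtoC 1)); [ apply Phi_one | ].
intros l. now rewrite Rmult_0_l, cis_0.
Qed.

Lemma norm_group (t : R) (x : H) : norm (group t x) = norm x.
Proof.
rewrite <- (Rmult_1_l (norm x)). apply norm_Phi_modulus_one; [ lra | | ].
- apply bounded_continuous_cis.
- intros l. rewrite Cconj_cis, <- cis_plus, Rmult_1_l.
  replace (- (t * l) + t * l) with 0 by ring. apply cis_0.
Qed.

Lemma group_resolvent (t : R) (x : H) :
  group t (resolvent P Ci x) = resolvent P Ci (group t x).
Proof.
rewrite <- !Phi_resolvent. apply Phi_comm.
- apply bounded_continuous_cis.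
- apply bounded_continuous_resolvent_fun.
Qed.

(** The domain of P is the range of its resolvent, with which the group commutes. *)
Lemma dom_group (t : R) (x : H) : dom P x -> dom P (group t x).
Proof.
intros Hx. rewrite <- (resolvent_shift P Preg Psa Ci x iu Hx), group_resolvent.
now apply dom_resolvent.
Qed.

Lemma shift_group (t : R) (x : H) : dom P x ->
  shift P Ci (group t x) = group t (shift P Ci x).
Proof.
intros Hx. rewrite <- (resolvent_shift P Preg Psa Ci x iu Hx) at 1.
rewrite group_resolvent. now apply shift_resolvent.
Qed.

Lemma app_shift (x : H) : P x = minus (shift P Ci x) (scal Ci x).
Proof. unfold shift. vring H. Qed.

Lemma app_group (t : R) (x : H) : dom P x -> P (group t x) = group t (P x).
Proof.
intros Hx. rewrite (app_shift (group t x)), shift_group by assumption.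
now rewrite (app_shift x), group_minus, group_scal.
Qed.

(** With v = (P + i)x the difference is Phi at (e^(isl) - 1)/(l + i), of modulus at most |s| |l| /
    |l + i| <= |s|, applied to v; the 2 is that of [norm_Phi]. *)
Lemma norm_group_minus_id (s : R) (x : H) : dom P x ->
  norm (minus (group s x) x) <= 2 * Rabs s * norm (shift P Ci x).
Proof.
intros Hx. set (v := shift P Ci x).
set (e := fun l => Cplus (cis (s * l)) (Copp (RtoC 1))).
assert (He : bounded_continuous e)
  by (apply bounded_continuous_plus;
      [ apply bounded_continuous_cis | apply bounded_continuous_const ]).
apply (norm_le_eq (Phi (fun l => Cmult (e l) (resolvent_fun l)) v)).
{ rewrite Phi_mult, Phi_resolvent by (assumption || apply bounded_continuous_resolvent_fun).
  unfold v. rewrite (resolvent_shift P Preg Psa Ci x iu Hx).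
  unfold e. rewrite (Phi_plus (fun l => cis (s * l)) (fun _ => Copp (RtoC 1)) _
    (bounded_continuous_cis s) (bounded_continuous_const _)).
  rewrite (Phi_const (Copp (RtoC 1))).
  fold (group s). vring H. }
apply norm_Phi.
- apply bounded_continuous_mult; [ exact He | apply bounded_continuous_resolvent_fun ].
- intros l. rewrite Cmod_mult, Cmod_resolvent_fun.
  pose proof (Cmod_cis_minus_1_le (s * l)) as L.
  change (Cminus (cis (s * l)) (RtoC 1)) with (e l) in L. rewrite Rabs_mult in L.
  assert (0 <= l * l) by nra.
  assert (Q : Rabs l <= sqrt (l * l + 1)).
  { rewrite <- sqrt_Rsqr_abs. apply sqrt_le_1_alt. unfold Rsqr. lra. }
  assert (Q0 : 0 < sqrt (l * l + 1)) by (apply sqrt_lt_R0; lra).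
  apply Rmult_le_reg_r with (sqrt (l * l + 1)); [ exact Q0 | ].
  rewrite Rmult_assoc, Rinv_l, Rmult_1_r by lra.
  eapply Rle_trans; [ exact L | ].
  apply Rmult_le_compat_l; [ apply Rabs_pos | exact Q ].
Qed.

(* On the spectral side this is |e^(isl) - 1 - isl| |l + i|^-2 <= 2 s^2; the factor l is
   rewritten as [1 - i / (l + i)] times [l + i] to stay among bounded functions. *)
Lemma norm_group_taylor (s : R) (x : H) : dom P x -> dom P (P x) ->
  norm (minus (minus (group s x) x) (scal (Cmult Ci (RtoC s)) (P x))) <=
  4 * (s * s) * norm (shift P Ci (shift P Ci x)).
Proof.
intros Hx HPx. set (r := resolvent_fun).
assert (Hsx : dom P (shift P Ci x))
  by (unfold shift; apply dom_plus; [ assumption | assumption | now apply dom_scal ]).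
set (v := shift P Ci (shift P Ci x)).
assert (Hr : bounded_continuous r) by apply bounded_continuous_resolvent_fun.
set (r2 := fun l => Cmult (r l) (r l)).
assert (Hr2 : bounded_continuous r2) by now apply bounded_continuous_mult.
assert (Er : Phi r v = shift P Ci x)
  by (unfold r; rewrite Phi_resolvent; now apply resolvent_shift).
assert (Er2 : Phi r2 v = x).
{ unfold r2. rewrite Phi_mult, Er by assumption. unfold r.
  rewrite Phi_resolvent. now apply resolvent_shift. }
set (e := fun l => Cplus (cis (s * l)) (Copp (RtoC 1))).
assert (He : bounded_continuous e)
  by (apply bounded_continuous_plus;
      [ apply bounded_continuous_cis | apply bounded_continuous_const ]).
set (a := fun l => Cmult (e l) (r2 l)).
set (b1 := fun l => Cmult (Copp Ci) (r2 l)).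
set (b2 := fun l => Cplus (r l) (b1 l)).
set (b := fun l => Cmult (Copp (Cmult Ci (RtoC s))) (b2 l)).
assert (Ha : bounded_continuous a) by now apply bounded_continuous_mult.
assert (Hb1 : bounded_continuous b1)
  by (apply bounded_continuous_mult; [ apply bounded_continuous_const | assumption ]).
assert (Hb2 : bounded_continuous b2) by now apply bounded_continuous_plus.
assert (Hb : bounded_continuous b)
  by (apply bounded_continuous_mult; [ apply bounded_continuous_const | assumption ]).
apply (norm_le_eq (Phi (fun l => Cplus (a l) (b l)) v)).
{ rewrite Phi_plus by assumption. unfold a, b. rewrite Phi_mult, Phi_scal by assumption.
  unfold b2. rewrite Phi_plus by assumption. unfold b1. rewrite Phi_scal by assumption.
  rewrite Er2, Er. unfold e.
  rewrite (Phi_plus (fun l => cis (s * l)) (fun _ => Copp (RtoC 1)) _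
    (bounded_continuous_cis s) (bounded_continuous_const _)).
  rewrite (Phi_const (Copp (RtoC 1))).
  fold (group s). unfold shift. vring H. }
replace (4 * (s * s)) with (2 * (2 * (s * s))) by ring.
apply norm_Phi; [ now apply bounded_continuous_plus | ].
intros l. assert (Hl : 0 <= l * l) by nra.
assert (E : Cplus (a l) (b l) =
  Cmult (Cminus (Cminus (cis (s * l)) (RtoC 1)) (Cmult Ci (RtoC (s * l)))) (r2 l)).
{ unfold a, b, b2, b1, e, r2, r.
  assert (El : Cplus (resolvent_fun l)
      (Cmult (Copp Ci) (Cmult (resolvent_fun l) (resolvent_fun l))) =
    Cmult (RtoC l) (Cmult (resolvent_fun l) (resolvent_fun l))).
  { rewrite resolvent_fun_eq. C_eq; field; nra. }
  rewrite El, RtoC_mult. ring. }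
rewrite E, Cmod_mult. unfold r2. rewrite Cmod_mult. unfold r.
rewrite Cmod_resolvent_fun, <- Rinv_mult, sqrt_sqrt by lra.
pose proof (Cmod_cis_taylor2 (s * l)) as L.
apply Rmult_le_reg_r with (l * l + 1); [ lra | ].
rewrite Rmult_assoc, Rinv_l, Rmult_1_r by lra.
eapply Rle_trans; [ exact L | ].
assert (0 <= s * s) by nra. nra.
Qed.

End CalculusProperties.
(** * The Cauchy problem *)

Section NormDerivative.
Context {V : CompleteNormedModule C_AbsRing}.

Definition norm_derive (u : R -> V) (t : R) (v : V) : Prop :=
  is_lim (fun h => norm (minus (scal (RtoC (/ h)) (minus (u (t + h)) (u t))) v)) 0 0.

(** Multiplying by h removes the exception at h = 0. *)
Lemma norm_derive_eps (u : R -> V) (t : R) (v : V) :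
  norm_derive u t v <->
  forall eps, 0 < eps -> exists d, 0 < d /\ forall h, Rabs h < d ->
    norm (minus (minus (u (t + h)) (u t)) (scal (RtoC h) v)) <= eps * Rabs h.
Proof.
assert (E : forall h, h <> 0 ->
  norm (minus (minus (u (t + h)) (u t)) (scal (RtoC h) v)) =
  Rabs h * norm (minus (scal (RtoC (/ h)) (minus (u (t + h)) (u t))) v)).
{ intros h Hh. rewrite <- Cmod_R, <- norm_scal_C. f_equal.
  vlinear V; C_eq; field; exact Hh. }
unfold norm_derive. split.
- intros L eps Heps. apply is_lim_spec in L.
  destruct (L (mkposreal eps Heps)) as [d Hd]. exists d.
  split; [ apply cond_pos | ]. intros h Hh.
  destruct (Req_dec h 0) as [->|H0].
  + rewrite Rplus_0_r, Rabs_R0, Rmult_0_r.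
    apply (norm_le_eq zero); [ vring V | ]. rewrite norm_zero_C. lra.
  + rewrite (E h H0), Rmult_comm. apply Rmult_le_compat_r; [ apply Rabs_pos | ].
    assert (Hb : ball 0 d h) by (change (Rabs (h - 0) < d); now rewrite Rminus_0_r).
    specialize (Hd h Hb H0). cbn in Hd.
    rewrite Rminus_0_r, Rabs_pos_eq in Hd by apply norm_ge_0. apply Rlt_le, Hd.
- intros L. apply is_lim_spec. intros eps.
  destruct (L (pos eps / 2)) as [d [Hd Q]]; [ pose proof (cond_pos eps); lra | ].
  exists (mkposreal d Hd). intros h Hb H0. change (Rabs (h - 0) < d) in Hb.
  rewrite Rminus_0_r in Hb. specialize (Q h Hb). rewrite (E h H0), Rmult_comm in Q.
  apply Rmult_le_reg_r in Q; [ | now apply Rabs_pos_lt ].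
  cbn. rewrite Rminus_0_r, Rabs_pos_eq by apply norm_ge_0.
  pose proof (cond_pos eps). eapply Rle_lt_trans; [ exact Q | ]. lra.
Qed.

(** This gives access to the sum rule, the fundamental theorem of calculus and the constancy of
    functions with zero derivative over [real_scalars V]. *)
Lemma norm_derive_is_derive (u : R -> V) (t : R) (v : V) :
  norm_derive u t v <-> @is_derive R_AbsRing (real_scalars V) u t v.
Proof.
rewrite norm_derive_eps. split.
- intros L. split; [ apply is_linear_scal_l | ].
  intros x Hx eps.
  rewrite <- (is_filter_lim_locally_unique _ _ Hx).
  destruct (L eps (cond_pos eps)) as [d [Hd Q]].
  exists (mkposreal d Hd). intros y Hy. change (Rabs (y - t) < d) in Hy.
  specialize (Q (y - t) Hy). rewrite (Rplus_minus t y : t + (y - t) = y) in Q. exact Q.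
- intros [_ L] eps Heps.
  destruct (L t (fun Q HQ => HQ) (mkposreal eps Heps)) as [d Hd].
  exists d. split; [ apply cond_pos | ]. intros h Hh.
  assert (Hb : @ball R_UniformSpace t d (t + h)).
  { change (Rabs (t + h - t) < d). now replace (t + h - t) with h by ring. }
  specialize (Hd _ Hb).
  change (norm (minus (minus (u (t + h)) (u t)) (scal (RtoC (t + h - t)) v)) <=
    eps * Rabs (t + h - t)) in Hd.
  now replace (t + h - t) with h in Hd by ring.
Qed.

Lemma norm_derive_plus (u w : R -> V) (t : R) (v z : V) :
  norm_derive u t v -> norm_derive w t z ->
  norm_derive (fun s => plus (u s) (w s)) t (plus v z).
Proof.
rewrite !norm_derive_is_derive. intros Hu Hw.
exact (@is_derive_plus R_AbsRing (real_scalars V) u w t v z Hu Hw).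
Qed.

Lemma norm_derive_scal (c : C) (u : R -> V) (t : R) (v : V) :
  norm_derive u t v -> norm_derive (fun s => scal c (u s)) t (scal c v).
Proof.
rewrite !norm_derive_eps. intros L eps Heps. pose proof (Cmod_ge_0 c) as Hc.
destruct (L (eps / (Cmod c + 1))) as [d [Hd Q]]; [ apply Rdiv_lt_0_compat; lra | ].
exists d. split; [ exact Hd | ]. intros h Hh. specialize (Q h Hh).
apply (norm_le_eq (scal c (minus (minus (u (t + h)) (u t)) (scal (RtoC h) v))));
  [ vring V | ].
apply norm_scal_le.
apply Rle_trans with ((Cmod c + 1) * (eps / (Cmod c + 1) * Rabs h)).
- apply Rmult_le_compat; try assumption; [ apply norm_ge_0 | lra ].
- right. field. lra.
Qed.

Lemma norm_derive_const (v : V) (t : R) : norm_derive (fun _ => v) t zero.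
Proof.
apply norm_derive_is_derive. exact (@is_derive_const R_AbsRing (real_scalars V) v t).
Qed.

Lemma norm_derive_continuous (u : R -> V) (t : R) (v : V) :
  norm_derive u t v -> @continuous R_UniformSpace (real_scalars V) u t.
Proof.
intros Hu. apply norm_derive_is_derive in Hu.
apply (@ex_derive_continuous R_AbsRing (real_scalars V)). now exists v.
Qed.

Lemma norm_derive_zero_constant (u : R -> V) :
  (forall t, norm_derive u t zero) -> forall s t, u s = u t.
Proof.
intros Hu.
assert (L : forall s t, s < t -> u s = u t).
{ intros s t Hst. apply (@eq_is_derive (real_scalars V) u s t); [ | exact Hst ].
  intros x _. apply (proj1 (norm_derive_is_derive u x zero)), Hu. }
intros s t. destruct (Rtotal_order s t) as [Hst|[->|Hst]].
- now apply L.
- reflexivity.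
- symmetry. now apply L.
Qed.

Lemma norm_derive_RInt (w : R -> V) :
  (forall t, @continuous R_UniformSpace (real_scalars V) w t) ->
  forall t, norm_derive (fun s => @RInt (real_scalars V) w 0 s) t (w t).
Proof.
intros Hw t. apply norm_derive_is_derive.
apply (@is_derive_RInt (real_scalars V) w _ 0 t); [ | apply Hw ].
apply filter_forall. intros s.
apply (@RInt_correct (real_scalars V)), (@ex_RInt_continuous (real_scalars V)).
intros z _. apply Hw.
Qed.

(** L commutes with Riemann sums by linearity and with their limit by boundedness. *)
Lemma is_RInt_linear (L : V -> V) (K : R) (w : R -> V) (a b : R) (l : V) :
  (forall x y, L (plus x y) = plus (L x) (L y)) ->
  (forall (c : C) x, L (scal c x) = scal c (L x)) ->
  (forall x, norm (L x) <= K * norm x) ->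
  @is_RInt (real_scalars V) w a b l ->
  @is_RInt (real_scalars V) (fun s => L (w s)) a b (L l).
Proof.
intros Lp Ls Ln Hw.
assert (L0 : L zero = zero).
{ transitivity (L (scal (RtoC 0) zero)); [ f_equal; vring V | ].
  rewrite Ls. vring V. }
assert (E : forall ptd, @Riemann_sum (real_scalars V) (fun s => L (w s)) ptd =
  L (@Riemann_sum (real_scalars V) w ptd)).
{ apply SF_cons_ind.
  - intros x0. symmetry. exact L0.
  - intros h s IH. rewrite !Riemann_sum_cons, IH.
    rewrite (Lp _ _ : L (@plus (real_scalars V) _ _) = _). f_equal.
    symmetry. exact (Ls (RtoC _) (w (snd h))). }
assert (Lc : filterlim L (@locally (real_scalars V) l) (@locally (real_scalars V) (L l))).
{ apply (proj2 (@filterlim_locally_ball_norm R_AbsRing _ (real_scalars V) _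
    (filter_filter (ProperFilter := @locally_filter (real_scalars V) l)) L (L l))).
  intros eps. set (K' := Rmax K 1).
  assert (HK : 0 < K') by (eapply Rlt_le_trans; [ | apply Rmax_r ]; lra).
  assert (He : 0 < pos eps / K') by (apply Rdiv_lt_0_compat; [ apply cond_pos | exact HK ]).
  apply (@locally_le_locally_norm R_AbsRing (real_scalars V)).
  exists (mkposreal _ He). intros y Hy.
  change (norm (minus y l) < pos eps / K') in Hy.
  change (norm (minus (L y) (L l)) < eps).
  apply Rle_lt_trans with (K' * norm (minus y l)).
  - apply (norm_le_eq (L (minus y l))).
    + transitivity (plus (L y) (scal (Copp (RtoC 1)) (L l))); [ vring V | ].
      rewrite <- Ls, <- Lp. f_equal. vring V.
    + eapply Rle_trans; [ apply Ln | ].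
      apply Rmult_le_compat_r; [ apply norm_ge_0 | apply Rmax_l ].
  - apply Rmult_lt_compat_l with (r := K') in Hy; [ | exact HK ].
    replace (K' * (pos eps / K')) with (pos eps) in Hy by (field; lra). exact Hy. }
unfold is_RInt in *.
apply filterlim_ext with (f := fun ptd => L (@scal R_Ring (real_scalars V) (sign (b - a))
  (@Riemann_sum (real_scalars V) w ptd))).
- intros ptd. rewrite E. exact (Ls (RtoC _) _).
- exact (filterlim_comp _ _ _ _ L _ _ _ Hw Lc).
Qed.

End NormDerivative.

(** * Calculus in the Frechet space H^oo *)

Section CauchyProblem.
Context {A : CStarAlgebra} {H : HilbertModule A} (P : Operator H).
Hypothesis (Preg : regular P) (Psa : selfadjoint P).

Let iu : imaginary_unit Ci := or_introl eq_refl.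

Lemma dom_pow_plus (k : nat) (x y : H) :
  dom_pow P k x -> dom_pow P k y -> dom_pow P k (plus x y).
Proof.
revert x y. induction k as [|k IH]; intros x y; [ reflexivity | ].
intros [Dx Kx] [Dy Ky]. split; [ now apply dom_plus | ].
rewrite app_plus by assumption. now apply IH.
Qed.

Lemma dom_pow_scal (k : nat) (c : C) (x : H) :
  dom_pow P k x -> dom_pow P k (scal c x).
Proof.
revert x. induction k as [|k IH]; intros x; [ reflexivity | ].
intros [Dx Kx]. split; [ now apply dom_scal | ].
rewrite app_scal by assumption. now apply IH.
Qed.

(** With R = (P + i)^-1, one has P R^(k+1) x = R^k x - i R^k (R x), and both terms fall under the
    induction hypothesis. *)
Lemma dom_pow_resolvent_iter (k : nat) (x : H) :
  dom_pow P k (Nat.iter k (resolvent P Ci) x).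
Proof.
revert x. induction k as [|k IH]; intros x; [ exact I | ].
rewrite Nat.iter_succ. set (w := Nat.iter k (resolvent P Ci) x). split.
- now apply dom_resolvent.
- rewrite app_shift, (shift_resolvent P Preg Psa Ci w iu), minus_scal.
  apply dom_pow_plus; [ apply IH | ]. do 2 apply dom_pow_scal.
  unfold w. rewrite <- Nat.iter_succ, Nat.iter_succ_r. apply IH.
Qed.

Lemma dom_pow_group (k : nat) (t : R) (x : H) :
  dom_pow P k x -> dom_pow P k (group (cfc P) t x).
Proof.
pose proof (cfc_is_functional_calculus P Preg Psa) as HP.
revert x. induction k as [|k IH]; intros x; [ reflexivity | ].
intros [Dx Kx]. split; [ now apply dom_group | ].
rewrite (app_group P) by assumption. now apply IH.
Qed.

Lemma Hinf_plus (x y : H) : Hinf P x -> Hinf P y -> Hinf P (plus x y).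
Proof. intros Hx Hy k. now apply dom_pow_plus. Qed.

Lemma Hinf_scal (c : C) (x : H) : Hinf P x -> Hinf P (scal c x).
Proof. intros Hx k. now apply dom_pow_scal. Qed.

Lemma Hinf_minus (x y : H) : Hinf P x -> Hinf P y -> Hinf P (minus x y).
Proof. intros Hx Hy. rewrite minus_scal. now apply Hinf_plus, Hinf_scal. Qed.

Lemma Hinf_dom (x : H) : Hinf P x -> dom P x.
Proof. intros Hx. apply (Hx 1%nat). Qed.

Lemma Hinf_app (x : H) : Hinf P x -> Hinf P (P x).
Proof. intros Hx k. apply (Hx (S k)). Qed.

Lemma Hinf_group (t : R) (x : H) : Hinf P x -> Hinf P (group (cfc P) t x).
Proof. intros Hx k. now apply dom_pow_group. Qed.

Lemma Hinf_shift (x : H) : Hinf P x -> Hinf P (shift P Ci x).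
Proof. intros Hx. apply Hinf_plus; [ now apply Hinf_app | now apply Hinf_scal ]. Qed.

Definition shift_pow (k : nat) : H -> H := Nat.iter k (shift P Ci).

Lemma shift_pow_S (k : nat) (x : H) :
  shift_pow (S k) x = shift P Ci (shift_pow k x).
Proof. reflexivity. Qed.

Lemma Hinf_shift_pow (k : nat) (x : H) : Hinf P x -> Hinf P (shift_pow k x).
Proof.
intros Hx. induction k as [|k IH]; [ exact Hx | ].
rewrite shift_pow_S. now apply Hinf_shift.
Qed.

Lemma shift_pow_plus (k : nat) (x y : H) : Hinf P x -> Hinf P y ->
  shift_pow k (plus x y) = plus (shift_pow k x) (shift_pow k y).
Proof.
intros Hx Hy. induction k as [|k IH]; [ reflexivity | ]. rewrite !shift_pow_S, IH.
apply shift_plus; try assumption; now apply Hinf_dom, Hinf_shift_pow.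
Qed.

Lemma shift_pow_scal (k : nat) (c : C) (x : H) : Hinf P x ->
  shift_pow k (scal c x) = scal c (shift_pow k x).
Proof.
intros Hx. induction k as [|k IH]; [ reflexivity | ]. rewrite !shift_pow_S, IH.
apply shift_scal; try assumption; now apply Hinf_dom, Hinf_shift_pow.
Qed.

Lemma shift_pow_minus (k : nat) (x y : H) : Hinf P x -> Hinf P y ->
  shift_pow k (minus x y) = minus (shift_pow k x) (shift_pow k y).
Proof.
intros Hx Hy. rewrite !minus_scal, shift_pow_plus, shift_pow_scal;
  try assumption; [ reflexivity | now apply Hinf_scal ].
Qed.

Lemma shift_pow_app (k : nat) (x : H) : Hinf P x ->
  shift_pow k (P x) = P (shift_pow k x).
Proof.
intros Hx. pose proof (Hinf_shift_pow k x Hx) as Hk.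
rewrite (app_shift P x), shift_pow_minus, shift_pow_scal;
  try assumption; [ | now apply Hinf_shift | now apply Hinf_scal ].
unfold shift_pow at 1. rewrite <- Nat.iter_succ_r, Nat.iter_succ.
symmetry. apply app_shift.
Qed.

Lemma shift_pow_group (k : nat) (t : R) (x : H) : Hinf P x ->
  shift_pow k (group (cfc P) t x) = group (cfc P) t (shift_pow k x).
Proof.
pose proof (cfc_is_functional_calculus P Preg Psa) as HP.
intros Hx. induction k as [|k IH]; [ reflexivity | ]. rewrite !shift_pow_S, IH.
apply (shift_group P Preg Psa _ HP). now apply Hinf_dom, Hinf_shift_pow.
Qed.

Lemma shift_pow_resolvent_iter (k : nat) (x : H) :
  shift_pow k (Nat.iter k (resolvent P Ci) x) = x.
Proof.
induction k as [|k IH]; [ reflexivity | ].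
unfold shift_pow. rewrite Nat.iter_succ_r, Nat.iter_succ, shift_resolvent by assumption.
exact IH.
Qed.

Lemma resolvent_iter_shift_pow (k : nat) (x : H) : Hinf P x ->
  Nat.iter k (resolvent P Ci) (shift_pow k x) = x.
Proof.
intros Hx. induction k as [|k IH]; [ reflexivity | ].
unfold shift_pow. rewrite Nat.iter_succ_r, Nat.iter_succ.
rewrite resolvent_shift by (assumption || now apply Hinf_dom, (Hinf_shift_pow k)).
exact IH.
Qed.

Lemma Hinf_one_plus_sqr_pow (k : nat) (x : H) :
  Hinf P x -> Hinf P (one_plus_sqr_pow P k x).
Proof.
intros Hx. induction k as [|k IH]; [ exact Hx | ].
apply Hinf_plus; [ exact IH | ]. now apply Hinf_app, Hinf_app.
Qed.

Lemma one_plus_sqr_pow_shift (k : nat) (x : H) : Hinf P x ->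
  one_plus_sqr_pow P k (shift P Ci x) = shift P Ci (one_plus_sqr_pow P k x).
Proof.
intros Hx. induction k as [|k IH]; [ reflexivity | ].
pose proof (Hinf_one_plus_sqr_pow k x Hx) as Hk.
unfold one_plus_sqr_pow in *. rewrite !Nat.iter_succ, IH.
set (v := Nat.iter k (fun v => plus v (P (P v))) x) in *.
assert (Dv : dom P v) by now apply Hinf_dom.
assert (D1 : dom P (P v)) by now apply Hinf_dom, Hinf_app.
assert (D2 : dom P (P (P v))) by now apply Hinf_dom, Hinf_app, Hinf_app.
unfold shift. repeat first [ rewrite app_plus | rewrite app_scal ];
  repeat first [ assumption | apply dom_plus | apply dom_scal ].
vring H.
Qed.

(** By [inner_shift], a factor P + i on each side amounts to 1 + P^2 on the left; the pairs are
    absorbed one by one because P + i commutes with 1 + P^2. *)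
Lemma inner_one_plus_sqr_pow (k : nat) (x y : H) : Hinf P x -> Hinf P y ->
  inner (one_plus_sqr_pow P k x) y = inner (shift_pow k x) (shift_pow k y).
Proof.
revert x y. induction k as [|k IH]; intros x y Hx Hy; [ reflexivity | ].
unfold shift_pow. rewrite !Nat.iter_succ_r. fold (shift_pow k).
rewrite <- IH by now apply Hinf_shift.
rewrite one_plus_sqr_pow_shift by assumption.
pose proof (Hinf_one_plus_sqr_pow k x Hx) as Hk.
rewrite (inner_shift P Psa Ci) by (assumption || now apply Hinf_dom).
unfold one_plus_sqr_pow. rewrite Nat.iter_succ. fold (one_plus_sqr_pow P k x).
rewrite inner_plus_l, (symmetric P Psa (P _) y)
  by (apply Hinf_dom; try apply Hinf_app; assumption).
apply plus_comm.
Qed.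

Lemma Hnorm_shift_pow (k : nat) (x : H) : Hinf P x ->
  Hnorm P k x = norm (shift_pow k x).
Proof.
intros Hx. unfold Hnorm. rewrite inner_one_plus_sqr_pow by assumption.
symmetry. apply norm_inner.
Qed.

(** The rules of differentiation can thus be proved in H and carried to every order k by commuting
    (P + i)^k with the operations. *)
Lemma is_derive_Hinf_iff (u : R -> H) (t : R) (v : H) : (forall s, Hinf P (u s)) ->
  is_derive_Hinf P u t v <->
  Hinf P v /\ forall k, norm_derive (fun s => shift_pow k (u s)) t (shift_pow k v).
Proof.
intros Hu.
assert (E : Hinf P v -> forall k h,
  Hnorm P k (minus (scal (RtoC (/ h)) (minus (u (t + h)) (u t))) v) =
  norm (minus (scal (RtoC (/ h)) (minus (shift_pow k (u (t + h))) (shift_pow k (u t))))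
    (shift_pow k v))).
{ intros Hv k h.
  assert (Hm : Hinf P (minus (u (t + h)) (u t))) by now apply Hinf_minus.
  rewrite Hnorm_shift_pow by (apply Hinf_minus; [ now apply Hinf_scal | exact Hv ]).
  rewrite shift_pow_minus, shift_pow_scal, shift_pow_minus;
    try apply Hinf_scal; auto. }
split; intros [Hv L]; (split; [ exact Hv | ]); intros k; specialize (L k).
- apply is_lim_ext with (2 := L). intros h. now apply E.
- apply is_lim_ext with (2 := L). intros h. symmetry. now apply E.
Qed.

Lemma is_derive_Hinf_plus (u w : R -> H) (t : R) (v z : H) :
  (forall s, Hinf P (u s)) -> (forall s, Hinf P (w s)) ->
  is_derive_Hinf P u t v -> is_derive_Hinf P w t z ->
  is_derive_Hinf P (fun s => plus (u s) (w s)) t (plus v z).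
Proof.
intros Hu Hw. rewrite !is_derive_Hinf_iff; try assumption;
  [ | intros s; now apply Hinf_plus ].
intros [Hv Lv] [Hz Lz]. split; [ now apply Hinf_plus | ]. intros k.
rewrite shift_pow_plus by assumption.
pose proof (norm_derive_plus _ _ _ _ _ (Lv k) (Lz k)) as L.
apply is_lim_ext with (2 := L). intros h. now rewrite !shift_pow_plus.
Qed.

Lemma is_derive_Hinf_scal (c : C) (u : R -> H) (t : R) (v : H) :
  (forall s, Hinf P (u s)) -> is_derive_Hinf P u t v ->
  is_derive_Hinf P (fun s => scal c (u s)) t (scal c v).
Proof.
intros Hu. rewrite !is_derive_Hinf_iff; try assumption;
  [ | intros s; now apply Hinf_scal ].
intros [Hv Lv]. split; [ now apply Hinf_scal | ]. intros k.
rewrite shift_pow_scal by assumption.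
pose proof (norm_derive_scal c _ _ _ (Lv k)) as L.
apply is_lim_ext with (2 := L). intros h. now rewrite !shift_pow_scal.
Qed.

(** P is continuous on H^oo at the cost of one order: (P + i)^k P = (P + i)^(k+1) - i (P + i)^k. *)
Lemma is_derive_Hinf_app (u : R -> H) (t : R) (v : H) :
  (forall s, Hinf P (u s)) -> is_derive_Hinf P u t v ->
  is_derive_Hinf P (fun s => P (u s)) t (P v).
Proof.
intros Hu. rewrite !is_derive_Hinf_iff; try assumption;
  [ | intros s; now apply Hinf_app ].
intros [Hv Lv]. split; [ now apply Hinf_app | ]. intros k.
assert (E : forall x, Hinf P x -> shift_pow k (P x) =
  plus (shift_pow (S k) x) (scal (Copp Ci) (shift_pow k x))).
{ intros x Hx. rewrite shift_pow_app, app_shift by assumption. unfold shift_pow.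
  rewrite Nat.iter_succ. vring H. }
rewrite (E v Hv).
pose proof (norm_derive_plus _ _ _ _ _ (Lv (S k))
  (norm_derive_scal (Copp Ci) _ _ _ (Lv k))) as L.
apply is_lim_ext with (2 := L). intros h. now rewrite !E.
Qed.

(** Write V for the group. After V(ct) is factored out, the error has three parts: V(ch) applied to
    the remainder of y, the term h (V(ch) - 1) y', and the Taylor remainder of V at y(t). The first
    is o(h) because V is isometric, the others are O(h^2). *)
Lemma norm_derive_group (c : R) (y : R -> H) (t : R) (y' : H) :
  dom P (y t) -> dom P (P (y t)) -> dom P y' -> norm_derive y t y' ->
  norm_derive (fun s => group (cfc P) (c * s) (y s)) t
    (group (cfc P) (c * t) (plus y' (scal (Cmult Ci (RtoC c)) (P (y t))))).
Proof.
intros D1 D2 D3. pose proof (cfc_is_functional_calculus P Preg Psa) as HP.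
rewrite !norm_derive_eps. intros L eps Heps.
set (a := 2 * Rabs c * norm (shift P Ci y')).
set (b := 4 * (c * c) * norm (shift P Ci (shift P Ci (y t)))).
assert (Ha : 0 <= a).
{ apply Rmult_le_pos; [ | apply norm_ge_0 ]. pose proof (Rabs_pos c). lra. }
assert (Hb : 0 <= b).
{ apply Rmult_le_pos; [ | apply norm_ge_0 ]. assert (0 <= c * c) by nra. lra. }
destruct (L (eps / 2)) as [d [Hd Q]]; [ lra | ].
(* Below the second radius the quadratic error (a + b) |h|^2 is at most eps |h| / 2; the 1 keeps the
   denominator positive. *)
exists (Rmin d (eps / (2 * (a + b + 1)))).
assert (He : 0 < eps / (2 * (a + b + 1))) by (apply Rdiv_lt_0_compat; lra).
split; [ now apply Rmin_pos | ]. intros h Hh.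
assert (Hh1 : Rabs h < d) by (eapply Rlt_le_trans; [ exact Hh | apply Rmin_l ]).
assert (Hh2 : Rabs h < eps / (2 * (a + b + 1)))
  by (eapply Rlt_le_trans; [ exact Hh | apply Rmin_r ]).
specialize (Q h Hh1). pose proof (Rabs_pos h) as Hh0.
set (V := group (cfc P)).
set (q := minus (minus (y (t + h)) (y t)) (scal (RtoC h) y')) in *.
apply (norm_le_eq (V (c * t) (plus (V (c * h) q)
  (plus (scal (RtoC h) (minus (V (c * h) y') y'))
    (minus (minus (V (c * h) (y t)) (y t)) (scal (Cmult Ci (RtoC (c * h))) (P (y t)))))))).
{ replace (c * (t + h)) with (c * t + c * h) by ring.
  unfold V. rewrite (group_add P _ HP).
  repeat first [ rewrite (group_plus P _ HP) | rewrite (group_minus P _ HP)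
               | rewrite (group_scal P _ HP) ].
  unfold q.
  repeat first [ rewrite (group_plus P _ HP) | rewrite (group_minus P _ HP)
               | rewrite (group_scal P _ HP) ].
  vring H. }
unfold V. rewrite (norm_group P _ HP).
replace (eps * Rabs h) with (eps / 2 * Rabs h + (eps / 2 * Rabs h)) by field.
apply norm_plus_le2; [ rewrite (norm_group P _ HP); exact Q | ].
apply Rle_trans with (Rabs h * (a * Rabs h) + b * (Rabs h * Rabs h)).
- apply norm_plus_le2.
  + apply norm_scal_le. rewrite Cmod_R. apply Rmult_le_compat_l; [ exact Hh0 | ].
    eapply Rle_trans; [ apply (norm_group_minus_id P Preg Psa _ HP _ _ D3) | ].
    rewrite Rabs_mult. unfold a. right. ring.
  + eapply Rle_trans; [ apply (norm_group_taylor P Preg Psa _ HP _ _ D1 D2) | ].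
    unfold b. right. rewrite <- (Rabs_pos_eq (c * h * (c * h))) by nra.
    rewrite <- (Rabs_pos_eq (c * c)) by nra. rewrite !Rabs_mult. ring.
- replace (Rabs h * (a * Rabs h) + b * (Rabs h * Rabs h))
    with (((a + b) * Rabs h) * Rabs h) by ring.
  apply Rmult_le_compat_r; [ exact Hh0 | ].
  apply Rle_trans with ((a + b + 1) * (eps / (2 * (a + b + 1)))).
  + apply Rmult_le_compat; lra.
  + right. field. lra.
Qed.

Lemma is_derive_Hinf_group (c : R) (y : R -> H) (t : R) (y' : H) :
  (forall s, Hinf P (y s)) -> is_derive_Hinf P y t y' ->
  is_derive_Hinf P (fun s => group (cfc P) (c * s) (y s)) t
    (group (cfc P) (c * t) (plus y' (scal (Cmult Ci (RtoC c)) (P (y t))))).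
Proof.
intros Hy. rewrite !is_derive_Hinf_iff; try assumption;
  [ | intros s; now apply Hinf_group ].
intros [Hv L].
assert (HPy : Hinf P (P (y t))) by now apply Hinf_app.
assert (Hz : Hinf P (plus y' (scal (Cmult Ci (RtoC c)) (P (y t)))))
  by (apply Hinf_plus; [ exact Hv | now apply Hinf_scal ]).
split; [ now apply Hinf_group | ]. intros k.
rewrite shift_pow_group, shift_pow_plus, shift_pow_scal, shift_pow_app;
  try assumption; try apply Hy; try now apply Hinf_scal.
assert (Dk : forall x, Hinf P x -> dom P (shift_pow k x))
  by (intros x Hx; now apply Hinf_dom, Hinf_shift_pow).
pose proof (norm_derive_group c (fun s => shift_pow k (y s)) t (shift_pow k y')
  (Dk _ (Hy t)) (Hinf_dom _ (Hinf_app _ (Hinf_shift_pow k _ (Hy t)))) (Dk _ Hv) (L k)) as Q.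
apply is_lim_ext with (2 := Q). intros h. now rewrite !shift_pow_group.
Qed.

Lemma is_derive_Hinf_continuous (u : R -> H) (t : R) (v : H) (k : nat) :
  (forall s, Hinf P (u s)) -> is_derive_Hinf P u t v ->
  @continuous R_UniformSpace (real_scalars H) (fun s => shift_pow k (u s)) t.
Proof.
intros Hu Hv. apply is_derive_Hinf_iff in Hv; [ | exact Hu ].
exact (norm_derive_continuous _ t _ (proj2 Hv k)).
Qed.

Lemma resolvent_iter_linear (k : nat) :
  (forall x y, Nat.iter k (resolvent P Ci) (plus x y) =
     plus (Nat.iter k (resolvent P Ci) x) (Nat.iter k (resolvent P Ci) y)) /\
  (forall (c : C) x, Nat.iter k (resolvent P Ci) (scal c x) =
     scal c (Nat.iter k (resolvent P Ci) x)) /\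
  (forall x, norm (Nat.iter k (resolvent P Ci) x) <= 1 * norm x).
Proof.
induction k as [|k [Hp [Hs Hn]]].
- repeat split; intros; cbn; lra.
- split; [ | split ].
  + intros x y. now rewrite !Nat.iter_succ, Hp, resolvent_plus.
  + intros c x. now rewrite !Nat.iter_succ, Hs, resolvent_scal.
  + intros x. rewrite Nat.iter_succ. eapply Rle_trans; [ | apply Hn ].
    set (w := Nat.iter k (resolvent P Ci) x).
    eapply Rle_trans; [ apply (norm_le_shift P Psa Ci _ iu) | ].
    * now apply dom_resolvent.
    * rewrite shift_resolvent by assumption. lra.
Qed.

(* [shift_pow] is unbounded, so it is moved through the integral by means of its
   bounded inverse. *)
Lemma is_derive_Hinf_RInt (w : R -> H) : (forall s, Hinf P (w s)) ->
  (forall k s, @continuous R_UniformSpace (real_scalars H) (fun s => shift_pow k (w s)) s) ->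
  (forall t, Hinf P (@RInt (real_scalars H) w 0 t)) /\
  (forall t, is_derive_Hinf P (fun t => @RInt (real_scalars H) w 0 t) t (w t)).
Proof.
intros Hw Hc.
assert (Ex : forall k t, @ex_RInt (real_scalars H) (fun s => shift_pow k (w s)) 0 t).
{ intros k t. apply (@ex_RInt_continuous (real_scalars H)). intros z _. apply Hc. }
(* The right-hand side is visibly in the domain of P^k, and (P + i)^k cancels against the resolvents
   to leave an ordinary integral in H. *)
assert (E : forall k t, @RInt (real_scalars H) w 0 t =
  Nat.iter k (resolvent P Ci) (@RInt (real_scalars H) (fun s => shift_pow k (w s)) 0 t)).
{ intros k t. destruct (resolvent_iter_linear k) as [Lp [Ls Ln]].
  apply (@is_RInt_unique (real_scalars H)).
  apply (@is_RInt_ext (real_scalars H)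
    (fun s => Nat.iter k (resolvent P Ci) (shift_pow k (w s)))).
  - intros s _. now apply resolvent_iter_shift_pow.
  - apply (is_RInt_linear _ 1); try assumption.
    apply (@RInt_correct (real_scalars H)), Ex. }
assert (HI : forall t, Hinf P (@RInt (real_scalars H) w 0 t)).
{ intros t k. rewrite (E k t). apply dom_pow_resolvent_iter. }
split; [ exact HI | ]. intros t. apply is_derive_Hinf_iff; [ exact HI | ].
split; [ apply Hw | ]. intros k.
apply is_lim_ext with (2 := norm_derive_RInt _ (Hc k) t).
intros h. now rewrite !(E k), !shift_pow_resolvent_iter.
Qed.

Lemma smooth_Hinf_spec (f : R -> H) : smooth_Hinf P f ->
  exists d : nat -> R -> H, d 0%nat = f /\ (forall n t, Hinf P (d n t)) /\
    (forall n t, is_derive_Hinf P (d n) t (d (S n) t)).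
Proof.
intros [d [E [Hd Dd]]]. exists d.
split; [ now apply functional_extensionality | now split ].
Qed.

Lemma cauchy_homogeneous_unique (z z' : R -> H) :
  (forall t, Hinf P (z t)) -> (forall t, is_derive_Hinf P z t (z' t)) ->
  (forall t, plus (z' t) (scal Ci (P (z t))) = zero) -> z 0 = zero ->
  forall t, z t = zero.
Proof.
intros Hz Dz Ez z0 t. pose proof (cfc_is_functional_calculus P Preg Psa) as HP.
set (V := group (cfc P)).
assert (D : forall s, norm_derive (fun s => V (1 * s) (z s)) s zero).
{ intros s. pose proof (is_derive_Hinf_group 1 z s (z' s) Hz (Dz s)) as Q.
  apply is_derive_Hinf_iff in Q; [ | intros r; now apply Hinf_group ].
  (* Order k = 0 is the derivative in H, which is enough to conclude that the function is
     constant. *)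
  destruct Q as [_ Q]. specialize (Q 0%nat). cbn in Q.
  replace (plus (z' s) (scal (Cmult Ci (RtoC 1)) (P (z s)))) with (@zero H) in Q.
  - rewrite (group_zero P _ HP) in Q. exact Q.
  - rewrite <- (Ez s). vring H. }
pose proof (norm_derive_zero_constant _ D t 0) as E. cbn beta in E.
apply norm_le_zero. rewrite <- (norm_group P _ HP (1 * t)). fold V. rewrite E, z0.
unfold V. rewrite (norm_group P _ HP), norm_zero_C. lra.
Qed.

End CauchyProblem.

Theorem theorem1 (A : CStarAlgebra) (H : HilbertModule A) (P : Operator H)
    (Pregular : regular P) (Pselfadjoint : selfadjoint P)
    (f : R -> H) (fsmooth : smooth_Hinf P f) (g : H) (gHinf : Hinf P g) :
  exists u : R -> H,
    (smooth_Hinf P u /\ solves_cauchy P f g u) /\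
    (forall v : R -> H, smooth_Hinf P v -> solves_cauchy P f g v -> v = u) /\
    (forall t : R,
       @ex_RInt (real_scalars H) (fun s => exp_i P (s - t) (f s)) 0 t /\
       u t = plus (exp_i P (- t) g)
               (@RInt (real_scalars H) (fun s => exp_i P (s - t) (f s)) 0 t)).
Proof.
pose proof (cfc_is_functional_calculus P Pregular Pselfadjoint) as HP.
destruct (smooth_Hinf_spec P f fsmooth) as [fd [Ef [Hfd Dfd]]].
assert (Hf : forall t, Hinf P (f t)) by (intros t; rewrite <- Ef; apply Hfd).
set (V := group (cfc P)).
(* Pulling e^(-itP) out of the integral leaves an integrand free of t; the factor 1 fits the general
   form [c * s] of [is_derive_Hinf_group]. *)
set (w := fun s => V (1 * s) (f s)).
assert (Hw : forall s, Hinf P (w s)) by (intros s; now apply Hinf_group).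
assert (Dw : forall s, exists w', is_derive_Hinf P w s w').
{ intros s. eexists. apply is_derive_Hinf_group; try assumption.
  rewrite <- Ef. apply Dfd. }
assert (Cw : forall k s,
  @continuous R_UniformSpace (real_scalars H) (fun s => shift_pow P k (w s)) s).
{ intros k s. destruct (Dw s) as [w' Hw'].
  now apply (is_derive_Hinf_continuous P Pregular Pselfadjoint w s w'). }
destruct (is_derive_Hinf_RInt P Pregular Pselfadjoint w Hw Cw) as [HF DF].
set (F := fun t => @RInt (real_scalars H) w 0 t) in *.
set (y := fun t => plus g (F t)).
assert (Hy : forall t, Hinf P (y t)) by (intros t; apply Hinf_plus; auto; apply HF).
assert (Dg : forall t, is_derive_Hinf P (fun _ => g) t zero).
{ intros t. apply is_derive_Hinf_iff; auto. split.
  - replace (@zero H) with (scal (RtoC 0) g) by vring H. now apply Hinf_scal.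
  - intros k.
    replace (shift_pow P k zero) with (@zero H); [ apply norm_derive_const | ].
    transitivity (shift_pow P k (scal (RtoC 0) g)); [ | f_equal; vring H ].
    rewrite shift_pow_scal by assumption. vring H. }
assert (Dy : forall t, is_derive_Hinf P y t (w t)).
{ intros t. replace (w t) with (plus zero (w t)) by vring H.
  apply is_derive_Hinf_plus; auto. }
set (u := fun t => V (- 1 * t) (y t)).
assert (Hu : forall t, Hinf P (u t)) by (intros t; now apply Hinf_group).
assert (Cancel : forall t x, V (- 1 * t) (V (1 * t) x) = x).
{ intros t x. unfold V. rewrite <- (group_add P _ HP).
  replace (- 1 * t + 1 * t) with 0 by ring. apply (group_0 P _ HP). }
(* The product rule with c = -1 gives e^(-itP)(w - iPy); the first term collapses to f and P
   commutes with the group in the second. *)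
assert (Du : forall t, is_derive_Hinf P u t (plus (f t) (scal (Copp Ci) (P (u t))))).
{ intros t.
  pose proof (is_derive_Hinf_group P Pregular Pselfadjoint (- 1) y t (w t) Hy (Dy t)) as Q.
  fold V in Q.
  replace (V (- 1 * t) (plus (w t) (scal (Cmult Ci (RtoC (- 1))) (P (y t)))))
    with (plus (f t) (scal (Copp Ci) (P (u t)))) in Q; [ exact Q | ].
  unfold V at 1. rewrite (group_plus P _ HP), (group_scal P _ HP). fold V.
  unfold w at 1. rewrite Cancel. unfold u, V.
  rewrite (app_group P Pregular Pselfadjoint _ HP) by now apply Hinf_dom. vring H. }
(* The bounded operator e^(-itP) is put back under the integral sign, where it combines with
   e^(isP). *)
assert (Eu : forall t,
  @is_RInt (real_scalars H) (fun s => exp_i P (s - t) (f s)) 0 t (V (- 1 * t) (F t))).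
{ intros t. apply (@is_RInt_ext (real_scalars H) (fun s => V (- 1 * t) (w s))).
  - intros s _. unfold w, V. rewrite <- (group_add P _ HP).
    replace (- 1 * t + 1 * s) with (s - t) by ring. reflexivity.
  - apply (is_RInt_linear _ 1).
    + intros x1 x2. apply (group_plus P _ HP).
    + intros c x. apply (group_scal P _ HP).
    + intros x. unfold V. rewrite (norm_group P _ HP). lra.
    + apply (@RInt_correct (real_scalars H)), (@ex_RInt_continuous (real_scalars H)).
      intros s _. exact (Cw 0%nat s). }
assert (Sol : solves_cauchy P f g u).
{ split.
  - exists (fun t => plus (f t) (scal (Copp Ci) (P (u t)))). split; [ exact Du | ].
    intros t. vring H.
  - unfold u, y, F. rewrite (@RInt_point (real_scalars H)).
    transitivity (V (- 1 * 0) g); [ f_equal; exact (plus_zero_r g) | ].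
    rewrite Rmult_0_r. apply (group_0 P _ HP). }
exists u. split; [ split; [ | exact Sol ] | split ].
(* The equation u' = f - iPu, differentiated n times, prescribes the higher derivatives of u. *)
- set (d := fix d (n : nat) : R -> H := match n with
    | O => u
    | S m => fun t => plus (fd m t) (scal (Copp Ci) (P (d m t)))
    end).
  assert (Hd : forall n t, Hinf P (d n t)).
  { induction n as [|n IH]; intros t; cbn; [ apply Hu | ].
    apply Hinf_plus; [ assumption | apply Hfd | ].
    apply Hinf_scal; [ assumption | ]. now apply Hinf_app. }
  exists d. split; [ reflexivity | split; [ exact Hd | ] ].
  induction n as [|n IH]; intros t.
  + cbn. rewrite Ef. apply Du.
  + apply (is_derive_Hinf_plus P Pregular Pselfadjoint (fd n)
      (fun t => scal (Copp Ci) (P (d n t)))).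
    * apply Hfd.
    * intros s. apply Hinf_scal, Hinf_app; auto.
    * apply Dfd.
    * apply is_derive_Hinf_scal; [ assumption | assumption | | ].
      -- intros s. apply Hinf_app, Hd.
      -- now apply is_derive_Hinf_app.
- intros v vsmooth [[dv [Dv Ev]] v0].
  destruct (smooth_Hinf_spec P v vsmooth) as [vd [Evd [Hvd _]]].
  assert (Hv : forall t, Hinf P (v t)) by (intros t; rewrite <- Evd; apply Hvd).
  apply functional_extensionality. intros t.
  (* The difference is written with a scalar -1 so that the rules for sums and multiples apply
     directly. *)
  set (z := fun t => plus (v t) (scal (Copp (RtoC 1)) (u t))).
  enough (Z : z t = zero).
  { transitivity (plus (z t) (u t)); [ unfold z; vring H | rewrite Z; vring H ]. }
  destruct Sol as [[du [Du' Eu']] u0].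
  apply (cauchy_homogeneous_unique P Pregular Pselfadjoint z
    (fun t => plus (dv t) (scal (Copp (RtoC 1)) (du t)))).
  + intros s. apply Hinf_plus; auto. now apply Hinf_scal.
  + intros s. apply is_derive_Hinf_plus; auto; [ intros r; now apply Hinf_scal | ].
    now apply is_derive_Hinf_scal.
  + intros s. unfold z.
    assert (Dvs : dom P (v s)) by now apply Hinf_dom.
    assert (Dus : dom P (u s)) by now apply Hinf_dom.
    rewrite app_plus, app_scal by (try apply dom_scal; assumption).
    transitivity (minus (plus (dv s) (scal Ci (P (v s)))) (plus (du s) (scal Ci (P (u s)))));
      [ vring H | ].
    rewrite Ev, Eu'. vring H.
  + unfold z. rewrite v0, u0. vring H.
- intros t. split; [ eexists; apply Eu | ].
  rewrite (@is_RInt_unique (real_scalars H) _ _ _ _ (Eu t)).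
  unfold u, y, V. rewrite (group_plus P _ HP). f_equal.
  unfold exp_i. replace (- t) with (- 1 * t) by ring. reflexivity.
Qed.
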